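(* Suppose that no algorithm solves every Dictionary Matching instance in $o(n/\sqrt{\log n})$ time. Let $P(n)$ and $Q(n)$ denote the preprocessing time and query time of any data structure for suffix array queries over a binary text of length $n$. Then no such data structure can satisfy $$P(n)+\frac{n(1+\log\log n)}{\log n}\,(Q(n)+1)=o\!\left(\frac{n}{\sqrt{\log n}}\right).$$ In particular, no such data structure can simultaneously have $P(n)=o(n/\sqrt{\log n})$ and query time $Q(n)=o(\sqrt{\log n}/(1+\log\log n))$.
   Context: Logarithms are binary; $[a..b]=\{k\in\mathbb Z:a\le k\le b\}$; strings are indexed from $1$. Dictionary Matching problem: let $n\ge2$ and $k,m\ge1$ be integers with $k=\Theta(n/\log n)$ and $m=\Theta(\log n)$. The input consists of the packed representation of a text $T\in\{0,1\}^n$ and the packed representations of a collection $\mathcal D=\{P_1,\dots,P_k\}\subseteq\{0,1\}^m$ of patterns. The output is YES if some $P_i$ occurs in $T$ as a substring, and NO otherwise. The model is the word RAM with word size $w=c\log n$, $c\ge2$ constant (standard arithmetic and bitwise word operations take $O(1)$ time). For a text $T$ of length $n$, $\mathrm{SA}_T[i]$ is the starting position of the lexicographically $i$th smallest suffix of $T$ (a proper prefix of a string is smaller than the string). A data structure for suffix array queries is built by a preprocessing algorithm from the packed representation of a binary text $T$ of length $n$ in $P(n)$ time and, given $i\in[1..n]$, returns $\mathrm{SA}_T[i]$ in $Q(n)$ time. The packed representation of a binary string with word size $w$ stores $w$ consecutive bits per word (earlier bits in lower-order positions), with unused bits of the last word set to $0$. *)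

(* Defs.v *)
From Stdlib Require PeanoNat.
From HB Require Import structures.
From mathcomp Require Import all_boot all_order all_algebra.
From mathcomp Require Import all_classical all_reals all_analysis.
Set Implicit Arguments.
Unset Strict Implicit.
Unset Printing Implicit Defensive.
Import Order.TTheory GRing.Theory Num.Theory.
Import numFieldNormedType.Exports.

Local Open Scope nat_scope.

(** * Word RAM

    A word is a natural number below [2 ^ w].  A program has finitely many
    registers and finitely many memory banks; each bank is an array of words
    addressed by a word.  Having a constant number of banks instead of a single
    one makes disjoint memory areas available to a caller and its subroutines.
    Control flow is structured.  Every instruction but [Skip] and every test of a
    condition takes one unit of time.  A program is a fixed text, independent
    of the word size and of the input. *)

Inductive binop :=
  | OpAdd | OpSub | OpMul | OpDiv | OpMod
  | OpAnd | OpOr | OpXor | OpShl | OpShr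
  | OpEq | OpLt.

Definition trunc_word (w x : nat) : nat := x %% 2 ^ w.

(* [OpSub] is subtraction modulo [2 ^ w]; division by zero yields [0] and the
   remainder modulo zero is the dividend. *)
Definition binop_sem (w : nat) (o : binop) (x y : nat) : nat :=
  trunc_word w
    match o with
    | OpAdd => x + y
    | OpSub => x + (2 ^ w - y)
    | OpMul => x * y
    | OpDiv => x %/ y
    | OpMod => x %% y
    | OpAnd => PeanoNat.Nat.land x y
    | OpOr  => PeanoNat.Nat.lor x y
    | OpXor => PeanoNat.Nat.lxor x y
    | OpShl => x * 2 ^ y
    | OpShr => x %/ 2 ^ y
    | OpEq  => x == y
    | OpLt  => x < y
    end.

Inductive prog :=
  | Skip
  | SetConst of nat & nat             (* [SetConst r v]: r := v *)
  | BinOp of binop & nat & nat & nat  (* [BinOp o r x y]: r := x o y *)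
  | Read of nat & nat & nat           (* [Read r b a]: r := bank b at a *)
  | Write of nat & nat & nat          (* [Write b a r]: bank b at a := r *)
  | Seq of prog & prog
  | If of nat & prog & prog
  | While of nat & prog.

Record state := State {
  reg  : nat -> nat;
  bank : nat -> nat -> nat }.

Definition set_reg (s : state) (r v : nat) : state :=
  State [eta reg s with r |-> v] (bank s).

Definition set_mem (s : state) (b a v : nat) : state :=
  State (reg s)
    (fun b' a' => if (b' == b) && (a' == a) then v else bank s b' a').

(* [exec w p s t s']: with word size [w], the program [p] started in [s] halts
   in [s'] after exactly [t] units of time. *)
Inductive exec (w : nat) : prog -> state -> nat -> state -> Prop :=
  | exec_skip s :
      exec w Skip s 0 s
  | exec_const s r v :
      exec w (SetConst r v) s 1 (set_reg s r (trunc_word w v))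
  | exec_binop s o r x y :
      exec w (BinOp o r x y) s 1
        (set_reg s r (binop_sem w o (reg s x) (reg s y)))
  | exec_read s r b a :
      exec w (Read r b a) s 1 (set_reg s r (bank s b (reg s a)))
  | exec_write s b a r :
      exec w (Write b a r) s 1 (set_mem s b (reg s a) (reg s r))
  | exec_seq p q s t s' u s'' :
      exec w p s t s' -> exec w q s' u s'' -> exec w (Seq p q) s (t + u) s''
  | exec_if_true r p q s t s' :
      reg s r != 0 -> exec w p s t s' -> exec w (If r p q) s t.+1 s'
  | exec_if_false r p q s t s' :
      reg s r = 0 -> exec w q s t s' -> exec w (If r p q) s t.+1 s'
  | exec_while_true r p s t s' u s'' :
      reg s r != 0 -> exec w p s t s' -> exec w (While r p) s' u s'' ->
      exec w (While r p) s (t + u).+1 s''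
  | exec_while_false r p s :
      reg s r = 0 -> exec w (While r p) s 1 s.

Definition log2 {R : realType} (x : R) : R := (ln x / ln 2)%R.

(* Word size [c * log n], rounded up to an integer. *)
Definition word_size {R : realType} (c : R) (n : nat) : nat :=
  `|Num.ceil (c * log2 n%:R)%R|%N.

(** * Packed strings *)

Definition num_words (w l : nat) : nat := (l + w.-1) %/ w.

Definition packed_word (w : nat) (s : seq bool) (j : nat) : nat :=
  \sum_(t < w) nth false s (j * w + t) * 2 ^ t.

Definition packed (w : nat) (s : seq bool) : seq nat :=
  mkseq (packed_word w s) (num_words w (size s)).

(* The initial state: the first registers and banks hold the inputs, all other
   registers and memory cells are zero. *)
Definition init_state (regs : seq nat) (banks : seq (seq nat)) : state :=
  State (nth 0 regs) (fun b => nth 0 (nth [::] banks b)).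

(** * Dictionary matching *)

Definition dm_answer (T : seq bool) (D : seq (seq bool)) : bool :=
  has (fun P => infix P T) D.

Definition dm_input (w n k m : nat) (T : seq bool) (D : seq (seq bool)) :
    state :=
  init_state [:: n; k; m]
    [:: packed w T; flatten [seq packed w P | P <- D]].

(* The conditions [k = Theta (n / log n)] and [m = Theta (log n)], with the
   hidden constants made explicit. *)
Definition dm_size {R : realType} (a1 a2 b1 b2 : R) (n k m : nat) : Prop :=
  [/\ 2 <= n, 1 <= k, 1 <= m,
      (a1 * (n%:R / log2 n%:R) <= k%:R <= a2 * (n%:R / log2 n%:R))%R &
      (b1 * log2 n%:R <= m%:R <= b2 * log2 n%:R)%R].

(* The input can be addressed by the machine.  For fixed constants in
   [dm_size] this only excludes finitely many instances. *)
Definition dm_fits (w k m : nat) : Prop :=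
  m < 2 ^ w /\ k * num_words w m < 2 ^ w.

(* [p] decides all instances within time [t n]; YES is [1] and NO is [0]. *)
Definition solves_dm {R : realType} (c a1 a2 b1 b2 : R)
    (p : prog) (t : nat -> nat) : Prop :=
  forall (n k m : nat) (T : n.-tuple bool) (D : k.-tuple (m.-tuple bool)),
    dm_size a1 a2 b1 b2 n k m ->
    dm_fits (word_size c n) k m ->
    let D' := [seq tval P | P <- D] in
    exists (u : nat) (s : state),
      [/\ exec (word_size c n) p (dm_input (word_size c n) n k m T D') u s,
          u <= t n &
          reg s 0 = dm_answer T D'].

(** * Suffix array queries *)

(* [seqlexi bool] is ordered lexicographically with [false < true]; a proper
   prefix is smaller. *)
Definition suffix_le (T : seq bool) (p q : nat) : bool :=
  ((drop p.-1 T : seqlexi bool) <= (drop q.-1 T : seqlexi bool))%O.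

Definition suffix_array (T : seq bool) (i : nat) : nat :=
  nth 0 (sort (suffix_le T) (iota 1 (size T))) i.-1.

(* A query receives its argument in register 0.  Everything else is as it was
   left by the preprocessing or by the previous query, so that queries may
   modify the data structure. *)
Inductive sa_reachable (w n : nat) (prep query : prog) (s0 : state) :
    state -> Prop :=
  | sa_after_prep t s :
      exec w prep s0 t s -> sa_reachable w n prep query s0 s
  | sa_after_query s i t s' :
      sa_reachable w n prep query s0 s -> 1 <= i <= n ->
      exec w query (set_reg s 0 i) t s' -> sa_reachable w n prep query s0 s'.

Definition sa_data_structure {R : realType} (c : R) (prep query : prog)
    (P Q : nat -> nat) : Prop :=
  forall (n : nat) (T : n.-tuple bool),
    2 <= n ->
    let w := word_size c n in
    let s0 := init_state [:: n] [:: packed w T] in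
    (exists (t : nat) (s : state), exec w prep s0 t s /\ t <= P n) /\
    (forall (s : state) (i : nat),
       sa_reachable w n prep query s0 s -> 1 <= i <= n ->
       exists (t : nat) (s' : state),
         [/\ exec w query (set_reg s 0 i) t s',
             t <= Q n &
             reg s' 0 = suffix_array T i]).

(* Main.v *)
(** A data structure for suffix array queries on the text itself decides dictionary
    matching.  The k patterns of Theta(log n) bits are radix sorted in time O(k + sqrt n)
    with digits of about half of log n bits.  The sorted patterns are then located one
    after the other in the suffix array, each search starting at the rank found for its
    predecessor: gallop in steps of w, the word size, then bisect the last step.
    Galloping costs n / w steps for all patterns together and each bisection costs
    log w = O(1 + log log n) steps, so that O(n (1 + log log n) / log n) queries suffice.
    A step compares a pattern with a suffix word by word; the first difference is the
    lowest set bit of an exclusive or, since earlier bits have lower order.  A pattern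
    that occurs is a prefix of the first suffix not below it, and its search ends with
    a comparison with that suffix.

    The constants of the program (digit size, and a bound on the number of words of a
    pattern) depend on c and b2 only.  Overflow is excluded for large n; for the finitely
    many small n the answer is read off a decision tree on the input words. *)

Require Import Defs.
From Stdlib Require PeanoNat.
From HB Require Import structures.
From mathcomp Require Import all_boot all_order all_algebra.
From mathcomp Require Import all_classical all_reals all_analysis.
From mathcomp Require Import zify ring lra.
Set Implicit Arguments.
Unset Strict Implicit.
Unset Printing Implicit Defensive.
Import Order.TTheory GRing.Theory Num.Theory.
Import numFieldNormedType.Exports.
Local Open Scope nat_scope.

(** * Binary digits *)

(** Treating the patterns independently is too slow: bisecting the whole suffix array for each of
    Theta(n / log n) patterns takes Theta(n) queries, and sorting the patterns by comparisons also
    takes time of order n. Sorted order makes the rank monotone, so that galloping is paid once for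
    the whole array; the step w balances n / w galloping steps against an interval of only w ranks
    left to bisect. The data structure is an arbitrary pair of programs: it may use any register and
    bank, expects a fresh memory, and may alter its own state at every query. It is therefore run
    with its registers and banks shifted to a zone disjoint from that of the caller, and all that is
    known of its state between queries is that it is reachable. The program text must not depend on
    n, so quantities such as the word size are computed at run time. Programs are verified with
    weakest preconditions and a ghost clock, which yields correctness and time together. *)

Definition bit (x i : nat) : bool := odd (x %/ 2 ^ i).

Lemma bit0 x : bit x 0 = odd x.
Proof. by rewrite /bit divn1. Qed.

Lemma bitS x i : bit x i.+1 = bit x./2 i.
Proof. by rewrite /bit expnS divnMA divn2. Qed.

Lemma bitD x r i : bit x (r + i) = bit (x %/ 2 ^ r) i.
Proof. by rewrite /bit expnD divnMA. Qed.

(** Makes the library specifications of the bitwise operations available for [bit]. *)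
Lemma testbitE x i : PeanoNat.Nat.testbit x i = bit x i.
Proof.
elim: i x => [|i IH] x.
  rewrite PeanoNat.Nat.bit0_odd bit0; elim: x => // x IH.
  by rewrite PeanoNat.Nat.odd_succ -PeanoNat.Nat.negb_odd IH.
rewrite bitS -IH /=; congr PeanoNat.Nat.testbit.
by elim/ltn_ind: x => -[|[|x]] //= /(_ x)->.
Qed.

Lemma bit_land x y i : bit (PeanoNat.Nat.land x y) i = bit x i && bit y i.
Proof. by rewrite -!testbitE PeanoNat.Nat.land_spec. Qed.
Lemma bit_lor x y i : bit (PeanoNat.Nat.lor x y) i = bit x i || bit y i.
Proof. by rewrite -!testbitE PeanoNat.Nat.lor_spec. Qed.
Lemma bit_lxor x y i : bit (PeanoNat.Nat.lxor x y) i = (bit x i != bit y i).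
Proof.
rewrite -!testbitE PeanoNat.Nat.lxor_spec.
by case: PeanoNat.Nat.testbit; case: PeanoNat.Nat.testbit.
Qed.

Lemma bit_high w x i : x < 2 ^ w -> w <= i -> bit x i = false.
Proof.
by move=> xw wi; rewrite /bit divn_small // (leq_trans xw) // leq_exp2l.
Qed.

Lemma eq_from_bit w x y : x < 2 ^ w -> y < 2 ^ w ->
  (forall i, i < w -> bit x i = bit y i) -> x = y.
Proof.
elim: w x y => [|w IH] x y; first by rewrite !ltnS !leqn0 => /eqP-> /eqP->.
rewrite expnS => xw yw e.
rewrite -(odd_double_half x) -(odd_double_half y) -!bit0 e //.
congr (_ + _.*2); apply: IH => [||i iw]; [lia|lia|].
by rewrite -!bitS e.
Qed.

Lemma bit_mod w x i : bit (x %% 2 ^ w) i = (i < w) && bit x i.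
Proof.
case: (ltnP i w) => iw; last by rewrite (bit_high (w := w)) // ltn_mod expn_gt0.
(* For [i < w] the part of [x] from bit [w] on contributes an even number to the quotient by
   [2 ^ i]. *)
have e : x = x %/ 2 ^ w * 2 ^ (w - i) * 2 ^ i + x %% 2 ^ w.
  by rewrite -mulnA -expnD subnK ?(ltnW iw) // -divn_eq.
rewrite /bit [in RHS]e divnMDl ?expn_gt0 // oddD oddM oddX subn_eq0.
by rewrite leqNgt iw andbF.
Qed.

Lemma bit_shl x r i : bit (x * 2 ^ r) i = (r <= i) && bit x (i - r).
Proof.
case: leqP => ri; first by rewrite -{1}(subnKC ri) bitD mulnK // expn_gt0.
rewrite -(subnKC (ltnW ri)) expnD mulnCA /bit mulKn ?expn_gt0 //.
by rewrite -(subnSK ri) expnS mulnCA oddM.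
Qed.

Lemma sum_bits_lt w (b : nat -> bool) : \sum_(t < w) b t * 2 ^ t < 2 ^ w.
Proof.
elim: w => [|w IH]; first by rewrite big_ord0.
rewrite big_ord_recr /= expnS mul2n -addnn.
by case: (b w); rewrite ?mul1n ?mul0n ?addn0 ?ltn_add2r // ltn_addr.
Qed.

Lemma bit_sum_bits w (b : nat -> bool) i :
  bit (\sum_(t < w) b t * 2 ^ t) i = (i < w) && b i.
Proof.
elim: w b i => [|w IH] b i; first by rewrite big_ord0 /bit div0n.
rewrite big_ord_recl muln1.
have -> : \sum_(i0 < w) b (bump 0 i0) * 2 ^ (bump 0 i0) =
          (\sum_(t < w) b t.+1 * 2 ^ t).*2.
  rewrite -mul2n big_distrr /=; apply: eq_bigr => t _.
  by rewrite /bump /= add1n expnS; lia.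
case: i => [|i]; first by rewrite bit0 oddD odd_double addbF oddb.
by rewrite bitS half_bit_double (IH (fun t => b t.+1)).
Qed.

Lemma bit_sub q e i : q < 2 ^ e -> i < e -> bit (2 ^ e - 1 - q) i = ~~ bit q i.
Proof.
elim: e q i => [|e IH] q i //; rewrite expnS => qe.
case: i => [|i] ie; first by rewrite !bit0; lia.
rewrite !bitS -IH //; last lia.
congr bit; lia.
Qed.

(** In two's complement, negation keeps the bits up to the lowest set bit and complements those
    above it, so the conjunction isolates that bit. The induction halves an even [x] and stops at an
    odd one. *)
Lemma land_negw w x : 0 < x < 2 ^ w -> exists v,
  [/\ v < w, PeanoNat.Nat.land x (2 ^ w - x) = 2 ^ v, bit x v &
      forall i, i < v -> ~~ bit x i].
Proof.
elim: w x => [|w IH] x; first by lia.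
rewrite expnS => xw; case ox: (odd x); last first.
  have [|v [vw e bv lo]] := IH x./2; first lia.
  exists v.+1; split; rewrite ?bitS //; last first.
    by case=> [|i] iv; rewrite ?bit0 ?ox // bitS lo.
  apply: (@eq_from_bit w.+2) => [|| i _].
  - apply: leq_ltn_trans (_ : x < _); last by rewrite !expnS; lia.
    by apply/ssrnat.leP/PeanoNat.Nat.land_le_l.
  - by rewrite ltn_exp2l //; lia.
  rewrite bit_land; case: i => [|i]; first by rewrite !bit0 ox expnS; lia.
  rewrite !bitS; have -> : (2 * 2 ^ w - x)./2 = 2 ^ w - x./2 by lia.
  by rewrite -bit_land e expnS; congr bit; lia.
exists 0; split=> //; rewrite ?bit0 //.
apply: (@eq_from_bit w.+2) => [|| i iw].
- apply: leq_ltn_trans (_ : x < _); last by rewrite !expnS; lia.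
  by apply/ssrnat.leP/PeanoNat.Nat.land_le_l.
- by rewrite -[2 ^ 0]/(2 ^ 0) ltn_exp2l.
rewrite bit_land; case: i iw => [|i] iw; first by rewrite !bit0; lia.
rewrite !bitS.
(* For odd [x] the half of the negation is the complement of the half, so only bit 0 is common. *)
have -> : (2 * 2 ^ w - x)./2 = 2 ^ w - 1 - x./2 by lia.
case: (ltnP i w) => iw'; last by rewrite (@bit_high w x./2) //; rewrite /bit ?div0n //; lia.
rewrite bit_sub //; last lia.
by rewrite andbN /bit div0n.
Qed.

Lemma regE s r v x : reg (set_reg s r v) x = if x == r then v else reg s x.
Proof. by []. Qed.

Lemma state_eq s s' : reg s =1 reg s' -> bank s =2 bank s' -> s = s'.
Proof.
case: s s' => r b [r' b'] /= er eb; congr State; apply: funext => // x.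
by apply: funext => y; apply: eb.
Qed.

(** * Running a program as a subroutine *)

(** Boundary between the caller, with its variables, temporaries and arrays, and the subroutine,
    which owns everything above. *)
Definition reg_off := 60.
Definition bank_off := 8.

Fixpoint relocate (p : prog) : prog :=
  match p with
  | Skip => Skip
  | SetConst r v => SetConst (reg_off + r) v
  | BinOp o r x y => BinOp o (reg_off + r) (reg_off + x) (reg_off + y)
  | Read r b a => Read (reg_off + r) (bank_off + b) (reg_off + a)
  | Write b a r => Write (bank_off + b) (reg_off + a) (reg_off + r)
  | Seq p q => Seq (relocate p) (relocate q)
  | If r p q => If (reg_off + r) (relocate p) (relocate q)
  | While r p => While (reg_off + r) (relocate p)
  end.

Definition substate (s : state) : state :=
  State (fun r => reg s (reg_off + r)) (fun b => bank s (bank_off + b)).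

Lemma substate_set_reg s r v :
  substate (set_reg s (reg_off + r) v) = set_reg (substate s) r v.
Proof. by apply: state_eq => // x /=; rewrite eqn_add2l. Qed.

Lemma substate_set_mem s b a v :
  substate (Defs.set_mem s (bank_off + b) a v) = Defs.set_mem (substate s) b a v.
Proof. by apply: state_eq => // x y /=; rewrite eqn_add2l. Qed.

Definition same_caller (s s' : state) : Prop :=
  (forall r, r < reg_off -> reg s' r = reg s r) /\
  (forall b, b < bank_off -> bank s' b = bank s b).

Lemma same_caller_trans s s' s'' :
  same_caller s s' -> same_caller s' s'' -> same_caller s s''.
Proof.
by move=> [r b] [r' b']; split=> x xo; rewrite ?r' ?b' ?r ?b.
Qed.

Lemma same_caller_set_reg s r v : same_caller s (set_reg s (reg_off + r) v).
Proof. by split=> // x xo; rewrite regE; case: eqP => // e; lia. Qed.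

(** The shift of registers and banks is injective and disjoint from the zone of the caller, so each
    instruction is simulated by one instruction and the time is unchanged. *)
Lemma exec_relocate w p s t s' : exec w p (substate s) t s' ->
  exists s2, [/\ exec w (relocate p) s t s2, substate s2 = s' & same_caller s s2].
Proof.
move e: (substate s) => s0 ex; elim: ex s e => {s0 p t s'}.
- by move=> s0 s <-; exists s; split=> //; apply: exec_skip.
- move=> s0 r v s <-; exists (set_reg s (reg_off + r) (trunc_word w v)).
  split; [exact: exec_const|exact: substate_set_reg|exact: same_caller_set_reg].
- move=> s0 o r x y s <-; eexists; split; [exact: exec_binop| |exact: same_caller_set_reg].
  exact: substate_set_reg.
- move=> s0 r b a s <-; eexists; split; [exact: exec_read| |exact: same_caller_set_reg].
  exact: substate_set_reg.
- move=> s0 b a r s <-; eexists; split; [exact: exec_write|exact: substate_set_mem|].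
  split=> // x xo; apply: funext => y /=; case: eqP => // exb; lia.
- move=> p q s0 t s' u s'' _ IHp _ IHq s /IHp[s1 [ep e1 c1]].
  have [s2 [eq e2 c2]] := IHq _ e1; exists s2; split=> //; first exact: exec_seq ep eq.
  exact: same_caller_trans c1 c2.
- move=> r p q s0 t s' r0 _ IH s es; have [s1 [ep e1 c1]] := IH _ es.
  by exists s1; split=> //; apply: exec_if_true => //; rewrite -es in r0.
- move=> r p q s0 t s' r0 _ IH s es; have [s1 [ep e1 c1]] := IH _ es.
  by exists s1; split=> //; apply: exec_if_false => //; rewrite -es in r0.
- move=> r p s0 t s' u s'' r0 _ IHp _ IHq s es; have [s1 [ep e1 c1]] := IHp _ es.
  have [s2 [eq e2 c2]] := IHq _ e1; exists s2; split=> //; last exact: same_caller_trans c1 c2.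
  by apply: exec_while_true ep eq; rewrite -es in r0.
- move=> r p s0 r0 s es; exists s; split=> //.
  by apply: exec_while_false; rewrite -es in r0.
Qed.

(** * Expressions and weakest preconditions *)

Inductive expr := V of nat | K of nat | O of binop & expr & expr | M of nat & expr.

(** Temporaries form a stack growing upwards from [t]. A move is the disjunction of a register with
    itself, which is exact on words. *)
Fixpoint comp (e : expr) (t : nat) : prog :=
  match e with
  | V x => BinOp OpOr t x x
  | K v => SetConst t v
  | O o a b => Seq (comp a t) (Seq (comp b t.+1) (BinOp o t t t.+1))
  | M b e => Seq (comp e t) (Read t b t)
  end.

Fixpoint cost (e : expr) : nat :=
  match e with
  | V _ | K _ => 1
  | O _ a b => cost a + (cost b + 1)
  | M _ e => cost e + 1
  end.

(* Registers below [nvars] are program variables, registers from [nvars] to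
   [reg_off] hold intermediate results. *)
Definition nvars := 40.

Fixpoint ewf (e : expr) (t : nat) : bool :=
  match e with
  | V x => (x < nvars) && (t < reg_off)
  | K _ => t < reg_off
  | O _ a b => ewf a t && ewf b t.+1
  | M b e => (b < bank_off) && ewf e t
  end.

(* [clk] is a ghost bound on the elapsed time. *)
Record hst := HSt {
  var : nat -> nat; arr : nat -> nat -> nat; orc : state; clk : nat }.

Fixpoint ev (w : nat) (h : hst) (e : expr) : nat :=
  match e with
  | V x => var h x
  | K v => trunc_word w v
  | O o a b => binop_sem w o (ev w h a) (ev w h b)
  | M b e => arr h b (ev w h e)
  end.

(** The bounds [rep_lt] and [rep_arr_lt] make moves exact, since every operation reduces modulo
    [2 ^ w]. The state of the subroutine carries no bound. *)
Record rep (w : nat) (s : state) (h : hst) : Prop := Rep {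
  rep_var : forall x, x < nvars -> reg s x = var h x;
  rep_lt : forall x, x < nvars -> var h x < 2 ^ w;
  rep_arr : forall b, b < bank_off -> bank s b = arr h b;
  rep_arr_lt : forall b a, b < bank_off -> arr h b a < 2 ^ w;
  rep_orc : substate s = orc h }.

Definition upd (h : hst) (x v : nat) : hst :=
  HSt (fun y => if y == x then v else var h y) (arr h) (orc h) (clk h).
Definition upda (h : hst) (b a v : nat) : hst :=
  HSt (var h) (fun b' a' => if (b' == b) && (a' == a) then v else arr h b' a')
    (orc h) (clk h).
Definition updo (h : hst) (o : state) : hst := HSt (var h) (arr h) o (clk h).
Definition tick (h : hst) (c : nat) : hst :=
  HSt (var h) (arr h) (orc h) (clk h + c).

(** Total correctness with time: the ghost clock advances by at least the time spent, so a
    postcondition bounding [clk] bounds the running time, and costs may be rounded up. *)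
Definition wp (w : nat) (p : prog) (h : hst) (Q : hst -> Prop) : Prop :=
  forall s, rep w s h -> exists t s' h',
    [/\ exec w p s t s', rep w s' h', clk h + t <= clk h' & Q h'].

Lemma ewf_lt e t : ewf e t -> t < reg_off.
Proof.
elim: e t => [x|v|o a IHa b IHb|b e IH] t //= /andP[]; rewrite //.
- by move=> /IHa.
- by move=> _ /IH.
Qed.

Lemma binop_lt w o x y : binop_sem w o x y < 2 ^ w.
Proof. by rewrite ltn_mod expn_gt0. Qed.

Lemma comp_correct w e t s h : rep w s h -> ewf e t -> nvars <= t ->
  exists s', [/\ exec w (comp e t) s (cost e) s', reg s' t = ev w h e,
    (forall x, (x < t) || (reg_off <= x) -> reg s' x = reg s x),
    bank s' = bank s & ev w h e < 2 ^ w].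
Proof.
elim: e t s => [x|v|o a IHa b IHb|b e IH] t s r /=.
- move=> /andP[xv tr] nt; eexists; split; [exact: exec_binop| | |by []|exact: (rep_lt r)].
  + rewrite regE eqxx (rep_var r xv) /binop_sem PeanoNat.Nat.lor_diag.
    by rewrite /trunc_word modn_small // (rep_lt r).
  + by move=> y yt; rewrite regE; case: eqP yt => // ->; lia.
- move=> tr nt; eexists; split; [exact: exec_const|by rewrite regE eqxx| |by []|].
  + by move=> y yt; rewrite regE; case: eqP yt => // ->; lia.
  + by rewrite ltn_mod expn_gt0.
- move=> /andP[wa wb] nt.
  have [s1 [e1 v1 f1 b1 _]] := IHa _ _ r wa nt.
  have r1 : rep w s1 h.
    split; [move=> x xv|exact: (rep_lt r)|move=> b' bb|exact: (rep_arr_lt r)|].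
    - by rewrite f1 ?(rep_var r) // (leq_trans xv).
    - by rewrite b1 (rep_arr r).
    - rewrite -(rep_orc r); apply: state_eq => x; rewrite /= ?b1 // f1 //.
      by rewrite leq_addr orbT.
  have [s2 [e2 v2 f2 b2 _]] := IHb _ _ r1 wb (leqW nt).
  eexists; split; [exact: exec_seq e1 (exec_seq e2 (exec_binop _ _ _ _ _ _))| | | |].
  + by rewrite regE eqxx v2 (f2 t) ?ltnSn // v1.
  + move=> y yt; rewrite regE; have tr := ewf_lt wa.
    case: eqP yt => [->|_] yt; first by lia.
    by rewrite f2 ?f1 //; lia.
  + by rewrite /= b2.
  + exact: binop_lt.
- move=> /andP[bb we] nt; have [s1 [e1 v1 f1 b1 _]] := IH _ _ r we nt.
  eexists; split; [exact: exec_seq e1 (exec_read _ _ _ _ _)| | |by []|].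
  + by rewrite regE eqxx v1 b1 (rep_arr r).
  + move=> y yt; rewrite regE; have tr := ewf_lt we.
    by case: eqP yt => [->|_] yt; [lia|exact: f1].
  + exact: (rep_arr_lt r).
Qed.

Lemma rep_temps w s s' h : rep w s h ->
  (forall x, (x < nvars) || (reg_off <= x) -> reg s' x = reg s x) ->
  bank s' = bank s -> rep w s' h.
Proof.
move=> r f b; split; [|exact: (rep_lt r)| |exact: (rep_arr_lt r)|].
- by move=> x xv; rewrite f ?xv // (rep_var r).
- by move=> x xv; rewrite b (rep_arr r).
- rewrite -(rep_orc r); apply: state_eq => x; rewrite /= ?b // f //.
Qed.

Lemma wp_conseq w p h (Q Q' : hst -> Prop) :
  wp w p h Q -> (forall h', Q h' -> Q' h') -> wp w p h Q'.
Proof.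
by move=> W QQ s /W[t [s' [h' [ex r c /QQ q]]]]; exists t, s', h'; split.
Qed.

Lemma wp_skip w h (Q : hst -> Prop) : Q h -> wp w Skip h Q.
Proof. by move=> q s r; exists 0, s, h; split=> //; [exact: exec_skip|rewrite addn0]. Qed.

Lemma wp_seq w p q h Q :
  wp w p h (fun h' => wp w q h' Q) -> wp w (Seq p q) h Q.
Proof.
move=> W s /W[t [s1 [h1 [e1 r1 c1 W1]]]].
have [u [s2 [h2 [e2 r2 c2 q2]]]] := W1 _ r1.
exists (t + u), s2, h2; split=> //; first exact: exec_seq e1 e2.
by rewrite addnA (leq_trans _ c2) // leq_add2r.
Qed.

Definition Assign (x : nat) (e : expr) : prog :=
  Seq (comp e nvars) (BinOp OpOr x nvars nvars).

Lemma wp_assign w x e h (Q : hst -> Prop) : x < nvars -> ewf e nvars ->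
  Q (tick (upd h x (ev w h e)) (cost e).+1) -> wp w (Assign x e) h Q.
Proof.
move=> xv we q s r.
have [s1 [e1 v1 f1 b1 lt1]] := comp_correct r we (leqnn _).
exists (cost e + 1), (set_reg s1 x (ev w h e)), (tick (upd h x (ev w h e)) (cost e).+1).
split=> //; last by rewrite /= addn1.
- apply: exec_seq e1 _.
  rewrite -[in X in exec _ _ _ _ X]v1.
  have <- : binop_sem w OpOr (reg s1 nvars) (reg s1 nvars) = reg s1 nvars.
    by rewrite /binop_sem PeanoNat.Nat.lor_diag /trunc_word modn_small // v1.
  exact: exec_binop.
have {r} r : rep w s1 h.
  by apply: rep_temps r _ b1 => y yt; apply: f1.
split.
- by move=> y yv; rewrite regE /=; case: eqP => // _; rewrite (rep_var r).
- by move=> y yv /=; case: eqP => // _; rewrite (rep_lt r).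
- by move=> b bb /=; rewrite (rep_arr r).
- by move=> b a bb /=; rewrite (rep_arr_lt r).
- rewrite -(rep_orc r); apply: state_eq => // y; rewrite /= ; case: eqP => // e'.
  by move: xv; rewrite -e' /reg_off /nvars; lia.
Qed.

Definition Store (b : nat) (a e : expr) : prog :=
  Seq (comp a nvars) (Seq (comp e nvars.+1) (Write b nvars nvars.+1)).

Lemma exec_store w b a e s h : rep w s h -> ewf a nvars -> ewf e nvars.+1 ->
  exists s', [/\ exec w (Store b a e) s (cost a + (cost e + 1))
       (Defs.set_mem s' b (ev w h a) (ev w h e)), rep w s' h & ev w h e < 2 ^ w].
Proof.
move=> r wa we.
have [s1 [e1 v1 f1 b1 _]] := comp_correct r wa (leqnn _).
have r1 : rep w s1 h by apply: rep_temps r _ b1 => y yt; apply: f1.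
have [s2 [e2 v2 f2 b2 lt2]] := comp_correct r1 we (leqnSn _).
exists s2; split=> //.
  apply: exec_seq e1 (exec_seq e2 _).
  by rewrite -v2 -v1 -f2 ?ltnSn //; exact: exec_write.
apply: rep_temps r1 _ b2 => y yt; apply: f2.
by move: yt; lia.
Qed.

Lemma wp_store w b a e h (Q : hst -> Prop) :
  b < bank_off -> ewf a nvars -> ewf e nvars.+1 ->
  Q (tick (upda h b (ev w h a) (ev w h e)) (cost a + (cost e + 1))) ->
  wp w (Store b a e) h Q.
Proof.
move=> bb wa we q s r; have [s' [ex r' lt']] := exec_store b r wa we.
eexists _, _, _; split; last (exact: q); first (exact: ex); last by [].
split; [exact: (rep_var r')|exact: (rep_lt r')| | |].
- by move=> b' bb'; apply: funext => a'; rewrite /= (rep_arr r').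
- by move=> b' a' bb' /=; case: ifP => // _; apply: (rep_arr_lt r').
- rewrite -(rep_orc r'); apply: state_eq => // x y /=.
  by case: eqP => // e'; move: bb; rewrite -e'; lia.
Qed.

Lemma wp_store_orc w b a e h (Q : hst -> Prop) : ewf a nvars -> ewf e nvars.+1 ->
  Q (tick (updo h (Defs.set_mem (orc h) b (ev w h a) (ev w h e)))
       (cost a + (cost e + 1))) ->
  wp w (Store (bank_off + b) a e) h Q.
Proof.
move=> wa we q s r; have [s' [ex r' lt']] := exec_store (bank_off + b) r wa we.
eexists _, _, _; split; last (exact: q); first (exact: ex); last by [].
split; [exact: (rep_var r')|exact: (rep_lt r')| |exact: (rep_arr_lt r')|].
- move=> b' bb'; apply: funext => a' /=; rewrite -(rep_arr r') //.
  by case: eqP => // e'; lia.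
- by rewrite substate_set_mem (rep_orc r').
Qed.

Definition SetArg (r : nat) (e : expr) : prog :=
  Seq (comp e nvars) (BinOp OpOr (reg_off + r) nvars nvars).

Lemma wp_setarg w x e h (Q : hst -> Prop) : ewf e nvars ->
  Q (tick (updo h (set_reg (orc h) x (ev w h e))) (cost e).+1) ->
  wp w (SetArg x e) h Q.
Proof.
move=> we q s r.
have [s1 [e1 v1 f1 b1 lt1]] := comp_correct r we (leqnn _).
exists (cost e + 1), (set_reg s1 (reg_off + x) (ev w h e)); eexists.
split; last (exact: q); last by rewrite /= addn1.
- apply: exec_seq e1 _.
  rewrite -[in X in exec _ _ _ _ X]v1.
  have <- : binop_sem w OpOr (reg s1 nvars) (reg s1 nvars) = reg s1 nvars.
    by rewrite /binop_sem PeanoNat.Nat.lor_diag /trunc_word modn_small // v1.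
  exact: exec_binop.
have {r} r : rep w s1 h.
  by apply: rep_temps r _ b1 => y yt; apply: f1.
split; [|exact: (rep_lt r)|exact: (rep_arr r)|exact: (rep_arr_lt r)|].
- move=> y yv; rewrite regE -(rep_var r) //; case: eqP => // e'.
  by move: yv; rewrite e' /reg_off /nvars; lia.
- by rewrite substate_set_reg (rep_orc r).
Qed.

Definition GetRes (x r : nat) : prog := BinOp OpOr x (reg_off + r) (reg_off + r).

Lemma wp_getres w x y h (Q : hst -> Prop) : x < nvars ->
  Q (tick (upd h x (trunc_word w (reg (orc h) y))) 1) -> wp w (GetRes x y) h Q.
Proof.
move=> xv q s r; eexists _, _, _; split; last (exact: q); first (exact: exec_binop); last by [].
split.
- move=> z zv; rewrite regE /= (rep_var r zv); case: eqP => // _.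
  by rewrite /binop_sem PeanoNat.Nat.lor_diag -(rep_orc r).
- by move=> z zv /=; case: eqP => // _; rewrite ?(rep_lt r) // ltn_mod expn_gt0.
- exact: (rep_arr r).
- exact: (rep_arr_lt r).
- rewrite /= -(rep_orc r); apply: state_eq => // z; rewrite /= ; case: eqP => // e'.
  by move: xv; rewrite -e' /reg_off /nvars; lia.
Qed.

Lemma wp_call w p t o h (Q : hst -> Prop) : exec w p (orc h) t o ->
  Q (tick (updo h o) t) -> wp w (relocate p) h Q.
Proof.
move=> ex q s r; rewrite -(rep_orc r) in ex.
have [s' [e' eo [cr cb]]] := exec_relocate ex.
exists t, s'; eexists; split; last (exact: q); first (exact: e'); last by [].
split; [|exact: (rep_lt r)| |exact: (rep_arr_lt r)|exact: eo].
- by move=> x xv; rewrite cr ?(rep_var r) // (leq_trans xv).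
- by move=> b bb; rewrite cb // (rep_arr r).
Qed.

Definition IfE (e : expr) (p q : prog) : prog := Seq (comp e nvars) (If nvars p q).
Definition WhileE (e : expr) (p : prog) : prog :=
  Seq (comp e nvars) (While nvars (Seq p (comp e nvars))).

Lemma wp_if w e p q h Q : ewf e nvars ->
  (ev w h e != 0 -> wp w p (tick h (cost e).+1) Q) ->
  (ev w h e = 0 -> wp w q (tick h (cost e).+1) Q) -> wp w (IfE e p q) h Q.
Proof.
move=> we W0 W1 s r.
have [s1 [e1 v1 f1 b1 _]] := comp_correct r we (leqnn _).
have {}r : rep w s1 (tick h (cost e).+1).
  by case: (rep_temps r f1 b1) => *; split.
case: (eqVneq (ev w h e) 0) => [z|nz].
  have [t [s2 [h2 [e2 r2 c2 q2]]]] := W1 z _ r.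
  exists (cost e + t.+1), s2, h2; split=> //; last by move: c2 => /=; lia.
  by apply: exec_seq e1 (exec_if_false _ _ e2); rewrite v1.
have [t [s2 [h2 [e2 r2 c2 q2]]]] := W0 nz _ r.
exists (cost e + t.+1), s2, h2; split=> //; last by move: c2 => /=; lia.
by apply: exec_seq e1 (exec_if_true _ _ e2); rewrite v1.
Qed.

(** The measure [mu] gives termination; time is accounted for by the invariant through [clk]. *)
Lemma wp_while w e p (I : hst -> Prop) (mu : hst -> nat) h Q : ewf e nvars ->
  I h ->
  (forall h, I h -> ev w h e != 0 ->
     wp w p (tick h (cost e).+1) (fun h' => I h' /\ mu h' < mu h)) ->
  (forall h, I h -> ev w h e = 0 -> Q (tick h (cost e).+1)) ->
  wp w (WhileE e p) h Q.
Proof.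
move=> we i body fin s r.
have [s1 [e1 v1 f1 b1 _]] := comp_correct r we (leqnn _).
have {r f1 b1} r := rep_temps r f1 b1.
(* The condition is already in its temporary when the loop is entered. Its evaluation at the end of
   a round is charged to the next test, which is why [cost e] is still owed here. *)
suff [t [s' [h' [ex r' c q]]]] : exists t s' h',
    [/\ exec w (While nvars (Seq p (comp e nvars))) s1 t s', rep w s' h',
        clk h + (cost e + t) <= clk h' & Q h'].
  by exists (cost e + t), s', h'; split=> //; apply: exec_seq e1 ex.
have [m] := ubnP (mu h); elim: m => // m IH in h i s1 v1 r {s e1} *; rewrite ltnS => mm.
case: (eqVneq (ev w h e) 0) => [z|nz].
  exists 1, s1, (tick h (cost e).+1).
  split; [|by case: r => *; split|by rewrite /=; lia|exact: fin].
  by apply: exec_while_false; rewrite v1.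
have r' : rep w s1 (tick h (cost e).+1) by case: r => *; split.
have [t [s2 [h2 [e2 r2 c2 [i2 m2]]]]] := body _ i nz _ r'.
have [s3 [e3 v3 f3 b3 _]] := comp_correct r2 we (leqnn _).
have [|u [s4 [h4 [e4 r4 c4 q4]]]] := IH _ i2 s3 v3 (rep_temps r2 f3 b3).
  exact: leq_trans m2 mm.
exists ((t + cost e) + u).+1, s4, h4; split=> //; last by move: c2 => /=; lia.
by apply: exec_while_true (exec_seq e2 e3) e4; rewrite v1.
Qed.

Lemma wp_assign_eq w x e h v (Q : hst -> Prop) : x < nvars -> ewf e nvars ->
  ev w h e = v -> Q (tick (upd h x v) (cost e).+1) -> wp w (Assign x e) h Q.
Proof. by move=> xv we <-; apply: wp_assign. Qed.

(** * Frame rule: what a program cannot modify *)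

Fixpoint wreg (p : prog) (x : nat) : bool :=
  match p with
  | Skip | Write _ _ _ => false
  | SetConst r _ | BinOp _ r _ _ | Read r _ _ => x == r
  | Seq p q | If _ p q => wreg p x || wreg q x
  | While _ p => wreg p x
  end.

Fixpoint wbank (p : prog) (x : nat) : bool :=
  match p with
  | Skip | SetConst _ _ | BinOp _ _ _ _ | Read _ _ _ => false
  | Write b _ _ => x == b
  | Seq p q | If _ p q => wbank p x || wbank q x
  | While _ p => wbank p x
  end.

Fixpoint pure (p : prog) : bool :=
  match p with
  | Skip => true
  | SetConst r _ | BinOp _ r _ _ | Read r _ _ => r < reg_off
  | Write b _ _ => b < bank_off
  | Seq p q | If _ p q => pure p && pure q
  | While _ p => pure p
  end.

Lemma wreg_relocate p x : x < reg_off -> wreg (relocate p) x = false.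
Proof.
move=> xr; elim: p => //=; by move=> *; apply/negbTE/eqP; lia.
Qed.

Lemma wbank_relocate p x : x < bank_off -> wbank (relocate p) x = false.
Proof.
move=> xr; elim: p => //=; by move=> *; apply/negbTE/eqP; lia.
Qed.

Record frame (p : prog) (h h' : hst) : Prop := Frame {
  fr_var : forall x, x < nvars -> ~~ wreg p x -> var h' x = var h x;
  fr_arr : forall b, b < bank_off -> ~~ wbank p b -> arr h' b = arr h b;
  fr_orc : pure p -> orc h' = orc h }.

Lemma exec_reg w p s t s' x : exec w p s t s' -> ~~ wreg p x -> reg s' x = reg s x.
Proof.
elim=> {p s t s'} //=.
- by move=> s r v /negbTE->.
- by move=> s o r y z /negbTE->.
- by move=> s r b a /negbTE->.
- by move=> p q s t s' u s'' _ IH1 _ IH2; rewrite negb_or => /andP[/IH1<- /IH2].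
- by move=> r p q s t s' _ _ IH; rewrite negb_or => /andP[/IH].
- by move=> r p q s t s' _ _ IH; rewrite negb_or => /andP[_ /IH].
- by move=> r p s t s' u s'' _ _ IH1 _ IH2 np; rewrite IH2 ?IH1.
Qed.

Lemma exec_bank w p s t s' x : exec w p s t s' -> ~~ wbank p x -> bank s' x = bank s x.
Proof.
elim=> {p s t s'} //=.
- by move=> s b a r /negbTE nx; apply: funext => y; rewrite nx.
- by move=> p q s t s' u s'' _ IH1 _ IH2; rewrite negb_or => /andP[/IH1<- /IH2].
- by move=> r p q s t s' _ _ IH; rewrite negb_or => /andP[/IH].
- by move=> r p q s t s' _ _ IH; rewrite negb_or => /andP[_ /IH].
- by move=> r p s t s' u s'' _ _ IH1 _ IH2 np; rewrite IH2 ?IH1.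
Qed.

Lemma pure_wreg p x : pure p -> ~~ wreg p (reg_off + x).
Proof.
elim: p => //=; by move=> *; lia.
Qed.

Lemma pure_wbank p x : pure p -> ~~ wbank p (bank_off + x).
Proof.
elim: p => //=; by move=> *; lia.
Qed.

(** Any execution leaves unwritten registers and banks alone, so the frame can be added to a
    finished specification instead of being carried through its proof. *)
Lemma wp_frame w p h Q : wp w p h Q -> wp w p h (fun h' => Q h' /\ frame p h h').
Proof.
move=> W s r; have [t [s' [h' [ex r' c q]]]] := W _ r.
exists t, s', h'; split=> //; split=> //; split.
- by move=> x xv px; rewrite -(rep_var r') // (exec_reg ex) // (rep_var r).
- by move=> b bb pb; rewrite -(rep_arr r') // (exec_bank ex) // (rep_arr r).
- move=> pp; rewrite -(rep_orc r') -(rep_orc r); apply: state_eq => x.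
    by rewrite /= (exec_reg ex) // pure_wreg.
  by rewrite /= (exec_bank ex) // pure_wbank.
Qed.

Lemma frame_refl p h c : frame p h (tick h c).
Proof. by []. Qed.

Lemma frame_trans p h h' h'' : frame p h h' -> frame p h' h'' -> frame p h h''.
Proof.
move=> [v a o] [v' a' o']; split=> [x xv px|b bb pb|pp].
- by rewrite v' ?v.
- by rewrite a' ?a.
- by rewrite o' ?o.
Qed.

(** Lets a loop invariant speak only of what the body changes; everything else is recovered from the
    frame. *)
Lemma wp_while_frame w e p (I : hst -> Prop) (mu : hst -> nat) h0 Q :
  ewf e nvars -> I h0 ->
  (forall h, frame p h0 h -> I h -> ev w h e != 0 ->
     wp w p (tick h (cost e).+1) (fun h' => I h' /\ mu h' < mu h)) ->
  (forall h, frame p h0 h -> I h -> ev w h e = 0 -> Q (tick h (cost e).+1)) ->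
  wp w (WhileE e p) h0 Q.
Proof.
move=> we i body fin.
apply: (@wp_while _ _ _ (fun h => frame p h0 h /\ I h) mu) => //.
- move=> h [fr ih] nz; apply: wp_conseq (wp_frame (body _ fr ih nz)) _.
  move=> h' [[i' m'] fr']; split=> //; split=> //.
  exact: frame_trans fr (frame_trans (frame_refl _ _ _) fr').
- by move=> h [fr ih]; apply: fin.
Qed.

(** * Machine operations in the absence of overflow *)

Section Arith.
Variable w : nat.
Implicit Types x y : nat.

Lemma truncE x : x < 2 ^ w -> trunc_word w x = x.
Proof. exact: modn_small. Qed.
Lemma addE x y : x + y < 2 ^ w -> binop_sem w OpAdd x y = x + y.
Proof. exact: modn_small. Qed.
Lemma subE x y : y <= x -> x < 2 ^ w -> binop_sem w OpSub x y = x - y.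
Proof.
move=> yx xw; rewrite /binop_sem /trunc_word.
have -> : x + (2 ^ w - y) = x - y + 2 ^ w by lia.
by rewrite modnDr modn_small //; lia.
Qed.
Lemma mulE x y : x * y < 2 ^ w -> binop_sem w OpMul x y = x * y.
Proof. exact: modn_small. Qed.
Lemma divE x y : x < 2 ^ w -> binop_sem w OpDiv x y = x %/ y.
Proof. by move=> xw; apply: modn_small; apply: leq_ltn_trans (leq_div _ _) xw. Qed.
Lemma modE x y : x < 2 ^ w -> binop_sem w OpMod x y = x %% y.
Proof. by move=> xw; apply: modn_small; apply: leq_ltn_trans (leq_mod _ _) xw. Qed.
Lemma shrE x y : x < 2 ^ w -> binop_sem w OpShr x y = x %/ 2 ^ y.
Proof. by move=> xw; apply: modn_small; apply: leq_ltn_trans (leq_div _ _) xw. Qed.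
Lemma ltE x y : 0 < w -> binop_sem w OpLt x y = (x < y).
Proof.
move=> w0; apply: modn_small; case: (x < y); rewrite ?expn_gt0 //=.
by rewrite -{1}(expn0 2) ltn_exp2l.
Qed.
Lemma weqE x y : 0 < w -> binop_sem w OpEq x y = (x == y).
Proof.
move=> w0; apply: modn_small; case: (x == y); rewrite ?expn_gt0 //=.
by rewrite -{1}(expn0 2) ltn_exp2l.
Qed.
Lemma bit_andE x y i : bit (binop_sem w OpAnd x y) i = [&& i < w, bit x i & bit y i].
Proof. by rewrite bit_mod bit_land. Qed.
Lemma bit_orE x y i : bit (binop_sem w OpOr x y) i = (i < w) && (bit x i || bit y i).
Proof. by rewrite bit_mod bit_lor. Qed.
Lemma bit_xorE x y i : bit (binop_sem w OpXor x y) i = (i < w) && (bit x i != bit y i).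
Proof. by rewrite bit_mod bit_lxor. Qed.
Lemma bit_shlE x r i : bit (binop_sem w OpShl x r) i =
  [&& i < w, r <= i & bit x (i - r)].
Proof. by rewrite bit_mod bit_shl. Qed.
Lemma bit_shrE x r i : bit (binop_sem w OpShr x r) i = (i < w) && bit x (r + i).
Proof. by rewrite bit_mod -bitD. Qed.
End Arith.

(** * Lexicographic order and suffix arrays *)

Definition sle (s t : seq bool) : bool := ((s : seqlexi bool) <= (t : seqlexi bool))%O.
Definition slt (s t : seq bool) : bool := ~~ sle t s.

Lemma sle_refl s : sle s s. Proof. exact: Order.POrderTheory.lexx. Qed.
Lemma sle_trans : transitive sle.
Proof. by move=> s t u; apply: Order.POrderTheory.le_trans. Qed.
Lemma sle_total : total sle.
Proof. by move=> s t; apply: Order.TotalTheory.le_total. Qed.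
Lemma sle_slt_trans s t u : sle s t -> slt t u -> slt s u.
Proof. by rewrite /slt => st; apply: contra => us; apply: sle_trans us st. Qed.
Lemma slt_sle_trans s t u : slt s t -> sle t u -> slt s u.
Proof. by rewrite /slt => st tu; apply: contra st => us; apply: sle_trans tu us. Qed.

Lemma sle_cons x s y t : sle (x :: s) (y :: t) = (x <= y) && ((x == y) ==> sle s t).
Proof. by rewrite /sle Order.SeqLexiOrder.lexi_cons; case: x y => [] []. Qed.

Notation nthb := (nth false).

Lemma sle_first_diff s t :
  (forall i, (forall l, l < i -> nthb s l = nthb t l) -> nthb s i -> nthb t i) ->
  size s = size t -> sle s t.
Proof.
elim: s t => [|x s IH] [|y t] //= H [st]; rewrite sle_cons.
have xy : x ==> y by apply/implyP; apply: (H 0).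
apply/andP; split; first by case: x y xy {H} => [] [].
apply/implyP => /eqP exy; apply: IH => // i eqi; apply: (H i.+1).
by case=> [|l] //=; apply: eqi.
Qed.

(** [s] may end before position [l]: its missing bits read as [false], like the padding of a packed
    text, and a string that ends early is smaller as well. *)
Lemma slt_first_diff s t l : l < size t ->
  (forall j, j < l -> nthb s j = nthb t j) -> nthb s l = false -> nthb t l ->
  slt s t /\ ~~ prefix t s.
Proof.
elim: t s l => [|y t IH] [|x s] l //=.
rewrite /slt sle_cons; case: l => [|l] lt eqj /=; first by move=> -> ->.
have <- : x = y by apply: (eqj 0).
rewrite eqxx leqnn /=; apply: IH => // j jl; exact: (eqj j.+1).
Qed.

Lemma sgt_first_diff s t l : l < size t ->
  (forall j, j < l -> nthb s j = nthb t j) -> nthb s l -> nthb t l = false ->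
  ~~ slt s t /\ ~~ prefix t s.
Proof.
elim: t s l => [|y t IH] [|x s] l //=; first by rewrite nth_nil.
rewrite /slt sle_cons; case: l => [|l] lt eqj /=; first by move=> -> ->.
have <- : x = y by apply: (eqj 0).
rewrite eqxx leqnn /=; apply: IH => // j jl; exact: (eqj j.+1).
Qed.

(** Agreement includes the default bits past the end of [s]; then only the lengths can separate the
    strings. *)
Lemma prefix_first_diff s t : (forall j, j < size t -> nthb s j = nthb t j) ->
  slt s t = (size s < size t) /\ prefix t s = (size t <= size s).
Proof.
elim: t s => [|y t IH] [|x s] //= H.
have <- : x = y by apply: (H 0).
rewrite /slt sle_cons eqxx leqnn /=; apply: IH => j jt; exact: (H j.+1).
Qed.

Lemma prefix_sle s t : prefix s t -> sle s t.
Proof.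
elim: s t => [|x s IH] [|y t] //= /andP[/eqP<- /IH st].
by rewrite sle_cons eqxx leqnn.
Qed.

Lemma prefix_between s t u : sle s t -> sle t u -> prefix s u -> prefix s t.
Proof.
elim: s t u => [|x s IH] [|y t] [|z u] //=.
rewrite !sle_cons => /andP[xy st] /andP[yz tu] /andP[/eqP xz pu].
have exy : x = y by case: x y z xy yz xz {st tu} => [] [] [].
by rewrite exy eqxx in st *; rewrite -xz exy eqxx in tu; apply: IH st tu pu.
Qed.

Section SuffixArray.
Variable T : seq bool.
Let n := size T.

Definition suf (y : nat) : seq bool := drop (suffix_array T y).-1 T.

Let sa := sort (suffix_le T) (iota 1 n).

Lemma size_sa : size sa = n. Proof. by rewrite size_sort size_iota. Qed.

Lemma sa_range y : 1 <= y <= n -> 1 <= suffix_array T y <= n.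
Proof.
move=> yn; have : suffix_array T y \in sa by apply: mem_nth; rewrite size_sa; lia.
by rewrite mem_sort mem_iota; lia.
Qed.

Lemma suf_mono x y : 1 <= x -> x <= y -> y <= n -> sle (suf x) (suf y).
Proof.
move=> x0 xy yn.
have tr : transitive (suffix_le T) by move=> a b c; apply: sle_trans.
have re : reflexive (suffix_le T) by move=> a; apply: sle_refl.
have to : total (suffix_le T) by move=> a b; apply: sle_total.
have so := sort_sorted to (iota 1 n).
apply: (sorted_leq_nth tr re 0 so); rewrite ?inE ?size_sa; lia.
Qed.

Lemma suf_surj p : 1 <= p <= n -> exists2 y, 1 <= y <= n & suffix_array T y = p.
Proof.
move=> pn; have pin : p \in sa by rewrite mem_sort mem_iota; lia.
exists (index p sa).+1; last by rewrite /suffix_array nth_index.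
by rewrite -index_mem size_sa in pin.
Qed.

Lemma infix_dropP P : 0 < size P ->
  reflect (exists2 p, 1 <= p <= n & prefix P (drop p.-1 T)) (infix P T).
Proof.
move=> P0; apply: (iffP (@seq.infixP _ P T)) => [[s1 [s2 e]]|[p pn /prefixP[s2 e]]].
  exists (size s1).+1; first
    by rewrite /n e !size_cat /= -addn1 leq_add2l (leq_trans P0) // leq_addr.
  by rewrite e /= drop_size_cat // prefix_prefix.
by exists (take p.-1 T), s2; rewrite -e cat_take_drop.
Qed.

(** An occurrence at rank [y] forces [y > lo], and the suffix of rank [lo.+1] then lies between the
    pattern and a suffix starting with the pattern, so it starts with the pattern too. *)
Lemma infix_search P lo : 0 < size P -> lo <= n ->
  (forall y, 1 <= y <= lo -> slt (suf y) P) ->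
  (lo < n -> ~~ slt (suf lo.+1) P) ->
  infix P T = (lo < n) && prefix P (suf lo.+1).
Proof.
move=> P0 lon below above; apply/infix_dropP/andP => // [[p /suf_surj[y yn <-]]|[ln pr]].
  rewrite -/(suf y) => py.
  have lo_y : lo < y.
    rewrite ltnNge; apply/negP => ylo.
    have /below : 1 <= y <= lo by lia.
    by rewrite /slt prefix_sle.
  have ln : lo < n by lia.
  split=> //; have := above ln; rewrite negbK => le1.
  by apply: prefix_between le1 _ py; apply: suf_mono; lia.
by exists (suffix_array T lo.+1) => //; apply: sa_range.
Qed.

End SuffixArray.

(** * Radix sort of bit strings *)

(* Earlier bits of a string are lower-order bits of a word, so that the lowest
   differing bit decides. *)
Definition lex_lt (x y : nat) : bool :=
  `[< exists j, [/\ forall i, i < j -> bit x i = bit y i, ~~ bit x j & bit y j] >].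

Definition bit_rev (d t : nat) : nat := \sum_(i < d) bit t (d.-1 - i) * 2 ^ i.

Lemma bit_rev_lt d t : bit_rev d t < 2 ^ d.
Proof. exact: (sum_bits_lt d (fun i => bit t (d.-1 - i))). Qed.

Lemma bit_bit_rev d t i : bit (bit_rev d t) i = (i < d) && bit t (d.-1 - i).
Proof. exact: (bit_sum_bits d (fun i => bit t (d.-1 - i))). Qed.

(** The recurrence that fills the table: reverse the half, shift down by one, and put the lowest bit
    of [t] on top. *)
Lemma bit_bit_rev_half d t i : bit (bit_rev d.+1 t) i =
  bit (bit_rev d.+1 t./2) i.+1 || (i == d) && odd t.
Proof.
rewrite !bit_bit_rev !ltnS /=; case: (ltngtP i d) => [id|//|->].
  by rewrite orbF -bitS subnSK.
by rewrite subnn bit0.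
Qed.

Lemma lt_bit d u v : u < v -> v < 2 ^ d ->
  exists j, [/\ j < d, forall i, j < i -> bit u i = bit v i, ~~ bit u j & bit v j].
Proof.
elim: d u v => [|d IH] u v uv; first by lia.
rewrite expnS => vd; case: (ltnP u./2 v./2) => h.
  have [|j [jd eqj uj vj]] := IH _ _ h; first by lia.
  exists j.+1; split; rewrite ?bitS //.
  by case=> // i ji; rewrite !bitS eqj.
exists 0; split; rewrite ?bit0 //; [|lia|lia].
by case=> // i _; rewrite !bitS; congr bit; lia.
Qed.

(** The highest differing bit decides the numerical order, and reversal makes it the lowest one. *)
Lemma lex_lt_bit_rev d u v : u < v -> v < 2 ^ d ->
  lex_lt (bit_rev d u) (bit_rev d v).
Proof.
move=> uv vd; have [j [jd eqj uj vj]] := lt_bit uv vd.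
apply/asboolP; exists (d.-1 - j); split.
- move=> i id; rewrite !bit_bit_rev; case: (i < d) => //=; apply: eqj; lia.
- by rewrite bit_bit_rev subKn ?(negbTE uj) ?andbF; lia.
- by rewrite bit_bit_rev subKn ?vj; lia.
Qed.

Lemma lex_ltxx x : lex_lt x x = false.
Proof. by apply/negP => /asboolP[j [_ /negP]]. Qed.

Definition rev_table (d : nat) : seq nat := mkseq (bit_rev d) (2 ^ d).

Lemma rev_table_lex d : pairwise lex_lt (rev_table d).
Proof.
rewrite pairwise_map; apply: (@sub_in_pairwise _ (fun i => i < 2 ^ d) ltn).
- by move=> u v _ vd uv; apply: lex_lt_bit_rev.
- by apply/allP => i; rewrite mem_iota.
by rewrite -sorted_pairwise ?iota_ltn_sorted //; apply: ltn_trans.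
Qed.

(** Reversal is an involution on words of [d] bits. *)
Lemma mem_rev_table d x : x < 2 ^ d -> x \in rev_table d.
Proof.
move=> xd; have -> : x = bit_rev d (bit_rev d x).
  apply: (eq_from_bit xd (bit_rev_lt _ _)) => i id.
  by rewrite !bit_bit_rev id /= subKn; [case: (leqP) |]; lia.
by apply: map_f; rewrite mem_iota bit_rev_lt.
Qed.

Definition radix_pass (dg : nat -> nat) (ord s : seq nat) : seq nat :=
  flatten [seq [seq i <- s | dg i == x] | x <- ord].

Lemma mem_radix_pass dg ord s i :
  (i \in radix_pass dg ord s) = (i \in s) && (dg i \in ord).
Proof.
apply/flatten_mapP/andP => [[x xo]|[i_s io]].
  by rewrite mem_filter => /andP[/eqP-> ->].
by exists (dg i) => //; rewrite mem_filter eqxx.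
Qed.

(** Stability of a pass: different digits are ordered by [ord], equal digits keep the order [r] of
    the previous passes. *)
Lemma radix_pass_pairwise (lt r r' : rel nat) dg ord s :
  {in s &, forall i j, lt (dg i) (dg j) -> r' i j} ->
  {in s &, forall i j, dg i = dg j -> r i j -> r' i j} ->
  pairwise lt ord -> pairwise r s -> pairwise r' (radix_pass dg ord s).
Proof.
move=> H1 H2 po ps; elim: ord po => //= x ord IH /andP[/allP xo po].
rewrite /radix_pass /= pairwise_cat; apply/and3P; split; last exact: IH.
- apply/allrelP => i j; rewrite mem_filter => /andP[/eqP ix i_s].
  rewrite -/(radix_pass dg ord s) mem_radix_pass => /andP[j_s jo].
  by apply: H1; rewrite // ix; apply: xo.
- apply: (@sub_in_pairwise _ (fun i => (dg i == x) && (i \in s)) r);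
    last exact: pairwise_filter.
  + by move=> i j /andP[/eqP ix i_s] /andP[/eqP jx j_s]; apply: H2; rewrite // ix jx.
  + by apply/allP => i; rewrite mem_filter.
Qed.

(** Absence of duplicates is the previous lemma applied to disequality, so only membership has to be
    compared. *)
Lemma perm_radix_pass dg d s : uniq s -> (forall i, dg i < 2 ^ d) ->
  perm_eq (radix_pass dg (rev_table d) s) s.
Proof.
move=> us dgd; apply: uniq_perm => //; last first.
  by move=> i; rewrite mem_radix_pass mem_rev_table ?andbT.
rewrite uniq_pairwise; apply: (@radix_pass_pairwise lex_lt [rel x y | x != y]).
- by move=> i j _ _ /=; apply: contraTneq => ->; rewrite lex_ltxx.
- by [].
- exact: rev_table_lex.
- by rewrite -uniq_pairwise.
Qed.

Section Digits.
Variables (w k nw : nat) (f : nat -> nat -> bool) (pw : nat -> nat -> nat).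
Hypothesis pwE : forall i a t, i < k -> a < nw -> t < w -> bit (pw i a) t = f i (a * w + t).
Hypothesis pw_lt : forall i a, pw i a < 2 ^ w.

(** Order of the strings [i] and [j] with the positions before [p] ignored, through their first
    difference: the invariant of a radix sort that starts from the last digit. *)
Definition lex_le_from (p i j : nat) : Prop :=
  forall l, p <= l -> (forall l', p <= l' < l -> f i l' = f j l') -> f i l -> f j l.

Definition lex_rel (p i j : nat) : bool := (i != j) && `[< lex_le_from p i j >].

Definition digit (a sh d i : nat) : nat := (pw i a %/ 2 ^ sh) %% 2 ^ d.

Lemma bit_digit a sh d i t : i < k -> a < nw -> bit (digit a sh d i) t =
  [&& t < d, sh + t < w & f i (a * w + (sh + t))].
Proof.
move=> ik an; rewrite bit_mod -bitD; case: (t < d) => //=.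
by case: ltnP => tw; [rewrite pwE|rewrite (bit_high (pw_lt i a))].
Qed.

(** The lowest differing bit of two digits is the first difference of the strings from the start of
    the digit on. The last digits of a word may overhang it or be empty, whence the minimum with
    [w]. *)
Lemma digit_lex_lt a sh d i j : i < k -> j < k -> a < nw ->
  lex_lt (digit a sh d i) (digit a sh d j) ->
  lex_rel (a * w + minn sh w) i j.
Proof.
move=> ik jk an /[dup] ij /asboolP[t [eqt it jt]]; apply/andP; split.
  by apply: contraTneq ij => ->; rewrite lex_ltxx.
apply/asboolP => l pl eql il.
move: it jt; rewrite !bit_digit //; case/boolP: (t < d) => //= td.
case/boolP: (sh + t < w) => //= tw it jt.
case: (ltngtP l (a * w + (sh + t))) => lt.
- have := eqt (l - (a * w + sh)); rewrite !bit_digit //.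
  have -> : l - (a * w + sh) < d by lia.
  have -> : sh + (l - (a * w + sh)) = l - a * w by lia.
  have -> : a * w + (l - a * w) = l by lia.
  have -> : l - a * w < w by lia.
  by move=> /= <- //; lia.
- have e : f i (a * w + (sh + t)) = f j (a * w + (sh + t)) by apply: eql; lia.
  by rewrite e jt in it.
- by rewrite -lt il in it.
Qed.

(** Equal digits leave the first difference to the positions after the digit, where the previous
    passes have already sorted. *)
Lemma digit_eq_lex a sh d i j : i < k -> j < k -> a < nw -> digit a sh d i = digit a sh d j ->
  lex_rel (a * w + minn (sh + d) w) i j -> lex_rel (a * w + minn sh w) i j.
Proof.
move=> ik jk an eqd /andP[ij /asboolP le]; rewrite /lex_rel ij; apply/asboolP => l pl eql il.
case: (ltnP l (a * w + minn (sh + d) w)) => lt.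
  have := bit_digit sh d (l - (a * w + sh)) ik an.
  rewrite eqd bit_digit //.
  have -> : l - (a * w + sh) < d by lia.
  have -> : sh + (l - (a * w + sh)) = l - a * w by lia.
  have -> : a * w + (l - a * w) = l by lia.
  have -> : l - a * w < w by lia.
  by rewrite il.
apply: le => // l' pl'; apply: eql; lia.
Qed.

End Digits.

(** * The matching program *)

Notation vN := 0 (only parsing). Notation vK := 1 (only parsing).
Notation vM := 2 (only parsing). Notation vW := 3 (only parsing).
Notation vNW := 4 (only parsing). Notation vMASK := 5 (only parsing).
Notation vD := 6 (only parsing). Notation vD2 := 7 (only parsing).
Notation vG := 9 (only parsing). Notation vA := 10 (only parsing).
Notation vSH := 11 (only parsing). Notation vT := 12 (only parsing).
Notation vI := 13 (only parsing). Notation vX := 14 (only parsing).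
Notation vP := 15 (only parsing). Notation vU := 16 (only parsing).
(* Text, patterns, bit reversals, order of the patterns, links and heads of the
   bucket lists. *)
Notation bT := 0 (only parsing). Notation bP := 1 (only parsing).
Notation bORD := 2 (only parsing). Notation bA := 3 (only parsing).
Notation bNEXT := 4 (only parsing). Notation bHEAD := 5 (only parsing).

Notation "e1 #+ e2" := (O OpAdd e1 e2) (at level 50, left associativity).
Notation "e1 #- e2" := (O OpSub e1 e2) (at level 50, left associativity).
Notation "e1 #* e2" := (O OpMul e1 e2) (at level 40, left associativity).
Notation "e1 #/ e2" := (O OpDiv e1 e2) (at level 40, left associativity).
Notation "e1 #% e2" := (O OpMod e1 e2) (at level 40, left associativity).
Notation "e1 #< e2" := (O OpLt e1 e2) (at level 70, no associativity).
Notation "e1 #>> e2" := (O OpShr e1 e2) (at level 45, left associativity).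
Notation "e1 #<< e2" := (O OpShl e1 e2) (at level 45, left associativity).
Notation "x ::= e" := (Assign x e) (at level 75, no associativity).
Notation "p ;; q" := (Seq p q) (at level 80, right associativity).

Lemma powtrunc w j : 0 < w -> 2 ^ j %% 2 ^ w = if j < w then 2 ^ j else 0.
Proof.
move=> w0; case: ltnP => jw; first by rewrite modn_small // ltn_exp2l.
by apply/eqP; rewrite -/(dvdn _ _) dvdn_exp2l.
Qed.

(** The word size is not an input: it is the number of doublings after which 1 overflows to 0. *)
Definition word_size_prog : prog :=
  vX ::= K 1;; vW ::= K 0;;
  WhileE (V vX) (vX ::= V vX #+ V vX;; vW ::= V vW #+ K 1).

Lemma wp_word_size w h : 1 < w -> wp w word_size_prog h (fun h' =>
  var h' vW = w /\ clk h' <= clk h + 15 * w + 15).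
Proof.
move=> w1; have w0 : 0 < w by lia.
have ww : w < 2 ^ w by apply: ltn_expl.
have w2 : 2 <= 2 ^ w by lia.
apply: wp_seq; apply: (wp_assign_eq (v := 1)) => //; first by rewrite /= truncE.
apply: wp_seq; apply: (wp_assign_eq (v := 0)) => //; first by rewrite /= truncE //; lia.
apply: (@wp_while_frame _ _ _ (fun h' => exists j, [/\ j <= w, var h' vW = j,
   var h' vX = 2 ^ j %% 2 ^ w & clk h' <= clk h + 15 * j + 6]) (fun h' => w - var h' vW)) => //.
- by exists 0; split=> //=; [rewrite modn_small|lia].
- move=> h1 fr [j [jw e3 eX c1]] /=; rewrite eX powtrunc // => nz.
  have jltw : j < w by case: ltnP nz.
  rewrite powtrunc // jltw in eX.
  apply: wp_seq; apply: (wp_assign_eq (v := 2 ^ j.+1 %% 2 ^ w)) => //.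
    by rewrite /= eX /binop_sem /trunc_word addnn -mul2n -expnS.
  apply: (wp_assign_eq (v := j.+1)) => //.
    by rewrite /= e3 truncE // addE ?addn1 //; lia.
  split; last by rewrite /= e3; lia.
  exists j.+1; split=> //=; lia.
- move=> h1 fr [j [jw e3 eX c1]] /=; rewrite eX powtrunc //.
  case: ltnP => [_|wj _]; first by have := expn_gt0 2 j; lia.
  by rewrite e3; split; lia.
Qed.

(** Builds the initial state that the preprocessing expects. The count [n %/ w + 1] may exceed the
    number of packed words by one; that extra cell, like all those beyond, is zero in the source. *)
Definition copy_prog : prog :=
  vU ::= V vN #/ V vW #+ K 1;; vT ::= K 0;;
  WhileE (V vT #< V vU)
    (Store (bank_off + 0) (V vT) (M bT (V vT));; vT ::= V vT #+ K 1);;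
  SetArg 0 (V vN).

Definition zero_state := State (fun _ => 0) (fun _ _ => 0).

Lemma wp_copy w n s h : 1 < w -> n + 1 < 2 ^ w ->
  orc h = zero_state -> var h vN = n -> var h vW = w ->
  (forall a, n %/ w < a -> arr h bT a = 0) ->
  (forall a, arr h bT a = nth 0 s a) ->
  wp w copy_prog h (fun h' =>
  orc h' = init_state [:: n] [:: s] /\ clk h' <= clk h + 20 * (n %/ w) + 40).
Proof.
move=> w1 nw oz en ew zs es; have w0 : 0 < w by lia.
have dn : n %/ w <= n by apply: leq_div.
apply: wp_seq; apply: (wp_assign_eq (v := (n %/ w).+1)) => //.
  by rewrite /= en ew truncE ?divE ?addE ?addn1 //; lia.
apply: wp_seq; apply: (wp_assign_eq (v := 0)) => //; first by rewrite /= truncE //; lia.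
apply: wp_seq.
apply: (@wp_while_frame _ _ _ (fun h' => [/\ var h' vT <= (n %/ w).+1,
   orc h' = State (fun _ => 0) (fun b a => if (b == 0) && (a < var h' vT) then nth 0 s a else 0)
   & clk h' <= clk h + 20 * var h' vT + 10]) (fun h' => (n %/ w).+1 - var h' vT)) => //.
- split=> //=; last lia.
  by rewrite oz; apply: state_eq => //= b a; rewrite andbF.
- move=> h1 fr [tn o1 c1] /=.
  have eU : var h1 vU = (n %/ w).+1 by rewrite (fr_var fr).
  have eT : arr h1 bT = arr h bT by rewrite (fr_arr fr).
  rewrite ltE // eU; case: ltnP => // tlt _.
  apply: wp_seq; apply: wp_store_orc => //=.
  apply: (wp_assign_eq (v := (var h1 vT).+1)) => //.
    by rewrite /= truncE ?addE ?addn1 //; lia.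
  split; last by rewrite /=; lia.
  split=> //=; last lia.
  rewrite o1 eT es; apply: state_eq => //= b a; rewrite ltnS.
  by case: (b == 0); case: ltngtP => //= ->.
- move=> h1 fr [tn o1 c1] /=.
  have eU : var h1 vU = (n %/ w).+1 by rewrite (fr_var fr).
  have eN : var h1 vN = n by rewrite (fr_var fr).
  rewrite ltE // eU; case: ltnP => // ut _; apply: wp_setarg => //=.
  split; last lia.
  rewrite o1 eN; apply: state_eq => [[|r]|[|b] a] /=; rewrite ?nth_nil //.
  by case: ltnP => // ta; rewrite -es zs //; lia.
Qed.

Definition consts_prog (C : nat) : prog :=
  vNW ::= (V vM #- K 1) #/ V vW #+ K 1;;
  vMASK ::= K 1 #<< (V vM #- (V vNW #- K 1) #* V vW);;
  vD ::= V vW #/ K C #+ K 1;;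
  vD2 ::= K 1 #<< V vD.

(** Used as a modulus, it keeps the bits of the last word that belong to the pattern. If that word
    is full, the power wraps to 0, and the machine remainder modulo 0 is the dividend, so all bits
    are kept. *)
Definition last_mask (w m : nat) := 2 ^ (m - m.-1 %/ w * w) %% 2 ^ w.
Definition num_digits (w m : nat) := (m.-1 %/ w).+1.
(** Rounded up, so that [C] digits cover a word. The value chosen for [C] later is
    [2 * nat_ceil c]. *)
Definition digit_size (w C : nat) := (w %/ C).+1.

Lemma wp_consts w m C h : 1 < w -> 1 < C < 2 ^ w -> 0 < m < 2 ^ w ->
  digit_size w C < w ->
  var h vM = m -> var h vW = w -> wp w (consts_prog C) h (fun h' =>
  [/\ var h' vNW = num_digits w m,
      var h' vMASK = last_mask w m,
      var h' vD = digit_size w C, var h' vD2 = 2 ^ digit_size w C &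
      clk h' <= clk h + 40]).
Proof.
move=> w1 Cw mw dw em ew; have w0 : 0 < w by lia.
have ww : w < 2 ^ w by apply: ltn_expl.
have dm : m.-1 %/ w <= m.-1 by apply: leq_div.
have dm' : m.-1 %/ w * w <= m.-1 by apply: leq_divM.
rewrite /consts_prog; apply: wp_seq; apply: (wp_assign_eq (v := num_digits w m)) => //.
  rewrite /= em ew truncE ?subE ?divE ?addE ?addn1 ?subn1 //; lia.
apply: wp_seq; apply: (wp_assign_eq (v := last_mask w m)) => //.
  rewrite /= em ew !truncE; try lia.
  rewrite (@subE _ (num_digits _ _)); rewrite /num_digits ?subn1 //=; try lia.
  rewrite mulE; try lia.
  by rewrite subE ?/last_mask ?/binop_sem ?mul1n //; lia.
apply: wp_seq; apply: (wp_assign_eq (v := digit_size w C)) => //.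
  by rewrite /= ew !truncE ?divE ?addE ?addn1 //; rewrite /digit_size in dw; lia.
apply: (wp_assign_eq (v := 2 ^ digit_size w C)) => //.
  by rewrite /= truncE /binop_sem ?mul1n ?truncE //; rewrite ?ltn_exp2l //; lia.
split=> //=; lia.
Qed.

(** Entry [t] comes from entry [t %/ 2] by one shift; entry 0 is correct in a zero memory. *)
Definition table_prog : prog :=
  vT ::= K 1;;
  WhileE (V vT #< V vD2)
    (Store bORD (V vT) (O OpOr (M bORD (V vT #/ K 2) #/ K 2)
                           ((V vT #% K 2) #<< (V vD #- K 1)));;
     vT ::= V vT #+ K 1).

Lemma wp_table w d h : 1 < w -> 0 < d < w -> var h vD = d -> var h vD2 = 2 ^ d ->
  arr h bORD 0 = 0 -> wp w table_prog h (fun h' =>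
  (forall u, u < 2 ^ d -> arr h' bORD u = bit_rev d u) /\
  clk h' <= clk h + 40 * 2 ^ d + 40).
Proof.
move=> w1 dw ed ed2 z; have w0 : 0 < w by lia.
have ww : w < 2 ^ w by apply: ltn_expl.
have d2w : 2 ^ d < 2 ^ w by rewrite ltn_exp2l //; lia.
apply: wp_seq; apply: (wp_assign_eq (v := 1)) => //; first by rewrite /= truncE //; lia.
apply: (@wp_while_frame _ _ _ (fun h' => [/\ 0 < var h' vT <= 2 ^ d,
   (forall u, u < var h' vT -> arr h' bORD u = bit_rev d u)
   & clk h' <= clk h + 40 * var h' vT + 20]) (fun h' => 2 ^ d - var h' vT)) => //.
- split=> //=; [by rewrite expn_gt0| |lia].
  case=> // _; rewrite z; apply/esym/eqP; rewrite /bit_rev sum_nat_eq0.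
  by apply/forallP => i; rewrite /bit div0n.
- move=> h1 fr [tn tab c1] /=.
  have eD2 : var h1 vD2 = 2 ^ d by rewrite (fr_var fr).
  have eD : var h1 vD = d by rewrite (fr_var fr).
  rewrite ltE // eD2; case: ltnP => // tlt _.
  have c2 : 2 < 2 ^ w by lia.
  apply: wp_seq; apply: wp_store => //=.
  rewrite truncE // (@truncE _ 1) ?(ltnW c2) // eD subE ?subn1; try lia.
  rewrite modE ?(@divE _ (var h1 vT)); try lia.
  rewrite tab; last lia.
  have bl : bit_rev d (var h1 vT %/ 2) < 2 ^ w by apply: ltn_trans (bit_rev_lt _ _) d2w.
  rewrite divE //.
  have -> : binop_sem w OpOr (bit_rev d (var h1 vT %/ 2) %/ 2)
     (binop_sem w OpShl (var h1 vT %% 2) d.-1) = bit_rev d (var h1 vT).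
    apply: (@eq_from_bit w); [exact: binop_lt|exact: ltn_trans (bit_rev_lt _ _) d2w|].
    case: d dw {ed ed2 d2w tn c1 tab eD2 eD tlt bl} => // d dw i iw.
    rewrite bit_orE bit_shlE iw /= bit_bit_rev_half divn2 -bitS divn2; congr (_ || _).
    case: (ltngtP d i) => [di|//|->] /=; last by rewrite subnn bit0 modn2 oddb.
    by rewrite modn2 -[i - d](subnSK di) bitS; case: odd; rewrite /bit div0n.
  apply: (wp_assign_eq (v := (var h1 vT).+1)) => //.
    by rewrite /= truncE ?addE ?addn1 //; lia.
  split; last by rewrite /=; lia.
  split=> /=; [lia| |lia].
  move=> u; rewrite ltnS leq_eqVlt; case: eqP => //= [->|_] //; exact: tab.
- move=> h1 fr [tn tab c1] /=.
  have eD2 : var h1 vD2 = 2 ^ d by rewrite (fr_var fr).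
  rewrite ltE // eD2; case: ltnP => // ut _; split=> /=; last lia.
  by move=> u ud; apply: tab; lia.
Qed.

Definition iota_prog : prog :=
  vT ::= K 0;;
  WhileE (V vT #< V vK) (Store bA (V vT) (V vT);; vT ::= V vT #+ K 1).

Lemma wp_iota w k h : 1 < w -> var h vK = k -> k < 2 ^ w ->
  wp w iota_prog h (fun h' =>
  mkseq (arr h' bA) k = iota 0 k /\ clk h' <= clk h + 20 * k + 20).
Proof.
move=> w1 ek kw; have w0 : 0 < w by lia.
have ww : w < 2 ^ w by apply: ltn_expl.
apply: wp_seq; apply: (wp_assign_eq (v := 0)) => //; first by rewrite /= truncE //; lia.
apply: (@wp_while_frame _ _ _ (fun h' => [/\ var h' vT <= k,
   (forall u, u < var h' vT -> arr h' bA u = u)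
   & clk h' <= clk h + 20 * var h' vT + 10]) (fun h' => k - var h' vT)) => //.
- by split=> //=; lia.
- move=> h1 fr [tn tab c1] /=.
  have eK : var h1 vK = k by rewrite (fr_var fr).
  rewrite ltE // eK; case: ltnP => // tlt _.
  apply: wp_seq; apply: wp_store => //=.
  apply: (wp_assign_eq (v := (var h1 vT).+1)) => //.
    by rewrite /= truncE ?addE ?addn1 //; lia.
  split; last by rewrite /=; lia.
  split=> //=; last lia.
  move=> u; rewrite ltnS leq_eqVlt; case: eqP => [->|_] //=; exact: tab.
- move=> h1 fr [tn tab c1] /=.
  have eK : var h1 vK = k by rewrite (fr_var fr).
  rewrite ltE // eK; case: ltnP => // ut _; split=> /=; last lia.
  rewrite -[RHS]map_id; apply/eq_in_map => u; rewrite mem_iota => uk; apply: tab; lia.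
Qed.

(* A pointer to the element [i] is represented by [i.+1], the null pointer by [0]. *)
Fixpoint llist (nx : nat -> nat) (p : nat) (l : seq nat) : Prop :=
  if l is i :: l' then p = i.+1 /\ llist nx (nx i) l' else p = 0.

Lemma eq_llist nx nx' p l : {in l, nx =1 nx'} -> llist nx p l -> llist nx' p l.
Proof.
elim: l p => //= i l IH p e [-> H]; split=> //.
rewrite -e ?mem_head //; apply: IH H => j jl; apply: e; rewrite inE jl; exact: orbT.
Qed.

(** Scanning from the last element to the first while inserting at the head leaves each list in the
    original order, as stability demands. *)
Definition bucket_prog : prog :=
  vT ::= V vK;;
  WhileE (V vT)
    (vT ::= V vT #- K 1;; vI ::= M bA (V vT);;
     vX ::= (M bP (V vI #* V vNW #+ V vA) #>> V vSH) #% V vD2;;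
     Store bNEXT (V vI) (M bHEAD (V vX));;
     Store bHEAD (V vX) (V vI #+ K 1)).

Definition unlink_prog : prog :=
  WhileE (V vP)
    (vP ::= V vP #- K 1;; Store bA (V vT) (V vP);;
     vT ::= V vT #+ K 1;; vP ::= M bNEXT (V vP)).

(** Buckets are visited in bit-reversed order, and their heads are cleared on the way, ready for the
    next pass. *)
Definition gather_prog : prog :=
  vU ::= K 0;; vT ::= K 0;;
  WhileE (V vU #< V vD2)
    (vX ::= M bORD (V vU);; vP ::= M bHEAD (V vX);;
     Store bHEAD (V vX) (K 0);; unlink_prog;; vU ::= V vU #+ K 1).

(** [vG] numbers the digits of all words of a pattern consecutively; counting down treats the least
    significant string positions first. *)
Definition sort_prog (C : nat) : prog :=
  vG ::= V vNW #* K C;;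
  WhileE (V vG)
    (vG ::= V vG #- K 1;; vA ::= V vG #/ K C;; vSH ::= (V vG #% K C) #* V vD;;
     bucket_prog;; gather_prog).

Section Sort.
Variables (w k d nw : nat) (P : nat -> nat).
Hypotheses (w1 : 1 < w) (d0 : 0 < d) (dw : d < w) (k2 : k * nw < 2 ^ w).
Hypotheses (nw0 : 0 < nw) (P2 : forall a, P a < 2 ^ w).

Let pw i a := P (i * nw + a).

Lemma k_lt : k < 2 ^ w.
Proof. by apply: leq_ltn_trans k2; rewrite leq_pmulr. Qed.

Lemma wp_bucket a sh h s :
  a < nw -> var h vK = k -> var h vNW = nw -> var h vA = a -> var h vSH = sh ->
  var h vD2 = 2 ^ d -> arr h bP = P -> mkseq (arr h bA) k = s ->
  uniq s -> (forall i, i \in s -> i < k) ->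
  (forall x, x < 2 ^ d -> arr h bHEAD x = 0) ->
  wp w bucket_prog h (fun h' =>
    (forall x, x < 2 ^ d ->
       llist (arr h' bNEXT) (arr h' bHEAD x) [seq i <- s | digit pw a sh d i == x]) /\
    clk h' <= clk h + 50 * k + 50).
Proof.
move=> an ek enw ea esh ed2 eP es us sk hz; have w0 : 0 < w by lia.
have d2w : 2 ^ d < 2 ^ w by rewrite ltn_exp2l.
have kw := k_lt; have ss : size s = k by rewrite -es size_mkseq.
apply: wp_seq; apply: (wp_assign_eq (v := k)) => //.
apply: (@wp_while_frame _ _ _ (fun h' => [/\ var h' vT <= k,
   (forall x, x < 2 ^ d -> llist (arr h' bNEXT) (arr h' bHEAD x)
      [seq i <- drop (var h' vT) s | digit pw a sh d i == x])
   & clk h' + 50 * var h' vT <= clk h + 50 * k + 10]) (fun h' => var h' vT)) => //.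
- split=> //=; last lia.
  by move=> x xd; rewrite drop_oversize ?ss // hz.
- move=> h1 fr [tk ll c1] /= t0.
  have [t et] : exists t, var h1 vT = t.+1 by exists (var h1 vT).-1; lia.
  have eK : var h1 vK = k by rewrite (fr_var fr).
  have eNW : var h1 vNW = nw by rewrite (fr_var fr).
  have eA : var h1 vA = a by rewrite (fr_var fr).
  have eSH : var h1 vSH = sh by rewrite (fr_var fr).
  have eD2 : var h1 vD2 = 2 ^ d by rewrite (fr_var fr).
  have eP1 : arr h1 bP = P by rewrite (fr_arr fr).
  have eA1 : arr h1 bA = arr h bA by rewrite (fr_arr fr).
  set i := nth 0 s t.
  have tk' : t < k by lia.
  have i_s : i \in s by apply: mem_nth; rewrite ss.
  have ik : i < k by apply: sk.
  apply: wp_seq; apply: (wp_assign_eq (v := t)) => //.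
    by rewrite /= truncE ?subE ?et ?subn1 //; lia.
  apply: wp_seq; apply: (wp_assign_eq (v := i)) => //.
    by rewrite /= eA1 /i -es nth_mkseq.
  have lt1 : i * nw + a < k * nw.
    by rewrite (@leq_trans (i.+1 * nw)) ?leq_mul2r ?ik ?orbT // mulSn; lia.
  apply: wp_seq; apply: (wp_assign_eq (v := digit pw a sh d i)) => //.
    rewrite /= eP1 eNW eA eSH eD2 mulE; last lia.
    by rewrite addE ?shrE ?modE //; [apply: leq_ltn_trans (leq_div _ _) _|lia].
  set x := digit pw a sh d i.
  have xd : x < 2 ^ d by rewrite ltn_mod expn_gt0.
  apply: wp_seq; apply: wp_store => //=; apply: wp_store => //=.
  rewrite truncE ?addE ?addn1; try lia.
  split; last by rewrite et.
  split=> /=; [lia| |lia].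
  have dt : drop t s = i :: drop t.+1 s by apply: drop_nth; rewrite ss.
  move=> y yd; rewrite dt /= -/x.
  (* Only the link of [i] is overwritten, and [i] occurs in no list built so far. *)
  have ni : i \notin drop t.+1 s.
    by have := drop_uniq t us; rewrite dt /= => /andP[].
  have L := ll y yd; rewrite et in L.
  rewrite [x == y]eq_sym; case: (eqVneq y x) => [e|ne] /=.
    split=> //; rewrite eqxx -e; apply: eq_llist L => j.
    by rewrite mem_filter => /andP[_ jd]; case: eqP jd => // ->; rewrite (negbTE ni).
  apply: eq_llist L => j.
  by rewrite mem_filter => /andP[_ jd]; case: eqP jd => // ->; rewrite (negbTE ni).
- move=> h1 fr [tk ll c1] /= t0; rewrite t0 in ll c1; split; last by lia.
  by move=> x /ll; rewrite drop0.
Qed.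

Lemma wp_unlink h l acc :
  llist (arr h bNEXT) (var h vP) l -> mkseq (arr h bA) (var h vT) = acc ->
  (forall i, i \in l -> i < k) -> size acc + size l < 2 ^ w ->
  wp w unlink_prog h (fun h' => mkseq (arr h' bA) (var h' vT) = acc ++ l /\
    clk h' + 30 * size acc <= clk h + 30 * var h' vT + 10).
Proof.
move=> L eacc lk sz; have w0 : 0 < w by lia.
have kw := k_lt.
have sacc : var h vT = size acc by rewrite -eacc size_mkseq.
apply: (@wp_while_frame _ _ _ (fun h' => exists l1 l2, [/\ l = l1 ++ l2,
   llist (arr h' bNEXT) (var h' vP) l2,
   mkseq (arr h' bA) (var h' vT) = acc ++ l1
   & clk h' + 30 * size acc <= clk h + 30 * var h' vT])
   (fun h' => size (acc ++ l) - var h' vT)) => //.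
- by exists [::], l; rewrite cats0; split=> //; lia.
- move=> h1 fr [l1 [l2 [el L2 e1 c1]]] /= p0.
  have eN : arr h1 bNEXT = arr h bNEXT by rewrite (fr_arr fr).
  case: l2 => [|i l2] /= in el L2; first by rewrite L2 in p0.
  case: L2 => [ep L2].
  have ik : i < k by apply: lk; rewrite el mem_cat mem_head orbT.
  have st : var h1 vT = size (acc ++ l1) by rewrite -e1 size_mkseq.
  have lt : var h1 vT < size (acc ++ l) by rewrite st el !size_cat /=; lia.
  rewrite size_cat in lt.
  apply: wp_seq; apply: (wp_assign_eq (v := i)) => //.
    by rewrite /= truncE ?subE ?ep ?subn1 //; lia.
  apply: wp_seq; apply: wp_store => //=.
  apply: wp_seq; apply: (wp_assign_eq (v := (var h1 vT).+1)) => //.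
    by rewrite /= truncE ?addE ?addn1 //; lia.
  apply: wp_assign => //=.
  split; last by rewrite /= size_cat; lia.
  exists (rcons l1 i), l2; split=> //=; [by rewrite cat_rcons| |lia].
  rewrite mkseqS eqxx -rcons_cat -e1; congr rcons.
  apply/eq_in_map => j; rewrite mem_iota => jt; case: eqP jt => // ->; lia.
- move=> h1 fr [l1 [l2 [el L2 e1 c1]]] /= p0; split; last lia.
  case: l2 => [|i l2] /= in el L2; first by rewrite e1 el cats0.
  by rewrite p0 in L2; case: L2.
Qed.

Lemma wp_gather h (dg : nat -> nat) s :
  var h vD2 = 2 ^ d -> (forall u, u < 2 ^ d -> arr h bORD u = bit_rev d u) ->
  perm_eq s (iota 0 k) -> (forall i, dg i < 2 ^ d) ->
  (forall x, x < 2 ^ d ->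
     llist (arr h bNEXT) (arr h bHEAD x) [seq i <- s | dg i == x]) ->
  wp w gather_prog h (fun h' =>
    [/\ mkseq (arr h' bA) k = radix_pass dg (rev_table d) s,
        (forall x, x < 2 ^ d -> arr h' bHEAD x = 0) &
        clk h' <= clk h + 50 * 2 ^ d + 30 * k + 50]).
Proof.
move=> ed2 tab ps dgd H; have w0 : 0 < w by lia.
have ww : w < 2 ^ w by apply: ltn_expl.
have d2w : 2 ^ d < 2 ^ w by rewrite ltn_exp2l.
have kw := k_lt.
set rt := rev_table d; pose F (x : nat) : seq nat := [seq i <- s | dg i == x].
have srt : size rt = 2 ^ d by rewrite size_mkseq.
have urt : uniq rt.
  rewrite uniq_pairwise; apply: sub_pairwise (rev_table_lex d) => x y.
  by apply: contraTneq => ->; rewrite lex_ltxx.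
have sRP : size (radix_pass dg rt s) = k.
  have us : uniq s by rewrite (perm_uniq ps) iota_uniq.
  by rewrite (perm_size (perm_radix_pass us dgd)) (perm_size ps) size_iota.
(* The elements already output and those still in buckets number [k] in all: this bounds the output
   position and amortizes the inner loops. *)
have szt u : size (flatten [seq F x | x <- take u rt]) + 
             size (flatten [seq F x | x <- drop u rt]) = k.
  by rewrite -size_cat -flatten_cat -map_cat cat_take_drop.
apply: wp_seq; apply: (wp_assign_eq (v := 0)) => //; first by rewrite /= truncE //; lia.
apply: wp_seq; apply: (wp_assign_eq (v := 0)) => //; first by rewrite /= truncE //; lia.
apply: (@wp_while_frame _ _ _ (fun h' => [/\ var h' vU <= 2 ^ d,
   mkseq (arr h' bA) (var h' vT) = flatten [seq F x | x <- take (var h' vU) rt],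
   (forall x, x \in drop (var h' vU) rt -> llist (arr h' bNEXT) (arr h' bHEAD x) (F x)),
   (forall x, x \in take (var h' vU) rt -> arr h' bHEAD x = 0)
   & clk h' <= clk h + 50 * var h' vU + 30 * var h' vT + 10])
   (fun h' => 2 ^ d - var h' vU)) => //.
- split=> //=; [by rewrite take0| |by rewrite take0|lia].
  move=> x /mem_drop /mapP[u]; rewrite mem_iota => ud ->; exact/H/bit_rev_lt.
- move=> h1 fr [ud eA LL Z c1] /=.
  have eD2 : var h1 vD2 = 2 ^ d by rewrite (fr_var fr).
  have eO : arr h1 bORD = arr h bORD by rewrite (fr_arr fr).
  rewrite ltE // eD2; case: ltnP => // ult _.
  set u := var h1 vU in ud eA LL Z c1 ult *.
  set x := nth 0 rt u.
  have ex : x = bit_rev d u by rewrite /x nth_mkseq.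
  have du : drop u rt = x :: drop u.+1 rt by apply: drop_nth; rewrite srt.
  have tu : take u.+1 rt = rcons (take u rt) x by apply: take_nth; rewrite srt.
  have xd : x < 2 ^ d by rewrite ex bit_rev_lt.
  have nx : x \notin drop u.+1 rt.
    by have := drop_uniq u urt; rewrite du /= => /andP[].
  apply: wp_seq; apply: (wp_assign_eq (v := x)) => //; first by rewrite /= eO tab.
  apply: wp_seq; apply: wp_assign => //=.
  apply: wp_seq; apply: wp_store => //=; rewrite truncE ?expn_gt0 //.
  apply: wp_seq.
  have Lx : llist (arr h1 bNEXT) (arr h1 bHEAD x) (F x) by apply: LL; rewrite du mem_head.
  have sz := szt u; rewrite du /= size_cat in sz.
  apply: wp_conseq.
    apply: wp_frame; apply: (wp_unlink (l := F x)); [exact: Lx|exact: eA| |].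
  + by move=> i; rewrite mem_filter (perm_mem ps) mem_iota => /andP[_].
  + by lia.
  move=> h2 [[e2 c2] fr2] /=.
  have eU : var h2 vU = u by rewrite (fr_var fr2).
  have eN2 : arr h2 bNEXT = arr h1 bNEXT by rewrite (fr_arr fr2).
  have eH2 : arr h2 bHEAD = fun y => if y == x then 0 else arr h1 bHEAD y.
    by rewrite (fr_arr fr2).
  apply: (wp_assign_eq (v := u.+1)) => //.
    by rewrite /= truncE ?addE ?addn1 ?eU //; lia.
  split; last by rewrite /= -/u; lia.
  split=> //=.
  + by rewrite tu map_rcons flatten_rcons.
  + move=> y yd; rewrite eN2 eH2; case: eqP yd => [->|_] yd; first by rewrite yd in nx.
    by apply: LL; rewrite du inE yd orbT.
  + move=> y; rewrite tu mem_rcons inE eH2; case: eqP => //= _; exact: Z.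
  + have := congr1 size eA; rewrite size_mkseq => s1; move: c2 => /=; rewrite -s1; lia.
- move=> h1 fr [ud eA LL Z c1] /=.
  have eD2 : var h1 vD2 = 2 ^ d by rewrite (fr_var fr).
  rewrite ltE // eD2; case: ltnP => // ult _.
  have eu : var h1 vU = 2 ^ d by lia.
  rewrite eu take_oversize ?srt // in eA Z.
  have eT : var h1 vT = k by rewrite -(size_mkseq (arr h1 bA) (var h1 vT)) eA.
  rewrite eT in eA; split=> //=; last lia.
  by move=> x xd; apply: Z; apply: mem_rev_table.
Qed.

Variables (C : nat) (f : nat -> nat -> bool).
Hypotheses (C0 : 0 < C) (C2 : nw * C < 2 ^ w) (wC : w <= C * d) (C3 : C * d < 2 ^ w).
Hypothesis PE : forall i a t, i < k -> a < nw -> t < w ->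
  bit (P (i * nw + a)) t = f i (a * w + t).
Hypothesis f0 : forall i l, nw * w <= l -> f i l = false.

(** String position where digit [g] starts; from there on the patterns are sorted once digit [g] has
    been processed. *)
Let digit_pos g := g %/ C * w + minn (g %% C * d) w.

Lemma wp_sort h :
  var h vK = k -> var h vNW = nw -> var h vD = d -> var h vD2 = 2 ^ d ->
  arr h bP = P -> (forall u, u < 2 ^ d -> arr h bORD u = bit_rev d u) ->
  mkseq (arr h bA) k = iota 0 k -> (forall x, x < 2 ^ d -> arr h bHEAD x = 0) ->
  wp w (sort_prog C) h (fun h' => exists s,
    [/\ mkseq (arr h' bA) k = s, perm_eq s (iota 0 k), pairwise (lex_rel f 0) s &
        clk h' <= clk h + nw * C * (100 * (k + 2 ^ d) + 200) + 20]).
Proof.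
move=> ek enw ed ed2 eP tab eA hz; have w0 : 0 < w by lia.
have CC : C <= nw * C by apply: leq_pmull.
have kw := k_lt.
rewrite /sort_prog; apply: wp_seq; apply: (wp_assign_eq (v := nw * C)) => //.
  by rewrite /= enw truncE ?mulE //; lia.
pose W := 100 * (k + 2 ^ d) + 200.
apply: (@wp_while_frame _ _ _ (fun h' => [/\ var h' vG <= nw * C,
   perm_eq (mkseq (arr h' bA) k) (iota 0 k),
   pairwise (lex_rel f (digit_pos (var h' vG))) (mkseq (arr h' bA) k),
   (forall x, x < 2 ^ d -> arr h' bHEAD x = 0)
   & clk h' + W * var h' vG <= clk h + W * (nw * C) + 10]) (fun h' => var h' vG)) => //.
- split=> //=; [by rewrite eA| |lia].
  rewrite eA; apply: (@sub_pairwise _ (fun i j => i != j)); last first.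
    by rewrite -uniq_pairwise iota_uniq.
  move=> i j /= ij; rewrite /lex_rel ij; apply/asboolP => l.
  (* Before the first pass the position is the end of the last word, past which all bits are
     [false]: any order is sorted. *)
  by rewrite /digit_pos mulnK // modnMl mul0n min0n addn0 => /f0->.
- move=> h1 fr [gk pm pw1 Z c1] /= g0.
  have [g eg] : exists g, var h1 vG = g.+1 by exists (var h1 vG).-1; lia.
  have eK : var h1 vK = k by rewrite (fr_var fr).
  have eNW : var h1 vNW = nw by rewrite (fr_var fr).
  have eD : var h1 vD = d by rewrite (fr_var fr).
  have eD2 : var h1 vD2 = 2 ^ d by rewrite (fr_var fr).
  have eP1 : arr h1 bP = P by rewrite (fr_arr fr).
  have eO : arr h1 bORD = arr h bORD by rewrite (fr_arr fr).
  have glt : g < nw * C by lia.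
  have an : g %/ C < nw by rewrite ltn_divLR.
  have gC : g %% C < C by rewrite ltn_mod.
  apply: wp_seq; apply: (wp_assign_eq (v := g)) => //.
    by rewrite /= truncE ?subE ?eg ?subn1 //; lia.
  apply: wp_seq; apply: (wp_assign_eq (v := g %/ C)) => //.
    by rewrite /= truncE ?divE //; lia.
  apply: wp_seq; apply: (wp_assign_eq (v := g %% C * d)) => //.
    rewrite /= eD truncE ?modE ?mulE //; try lia.
    by apply: leq_ltn_trans C3; rewrite leq_mul2r (ltnW gC) orbT.
  set sh := g %% C * d; set a := g %/ C.
  apply: wp_seq; apply: wp_conseq.
    apply: wp_frame; apply: (@wp_bucket a sh _ (mkseq (arr h1 bA) k)) => //=.
    + by rewrite (perm_uniq pm) iota_uniq.
    + by move=> i; rewrite (perm_mem pm) mem_iota.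
  move=> h2 [[ll c2] fr2] /=.
  set s := mkseq (arr h1 bA) k in pm pw1 ll *.
  pose dg := digit (fun i a => P (i * nw + a)) a sh d.
  have dgd i : dg i < 2 ^ d by rewrite ltn_mod expn_gt0.
  have us : uniq s by rewrite (perm_uniq pm) iota_uniq.
  apply: wp_conseq.
    apply: wp_frame; apply: (@wp_gather h2 dg s) => //.
    + by rewrite (fr_var fr2).
    + by rewrite (fr_arr fr2) //= eO.
  move=> h3 [[e3 z3 c3] fr3].
  have eg3 : var h3 vG = g by rewrite (fr_var fr3) // (fr_var fr2).
  split; last by rewrite eg3 eg.
  split=> //; rewrite ?e3 ?eg3; [lia| | |].
  + exact: perm_trans (perm_radix_pass us dgd) pm.
  + have mk i : i \in s -> i < k by rewrite (perm_mem pm) mem_iota.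
    apply: radix_pass_pairwise (rev_table_lex d) pw1 => i j i_s j_s.
    * by apply: (digit_lex_lt PE); rewrite ?mk.
    (* Digit [g.+1] lies in the same word, or starts the next one; in the latter case [w <= C * d]
       makes the minimum equal to [w], which is the same position. *)
    * have -> : digit_pos (var h1 vG) = a * w + minn (sh + d) w.
        rewrite eg /digit_pos /sh -mulSnr; case: (ltnP (g %% C).+1 C) => [gC1|gC2].
        - rewrite (_ : g.+1 = a * C + (g %% C).+1); last by rewrite addnS -divn_eq.
          by rewrite divnMDl // modnMDl (modn_small gC1) (divn_small gC1) addn0.
        - have gC1 : (g %% C).+1 = C by lia.
          have -> : g.+1 = a.+1 * C by rewrite mulSnr -[X in _ + X]gC1 addnS -divn_eq.
          by rewrite mulnK // modnMl mul0n min0n gC1; lia.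
      by apply: (digit_eq_lex PE); rewrite ?mk.
  + by move: c2 c3 c1 => /=; rewrite eg /W; lia.
- move=> h1 fr [gk pm pw1 Z c1] /= g0; exists (mkseq (arr h1 bA) k); split=> //; last lia.
  by rewrite g0 /digit_pos div0n mod0n !mul0n min0n in pw1.
Qed.
End Sort.

(** * Comparison of a pattern with a suffix of the text *)

Notation vLO := 17 (only parsing). Notation vHI := 18 (only parsing).
Notation vY := 19 (only parsing). Notation vLT := 20 (only parsing).
Notation vANS := 21 (only parsing). Notation vIDX := 22 (only parsing).
Notation vPID := 23 (only parsing). Notation vPOS := 24 (only parsing).
Notation vQ := 25 (only parsing). Notation vR := 26 (only parsing).
Notation vWA := 27 (only parsing). Notation vDIFF := 28 (only parsing).
Notation vPW := 29 (only parsing).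

(** A suffix need not start at a word boundary: each of its words is assembled from two consecutive
    words of the text. The scan stops at the first nonzero difference. *)
Definition scan_prog : prog :=
  vQ ::= V vPOS #/ V vW;; vR ::= V vPOS #% V vW;;
  vWA ::= K 0;; vDIFF ::= K 0;;
  WhileE (O OpAnd (V vWA #< V vNW) (O OpEq (V vDIFF) (K 0)))
    (vPW ::= M bP (V vPID #+ V vWA);;
     vDIFF ::= O OpXor (O OpOr (M bT (V vQ #+ V vWA) #>> V vR)
                 (M bT (V vQ #+ V vWA #+ K 1) #<< (V vW #- V vR))) (V vPW);;
     vWA ::= V vWA #+ K 1;;
     IfE (O OpEq (V vWA) (V vNW)) (vDIFF ::= V vDIFF #% V vMASK) Skip).

(** The isolated lowest bit of the difference is tested in the pattern word: if it is set there, the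
    suffix has a zero at that position and is smaller. Without a difference, a suffix shorter than
    the pattern is smaller and any other is an occurrence. *)
Definition compare_prog : prog :=
  scan_prog;;
  IfE (V vDIFF)
    (vLT ::= K 0 #< O OpAnd (O OpAnd (V vDIFF) (K 0 #- V vDIFF)) (V vPW))
    (IfE (V vN #< V vPOS #+ V vM) (vLT ::= K 1) (vANS ::= K 1)).

Lemma andbE w (b1 b2 : bool) : 0 < w -> binop_sem w OpAnd b1 b2 = b1 && b2.
Proof.
move=> w0; have w2 : 1 < 2 ^ w by rewrite -{1}(expn0 2) ltn_exp2l.
by case: b1 b2 => [] []; rewrite /binop_sem /trunc_word /= modn_small // ltnW.
Qed.

Lemma negwE w x : 0 < x -> binop_sem w OpSub 0 x = 2 ^ w - x.
Proof.
move=> x0; rewrite /binop_sem /trunc_word add0n modn_small //.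
by have : 0 < 2 ^ w by [rewrite expn_gt0]; lia.
Qed.

Lemma land_pow2_gt0 w v y : v < w -> (0 < binop_sem w OpAnd (2 ^ v) y) = bit y v.
Proof.
move=> vw; have b2 i : bit (2 ^ v) i = (i == v).
  rewrite -[2 ^ v]mul1n bit_shl; case: (ltngtP v i) => [vi|//|->].
    by rewrite -(subnSK vi) bitS /bit div0n.
  by rewrite subnn bit0.
case: (boolP (bit y v)) => yv.
  rewrite lt0n; apply: contraTneq isT => z.
  by have := bit_andE w (2 ^ v) y v; rewrite z vw b2 eqxx yv /bit div0n.
rewrite [binop_sem _ _ _ _](@eq_from_bit w _ 0) //; first exact: binop_lt.
  by rewrite expn_gt0.
move=> i iw; rewrite bit_andE b2 [RHS]/bit div0n.
by case: eqP => [->|_]; rewrite /= ?(negbTE yv) ?andbF.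
Qed.

Section Compare.
Variables (w n m i : nat) (T S : seq bool) (TX PX : nat -> nat).
Let nw := num_digits w m.
Hypotheses (w1 : 1 < w) (m0 : 0 < m) (nm : n + m < 2 ^ w).
Hypothesis nw2 : forall p, p < n -> p %/ w + nw + 1 < 2 ^ w.
Hypotheses (sT : size T = n) (sS : size S = m) (inw : i * nw + nw < 2 ^ w).
Hypothesis T2 : forall a, TX a < 2 ^ w.
Hypothesis TE : forall a t, t < w -> bit (TX a) t = nthb T (a * w + t).
Hypothesis PE : forall a t, a < nw -> t < w -> bit (PX (i * nw + a)) t = nthb S (a * w + t).

Lemma last_word : nw.-1 * w < m <= nw * w.
Proof.
rewrite /nw /num_digits /=; have := leq_divM m.-1 w.
by have := @ltn_ceil m.-1 w; lia.
Qed.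

(** Also valid for [r = 0]: the shift by [w] of the second word is then truncated to 0. *)
Lemma text_word q r a t : r < w -> t < w ->
  bit (binop_sem w OpOr (binop_sem w OpShr (TX (q + a)) r)
         (binop_sem w OpShl (TX (q + a + 1)) (w - r))) t =
  nthb T (q * w + r + (a * w + t)).
Proof.
move=> rw tw; rewrite bit_orE tw bit_shrE bit_shlE tw /=.
case: (ltnP (r + t) w) => rt.
  rewrite TE // [_ <= t]leqNgt (_ : t < _) /= ?orbF; last lia.
  by congr nthb; rewrite mulnDl; lia.
rewrite (bit_high (T2 _) rt) (_ : _ <= t); last lia.
rewrite TE; last lia.
by congr nthb; rewrite !mulnDl; lia.
Qed.

Lemma wp_scan p h :
  p < n -> var h vN = n -> var h vM = m -> var h vW = w -> var h vNW = nw ->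
  var h vMASK = last_mask w m ->
  var h vPID = i * nw -> var h vPOS = p -> arr h bT = TX -> arr h bP = PX ->
  wp w scan_prog h (fun h' => clk h' <= clk h + 100 * nw + 50 /\
    if var h' vDIFF == 0 then
      forall l, l < m -> nthb (drop p T) l = nthb S l
    else exists a, [/\ a < nw, var h' vDIFF < 2 ^ w,
       (forall l, l < a * w -> nthb (drop p T) l = nthb S l),
       (forall t, bit (var h' vDIFF) t = [&& t < w, a * w + t < m &
           nthb (drop p T) (a * w + t) != nthb S (a * w + t)]) &
       var h' vPW = PX (i * nw + a)]).
Proof.
move=> pn en em ew enw emask epid epos eT eP.
have w0 : 0 < w by lia.
have ww : w < 2 ^ w by apply: ltn_expl.
have lw := last_word.
have [q [r [epq rw qw]]] : exists q r, [/\ p = q * w + r, r < w & q + nw + 1 < 2 ^ w].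
  exists (p %/ w), (p %% w); split; [exact: divn_eq|exact: ltn_pmod|exact: nw2].
apply: wp_seq; apply: (wp_assign_eq (v := q)) => //.
  rewrite /= ew epos divE; last by lia.
  by rewrite epq divnMDl // divn_small // addn0.
apply: wp_seq; apply: (wp_assign_eq (v := r)) => //.
  rewrite /= ew epos modE; last by lia.
  by rewrite epq modnMDl modn_small.
apply: wp_seq; apply: (wp_assign_eq (v := 0)) => //; first by rewrite /= truncE //; lia.
apply: wp_seq; apply: (wp_assign_eq (v := 0)) => //; first by rewrite /= truncE //; lia.
pose DB a t := [&& t < w, a * w + t < m &
           nthb (drop p T) (a * w + t) != nthb S (a * w + t)].
(* The loop invariant records agreement before the last word read only; a zero difference extends it
   through that word, within the length [m]. *)
have noDB h1 a : var h1 vDIFF = 0 -> 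
   (forall l, l < a.-1 * w -> nthb (drop p T) l = nthb S l) ->
   (0 < a -> forall t, bit (var h1 vDIFF) t = DB a.-1 t) ->
   (forall l, l < a * w -> l < m -> nthb (drop p T) l = nthb S l).
  move=> z eql dbl l la lm; case: (ltnP l (a.-1 * w)) => [/eql //|al].
  case: a eql dbl la al => // a eql dbl la al; rewrite /= in dbl al.
  have := dbl isT (l - a * w); rewrite z /bit div0n /= /DB subnKC // lm.
  have -> : l - a * w < w by rewrite mulSn in la; lia.
  by move/esym/negbFE/eqP.
apply: (@wp_while_frame _ _ _ (fun h' => exists a, [/\ var h' vWA = a, a <= nw,
   (forall l, l < a.-1 * w -> nthb (drop p T) l = nthb S l),
   (0 < a -> [/\ var h' vDIFF < 2 ^ w, forall t, bit (var h' vDIFF) t = DB a.-1 t &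
      var h' vPW = PX (i * nw + a.-1)]) &
   (a = 0 -> var h' vDIFF = 0) /\
   clk h' <= clk h + 100 * a + 20]) (fun h' => nw - var h' vWA)) => //.
- by exists 0; split=> //=; lia.
- move=> h1 fr [a [eA an eql dbl [a0 c1]]] /=.
  have eNW : var h1 vNW = nw by rewrite (fr_var fr).
  have eW : var h1 vW = w by rewrite (fr_var fr).
  have eMASK : var h1 vMASK = last_mask w m by rewrite (fr_var fr).
  have ePID : var h1 vPID = i * nw by rewrite (fr_var fr).
  have eQ : var h1 vQ = q by rewrite (fr_var fr).
  have eR : var h1 vR = r by rewrite (fr_var fr).
  have eT1 : arr h1 bT = TX by rewrite (fr_arr fr).
  have eP1 : arr h1 bP = PX by rewrite (fr_arr fr).
  rewrite truncE ?expn_gt0 // ltE // weqE // andbE // eA eNW.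
  rewrite eqb0 negbK => /andP[alt /eqP dz].
  have eql' : forall l, l < a * w -> nthb (drop p T) l = nthb S l.
    move=> l la; apply: (noDB h1 a dz eql _ _ la); first by move=> /dbl[].
    have : a * w <= nw.-1 * w by rewrite leq_mul2r; lia.
    lia.
  apply: wp_seq; apply: (wp_assign_eq (v := PX (i * nw + a))) => //.
    by rewrite /= eP1 ePID eA addE //; lia.
  apply: wp_seq; apply: wp_assign => //=.
  rewrite eT1 eQ eR eW eA truncE; last by lia.
  rewrite (@addE w q a); last lia.
  rewrite (@addE w (q + a) 1); last lia.
  rewrite subE; [|exact: ltnW|exact: ww].
  set X := binop_sem w OpXor _ _.
  have bX t : bit X t = (t < w) && (nthb (drop p T) (a * w + t) != nthb S (a * w + t)).
    rewrite bit_xorE; case: ltnP => //= tw; by rewrite nth_drop epq -text_word // PE.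
  apply: wp_seq; apply: (wp_assign_eq (v := a.+1)) => //.
    by rewrite /= eA truncE ?addE ?addn1 //; lia.
  apply: wp_if => //=; rewrite eNW weqE //.
    rewrite eqb0 negbK => /eqP ea.
    apply: (wp_assign_eq (v := X %% 2 ^ (m - m.-1 %/ w * w))) => //.
      rewrite /= eMASK modE /last_mask ?powtrunc //; last exact: binop_lt.
      case: ltnP => // le; rewrite modn0 [RHS]modn_small //.
      by apply: leq_trans (binop_lt _ _ _ _) _; rewrite leq_exp2l.
    split; last by rewrite /= ?eA; apply: ltn_sub2l.
    exists a.+1; split=> //=; last lia.
    move=> _; split=> //.
      by apply: leq_ltn_trans (leq_mod _ _) (binop_lt _ _ _ _).
    move=> t; rewrite bit_mod bX /DB.
    have -> : m.-1 %/ w = a by rewrite -[LHS]/(nw.-1) -ea.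
    by rewrite ltn_subRL andbCA.
  move=> /eqP; rewrite eqb0 => /eqP nea.
  apply: wp_skip; split; last by rewrite /= ?eA; apply: ltn_sub2l.
  exists a.+1; split=> //=; last lia.
  move=> _; split=> //; first exact: binop_lt.
  move=> t; rewrite bX /DB; case: ltnP => //= tw.
  have : a.+1 * w <= nw.-1 * w by rewrite leq_mul2r; lia.
  by rewrite mulSn => H; have -> : a * w + t < m by lia.
- move=> h1 fr [a [eA an eql dbl [a0 c1]]] /=.
  have eNW : var h1 vNW = nw by rewrite (fr_var fr).
  rewrite truncE ?expn_gt0 // ltE // weqE // andbE // eA eNW.
  move=> /eqP; rewrite eqb0 => nc.
  split; first by lia.
  case: eqP nc => [dz|dnz] nc.
    have ea : a = nw by move: nc; rewrite andbT -leqNgt; lia.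
    move=> l lm; apply: (noDB h1 a dz eql _ _ _ lm); first by move=> /dbl[].
    rewrite ea; lia.
  have a1 : 0 < a by case: a a0 {eA an eql dbl c1 nc} => // /(_ erefl).
  by case: (dbl a1) => *; exists a.-1; split=> //; lia.
Qed.

Lemma wp_compare p h :
  p < n -> var h vN = n -> var h vM = m -> var h vW = w -> var h vNW = nw ->
  var h vMASK = last_mask w m ->
  var h vPID = i * nw -> var h vPOS = p -> arr h bT = TX -> arr h bP = PX ->
  var h vLT = 0 ->
  wp w compare_prog h (fun h' =>
    [/\ var h' vLT = slt (drop p T) S,
        var h' vANS = (if prefix S (drop p T) then 1 else var h vANS) &
        clk h' <= clk h + 100 * nw + 100]).
Proof.
move=> pn en em ew enw emask epid epos eT eP elt.
have w0 : 0 < w by lia.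
have ww : w < 2 ^ w by apply: ltn_expl.
apply: wp_seq; apply: wp_conseq.
  by apply: wp_frame; apply: wp_scan pn en em ew enw emask epid epos eT eP.
move=> h1 [[c1 sc] fr].
have eLT : var h1 vLT = 0 by rewrite (fr_var fr).
have eANS : var h1 vANS = var h vANS by rewrite (fr_var fr).
have eN : var h1 vN = n by rewrite (fr_var fr).
have eM : var h1 vM = m by rewrite (fr_var fr).
have ePOS : var h1 vPOS = p by rewrite (fr_var fr).
apply: wp_if => //= d0; last first.
  rewrite d0 eqxx in sc; rewrite -sS in sc.
  (* All [m] bits agree, with zeros read past the end of the text, so the length of the suffix
     decides. *)
  have [e1 e2] := prefix_first_diff sc; rewrite size_drop sT sS in e1 e2.
  have npm : p + m < 2 ^ w by lia.
  apply: wp_if => //=; rewrite eN eM ePOS addE // ltE //.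
    rewrite eqb0 negbK => le.
    apply: (wp_assign_eq (v := 1)) => //; first by rewrite /= truncE //; lia.
    rewrite /= e1 e2 eANS; split; last by lia.
      by have -> : n - p < m by lia.
    by case: leqP => //; lia.
  move=> /eqP; rewrite eqb0 => le.
  apply: (wp_assign_eq (v := 1)) => //; first by rewrite /= truncE //; lia.
  rewrite /= e1 e2 eLT; split; last by lia.
    by have -> : n - p < m = false by lia.
  by case: leqP => //; lia.
rewrite (negbTE d0) in sc; case: sc => a [an dl eql db epw].
have [|v [vw lb bv lo]] := @land_negw w (var h1 vDIFF); first by lia.
have := db v; rewrite bv vw => /esym /= /andP[vm ne].
have eqv j : j < a * w + v -> nthb (drop p T) j = nthb S j.
  move=> jv; case: (ltnP j (a * w)) => [/eql//|aj].
  have jw : j - a * w < w by lia.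
  have := lo (j - a * w); rewrite db jw subnKC // (_ : j < m) /=; last lia.
  by rewrite negbK => H; apply/eqP/H; lia.
have eb : (0 < binop_sem w OpAnd (binop_sem w OpAnd (var h1 vDIFF)
     (binop_sem w OpSub 0 (var h1 vDIFF))) (var h1 vPW)) = nthb S (a * w + v).
  rewrite negwE; last by lia.
  have -> : binop_sem w OpAnd (var h1 vDIFF) (2 ^ w - var h1 vDIFF) = 2 ^ v.
    by rewrite /binop_sem lb truncE // ltn_exp2l.
  by rewrite land_pow2_gt0 // epw PE.
apply: (wp_assign_eq (v := nthb S (a * w + v))) => //.
  by rewrite /= truncE ?expn_gt0 // ltE // eb.
rewrite /= eANS.
case: (boolP (nthb S (a * w + v))) ne => bS ne.
  have [||||l1 l2] := @slt_first_diff (drop p T) S (a * w + v); rewrite ?sS //.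
    by apply/negbTE; move: ne; rewrite eqb_id.
  by rewrite l1 (negbTE l2); split=> //; lia.
have [||||l1 l2] := @sgt_first_diff (drop p T) S (a * w + v); rewrite ?sS ?(negbTE bS) //.
  by move: ne; rewrite eqbF_neg negbK.
by rewrite (negbTE l1) (negbTE l2); split=> //; lia.
Qed.
End Compare.

(** * Search of the sorted patterns in the suffix array *)

Definition probe_prog (query : prog) : prog :=
  vLT ::= K 0;;
  IfE (V vN #< V vY) Skip
    (SetArg 0 (V vY);; relocate query;; GetRes vPOS 0;; vPOS ::= V vPOS #- K 1;;
     compare_prog).

Definition gallop_prog (query : prog) : prog :=
  WhileE (V vLT)
    (vLO ::= V vHI;; vHI ::= V vLO #+ V vW;; vY ::= V vHI;; probe_prog query).

Definition bisect_prog (query : prog) : prog :=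
  WhileE (K 1 #< V vHI #- V vLO)
    (vY ::= (V vLO #+ V vHI) #/ K 2;; probe_prog query;;
     IfE (V vLT) (vLO ::= V vY) (vHI ::= V vY)).

Definition search_prog (query : prog) : prog :=
  vLO ::= K 0;; vIDX ::= K 0;; vANS ::= K 0;;
  WhileE (V vIDX #< V vK)
    (vPID ::= M bA (V vIDX) #* V vNW;; vLT ::= K 1;; vHI ::= V vLO;;
     gallop_prog query;; bisect_prog query;; vIDX ::= V vIDX #+ K 1).

Section Search.
Variables (w n k m : nat) (T : seq bool) (Ps : nat -> seq bool) (TX PX : nat -> nat).
Variables (query : prog) (Reach : state -> Prop) (Qt : nat).
Let nw := num_digits w m.
Hypotheses (w1 : 1 < w) (m0 : 0 < m) (nm : n + m < 2 ^ w).
Hypothesis nw2 : forall p, p < n -> p %/ w + nw + 1 < 2 ^ w.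
Hypotheses (n2 : 2 * n + w + 1 < 2 ^ w) (k2 : k * nw < 2 ^ w).
Hypotheses (sT : size T = n) (sP : forall i, i < k -> size (Ps i) = m).
Hypothesis T2 : forall a, TX a < 2 ^ w.
Hypothesis TE : forall a t, t < w -> bit (TX a) t = nthb T (a * w + t).
Hypothesis PE : forall i a t, i < k -> a < nw -> t < w ->
  bit (PX (i * nw + a)) t = nthb (Ps i) (a * w + t).
(** [Reach] abstracts the states a sequence of queries can lead to; it must be preserved because a
    query may modify the data structure. *)
Hypothesis query_spec : forall o y, Reach o -> 1 <= y <= n ->
  exists t o', [/\ exec w query (set_reg o 0 y) t o', t <= Qt,
    reg o' 0 = suffix_array T y & Reach o'].

Record env (h : hst) : Prop := Env {
  env_n : var h vN = n; env_k : var h vK = k; env_m : var h vM = m;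
  env_w : var h vW = w; env_nw : var h vNW = nw;
  env_mask : var h vMASK = last_mask w m;
  env_T : arr h bT = TX; env_P : arr h bP = PX }.

Lemma env_frame p h h' : frame p h h' ->
  all (fun x => ~~ wreg p x) [:: vN; vK; vM; vW; vNW; vMASK] ->
  ~~ wbank p bT -> ~~ wbank p bP -> env h -> env h'.
Proof.
move=> fr /= /and5P[w0 w1' w2 w3 /and3P[w4 w5 _]] b0 b1 [eN eK eM eW eNW eMASK eT eP].
by split; rewrite ?(fr_var fr) ?(fr_arr fr).
Qed.

(** Galloping may overshoot the array: a rank above [n] counts as not below the pattern and costs no
    query. *)
Lemma wp_probe i y h : env h -> i < k -> var h vPID = i * nw -> var h vY = y ->
  0 < y -> Reach (orc h) ->
  wp w (probe_prog query) h (fun h' =>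
    [/\ Reach (orc h'), var h' vLT = (y <= n) && slt (suf T y) (Ps i),
        var h' vANS = (if (y <= n) && prefix (Ps i) (suf T y) then 1 else var h vANS) &
        clk h' <= clk h + Qt + 100 * nw + 120]).
Proof.
move=> [eN eK eM eW eNW eMASK eT eP] ik ePID eY y0 R.
have w0 : 0 < w by lia.
have ww : w < 2 ^ w by apply: ltn_expl.
have inw : i * nw + nw <= k * nw by rewrite -mulSnr leq_mul2r ik orbT.
apply: wp_seq; apply: (wp_assign_eq (v := 0)) => //; first by rewrite /= truncE //; lia.
apply: wp_if => //=; rewrite eN eY ltE // => c.
  have -> : y <= n = false by lia.
  by apply: wp_skip; split=> //=; lia.
have yn : y <= n by lia.
rewrite yn; apply: wp_seq; apply: wp_setarg => //=; rewrite eY.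
have [|t [st [ex tQ eo R']]] := query_spec (y := y) R; first by lia.
apply: wp_seq; apply: (wp_call (o := st) (t := t)) => //=.
apply: wp_seq; apply: wp_getres => //=; rewrite eo.
have sar : 1 <= suffix_array T y <= n by rewrite -sT; apply: sa_range; rewrite sT; lia.
rewrite truncE; last lia.
apply: wp_seq; apply: (wp_assign_eq (v := (suffix_array T y).-1)) => //.
  by rewrite /= truncE ?subE ?subn1 //; lia.
apply: wp_conseq.
  apply: wp_frame.
  have PEi a t' : a < nw -> t' < w -> bit (PX (i * nw + a)) t' = nthb (Ps i) (a * w + t').
    exact: PE.
  have inw' := leq_ltn_trans inw k2.
  have pn : (suffix_array T y).-1 < n by lia.
  by apply: (wp_compare w1 m0 nm nw2 sT (sP ik) inw' T2 TE PEi pn).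
move=> h' [[e1 e2 c1] fr]; split=> //.
- by rewrite (fr_orc fr).
- by move: c1 => /=; lia.
Qed.

Definition good i lo := forall y, 1 <= y <= lo -> slt (suf T y) (Ps i).
(** The upper end of a search interval: if it is a genuine rank, it has been probed, so an
    occurrence there is already recorded in [ans]. *)
Definition bad i hi ans := hi <= n ->
  ~~ slt (suf T hi) (Ps i) /\ (prefix (Ps i) (suf T hi) -> ans = 1).
(** Soundness of the answer register: it changes only for a real occurrence, at whatever rank was
    probed. *)
Definition ans_step i (a0 a : nat) := a = a0 \/ a = 1 /\ infix (Ps i) T.

Lemma good_at i y : y <= n -> slt (suf T y) (Ps i) -> good i y.
Proof.
move=> yn yP z /andP[z1 zy]; apply: sle_slt_trans yP.
by apply: suf_mono => //; rewrite sT.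
Qed.

Lemma bad_mono i hi (b : bool) a : bad i hi a -> bad i hi (if b then 1 else a).
Proof. by case: b => // B /B[? ?]. Qed.

Lemma ans_step_probe i y a0 a : i < k -> 0 < y -> ans_step i a0 a ->
  ans_step i a0 (if (y <= n) && prefix (Ps i) (suf T y) then 1 else a).
Proof.
move=> ik y0 s; case: ifP => // /andP[yn pr]; right; split=> //.
apply/infix_dropP; first by rewrite sP.
by exists (suffix_array T y) => //; apply: sa_range; rewrite sT y0.
Qed.

Let W := Qt + 100 * nw + 200.

(* The time is multiplied by [w]: a step, which costs at most [W], advances the rank by
   [w], so the total cost of galloping is [W] per unit of rank. *)
Lemma wp_gallop i lo h : env h -> i < k -> var h vPID = i * nw -> Reach (orc h) ->
  var h vLT = 1 -> var h vLO = lo -> var h vHI = lo -> lo <= n -> good i lo ->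
  wp w (gallop_prog query) h (fun h' => exists lo',
    [/\ [/\ Reach (orc h'), var h' vLO = lo' & var h' vHI = lo' + w],
        lo' <= n, good i lo',
        bad i (lo' + w) (var h' vANS) /\ ans_step i (var h vANS) (var h' vANS) &
        w * clk h' + W * lo <= w * (clk h + 10) + W * (lo' + w)]).
Proof.
move=> En ik ePID R eLT eLO eHI lon gl.
have w0 : 0 < w by lia.
have ww : w < 2 ^ w by apply: ltn_expl.
apply: (@wp_while_frame _ _ _ (fun h' => [/\ Reach (orc h'),
   w * clk h' + W * lo <= w * clk h + W * var h' vHI,
   ans_step i (var h vANS) (var h' vANS) &
   if var h' vLT == 0 then
     [/\ var h' vHI = var h' vLO + w, var h' vLO <= n, good i (var h' vLO) &
         bad i (var h' vHI) (var h' vANS)]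
   else var h' vHI <= n /\ good i (var h' vHI)])
   (fun h' => (n + w).+1 - var h' vHI)) => //.
- by rewrite eLT eHI; split=> //; left.
- move=> h1 fr [R1 c1 as1 H] /= lt0.
  have E1 : env h1 by apply: env_frame fr _ _ _ En; rewrite /= ?wreg_relocate ?wbank_relocate.
  have ePID1 : var h1 vPID = i * nw by rewrite (fr_var fr) //= ?wreg_relocate.
  rewrite (negbTE lt0) in H; case: H => hn gh.
  set hi := var h1 vHI in c1 hn gh *.
  apply: wp_seq; apply: (wp_assign_eq (v := hi)) => //.
  apply: wp_seq; apply: (wp_assign_eq (v := hi + w)) => //.
    by rewrite /= (env_w E1) addE //; lia.
  apply: wp_seq; apply: (wp_assign_eq (v := hi + w)) => //.
  apply: wp_conseq.
    apply: wp_frame; apply: (@wp_probe i (hi + w)) => //=; last by lia.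
    by case: E1 => *; split.
  move=> h2 [[R2 e2 e3 c2] fr2].
  have eHI2 : var h2 vHI = hi + w by rewrite (fr_var fr2) //= ?wreg_relocate.
  have eLO2 : var h2 vLO = hi by rewrite (fr_var fr2) //= ?wreg_relocate.
  rewrite eHI2 eLO2; split; last by lia.
  split=> //.
  + have : w * clk h2 <= w * (clk h1 + W).
      by rewrite leq_mul2l; apply/orP; right; move: c2 => /=; rewrite /W; lia.
    rewrite !mulnDr; lia.
  + by rewrite e3; apply: ans_step_probe => //; lia.
  (* A rank past the end of the array ends the gallop, and [bad] then holds vacuously. *)
  + rewrite e2 e3; case: (boolP (hi + w <= n)) => //= hwn.
      case: (boolP (slt _ _)) => sl /=; first by split=> //; apply: good_at.
      by split=> // _; split=> // ->.
    by split=> //; move: hwn => /negP hwn /hwn.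
- move=> h1 fr [R1 c1 as1 H] /= lt0; rewrite lt0 eqxx in H.
  case: H => e1 ln gl1 b1; exists (var h1 vLO); rewrite -e1; split=> //.
  by rewrite mulnDr; rewrite mulnDr; lia.
Qed.

(** [e] is the number of halvings still allowed, each paid by one [W]. The invariant keeps [good] at
    the lower and [bad] at the upper end, so the final upper end [lo'.+1] is the first suffix not
    below the pattern and needs no further probe. *)
Lemma wp_bisect i lo hi e h : env h -> i < k -> var h vPID = i * nw -> Reach (orc h) ->
  var h vLO = lo -> var h vHI = hi -> lo <= n -> lo < hi -> hi <= n + w ->
  hi - lo <= 2 ^ e -> good i lo -> bad i hi (var h vANS) ->
  wp w (bisect_prog query) h (fun h' => exists lo',
    [/\ Reach (orc h') /\ var h' vLO = lo', lo <= lo' <= n, good i lo',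
        bad i lo'.+1 (var h' vANS) /\ ans_step i (var h vANS) (var h' vANS) &
        clk h' <= clk h + W * e + 10]).
Proof.
move=> En ik ePID R eLO eHI lon lohi hin he gl bh.
have w0 : 0 < w by lia.
have ww : w < 2 ^ w by apply: ltn_expl.
apply: (@wp_while_frame _ _ _ (fun h' => [/\ Reach (orc h') /\ lo <= var h' vLO <= n,
   var h' vLO < var h' vHI <= n + w,
   ans_step i (var h vANS) (var h' vANS),
   good i (var h' vLO) /\ bad i (var h' vHI) (var h' vANS) &
   exists e', var h' vHI - var h' vLO <= 2 ^ e' /\
     clk h' + W * e' <= clk h + W * e])
   (fun h' => var h' vHI - var h' vLO)) => //.
- rewrite eLO eHI; split; [|lia|by left| |by exists e]; split=> //; lia.
- move=> h1 fr [[R1 l1] l2 as1 [g1 b1] [e' [he' c1]]] /=.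
  have E1 : env h1 by apply: env_frame fr _ _ _ En; rewrite /= ?wreg_relocate ?wbank_relocate.
  have ePID1 : var h1 vPID = i * nw by rewrite (fr_var fr) //= ?wreg_relocate.
  set lo1 := var h1 vLO in l1 l2 g1 he' *; set hi1 := var h1 vHI in l2 b1 he' *.
  rewrite truncE; last lia.
  rewrite subE; [|lia|lia].
  rewrite ltE // eqb0 negbK => gap.
  case: e' he' c1 => [|e'] he' c1; first by lia.
  rewrite expnS in he'.
  set mid := (lo1 + hi1) %/ 2.
  have midE : mid * 2 <= lo1 + hi1 < mid * 2 + 2.
    by rewrite leq_divM /=; have := @ltn_ceil (lo1 + hi1) 2; rewrite -/mid; lia.
  apply: wp_seq; apply: (wp_assign_eq (v := mid)) => //.
    by rewrite /= -/lo1 -/hi1 addE ?truncE ?divE //; lia.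
  apply: wp_seq; apply: wp_conseq.
    apply: wp_frame; apply: (@wp_probe i mid) => //=; last by lia.
    by case: E1 => *; split.
  move=> h2 [[R2 e2 e3 c2] fr2].
  have eHI2 : var h2 vHI = hi1 by rewrite (fr_var fr2) //= ?wreg_relocate.
  have eLO2 : var h2 vLO = lo1 by rewrite (fr_var fr2) //= ?wreg_relocate.
  have eY2 : var h2 vY = mid by rewrite (fr_var fr2) //= ?wreg_relocate.
  have as2 : ans_step i (var h vANS) (var h2 vANS).
    by rewrite e3; apply: ans_step_probe => //; lia.
  have W2 : clk h2 + 30 <= clk h1 + W by move: c2 => /=; rewrite /W; lia.
  apply: wp_if => //=; rewrite e2 => lt0.
    have /andP[mn sl] : (mid <= n) && slt (suf T mid) (Ps i).
      by move: lt0; rewrite eqb0 negbK.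
    apply: wp_assign => //=; rewrite eY2 eHI2; split; last by lia.
    split=> //; [split=> //; lia|lia| |].
      by split; [apply: good_at|rewrite e3; apply: bad_mono].
    exists e'; split; [lia|move: c1; rewrite mulnS; lia].
  apply: wp_assign => //=; rewrite eY2 eLO2; split; last by lia.
  split=> //; [lia| |].
    split=> // mn; rewrite mn /= in lt0 e3; split; first by move: lt0; case: slt.
    by move=> pr; rewrite e3 pr.
  exists e'; split; [lia|move: c1; rewrite mulnS; lia].
- move=> h1 fr [[R1 l1] l2 as1 [g1 b1] [e' [he' c1]]] /=.
  rewrite truncE; last lia.
  rewrite subE; [|lia|lia].
  rewrite ltE // => /eqP; rewrite eqb0 => gap; exists (var h1 vLO).
  have <- : var h1 vHI = (var h1 vLO).+1 by lia.
  split=> //; lia.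
Qed.


(** The term [W * var h' vLO] of the invariant is a potential: ranks never decrease, so all gallops
    together pay at most [W * n] in time multiplied by [w]. *)
Lemma wp_search s e h : env h -> Reach (orc h) -> mkseq (arr h bA) k = s ->
  perm_eq s (iota 0 k) -> pairwise (lex_rel (fun i => nthb (Ps i)) 0) s ->
  w <= 2 ^ e ->
  wp w (search_prog query) h (fun h' =>
    var h' vANS = has (fun i => infix (Ps i) T) (iota 0 k) /\
    w * clk h' <= w * (clk h + 30) + W * n + w * (k * (W * (e + 2)))).
Proof.
move=> En R es ps so we.
have w0 : 0 < w by lia.
have ww : w < 2 ^ w by apply: ltn_expl.
have sk i : i \in s -> i < k by rewrite (perm_mem ps) mem_iota.
have ss : size s = k by rewrite (perm_size ps) size_iota.
have nw0 : 0 < nw by [].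
have kw : k < 2 ^ w by apply: leq_ltn_trans k2; rewrite leq_pmulr.
apply: wp_seq; apply: (wp_assign_eq (v := 0)) => //; first by rewrite /= truncE //; lia.
apply: wp_seq; apply: (wp_assign_eq (v := 0)) => //; first by rewrite /= truncE //; lia.
apply: wp_seq; apply: (wp_assign_eq (v := 0)) => //; first by rewrite /= truncE //; lia.
(* Cost per pattern besides the advance of the rank: one [W] for the last, overshooting gallop step,
   [e] for the bisection, one for the constant overhead. *)
pose D := W * (e + 2).
apply: (@wp_while_frame _ _ _ (fun h' => [/\ Reach (orc h') /\ var h' vIDX <= k,
   var h' vLO <= n,
   (forall i, i \in drop (var h' vIDX) s -> good i (var h' vLO)),
   var h' vANS = has (fun i => infix (Ps i) T) (take (var h' vIDX) s) &
   w * clk h' <= w * (clk h + 20) + W * var h' vLO + w * (var h' vIDX * D)])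
   (fun h' => k - var h' vIDX)) => //.
- split=> //=; [by move=> i _ y; lia|by rewrite take0|].
  by rewrite !mulnDr; lia.
- move=> h1 fr [[R1 jk] lon gs eans c1] /=.
  have E1 : env h1.
    by apply: env_frame fr _ _ _ _; rewrite /= ?wreg_relocate ?wbank_relocate //;
    case: En => *; split.
  have eA : arr h1 bA = arr h bA by rewrite (fr_arr fr) //= ?wbank_relocate.
  rewrite (env_k E1) ltE // eqb0 negbK.
  set j := var h1 vIDX in jk gs eans c1 * => jlt.
  set lo := var h1 vLO in lon gs c1 *.
  pose i := nth 0 s j.
  have dj : drop j s = i :: drop j.+1 s by apply: drop_nth; rewrite ss.
  have i_s : i \in s by apply: mem_nth; rewrite ss.
  have ik := sk _ i_s.
  have inw : i * nw + nw <= k * nw by rewrite -mulSnr leq_mul2r ik orbT.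
  apply: wp_seq; apply: (wp_assign_eq (v := i * nw)) => //.
    by rewrite /= (env_nw E1) eA -/j mulE -[arr h _ _](@nth_mkseq _ 0 _ k) ?es //; lia.
  apply: wp_seq; apply: (wp_assign_eq (v := 1)) => //; first by rewrite /= truncE //; lia.
  apply: wp_seq; apply: (wp_assign_eq (v := lo)) => //.
  apply: wp_seq; apply: wp_conseq.
    apply: wp_frame; apply: (@wp_gallop i lo) => //=.
      by case: E1 => *; split.
    by apply: gs; rewrite dj mem_head.
  move=> h2 [[lo2 [[R2 eLO2 eHI2] ln2 g2 [b2 as2] c2]] fr2].
  have E2 : env h2.
    apply: env_frame fr2 _ _ _ _; rewrite /= ?wreg_relocate ?wbank_relocate //.
    by case: E1 => *; split.
  have ePID2 : var h2 vPID = i * nw by rewrite (fr_var fr2) //= ?wreg_relocate.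
  apply: wp_seq; apply: wp_conseq.
    apply: wp_frame; apply: (@wp_bisect i lo2 (lo2 + w) e) => //=; lia.
  move=> h3 [[lo3 [[R3 eLO3] ln3 g3 [b3 as3] c3]] fr3].
  have eIDX3 : var h3 vIDX = j.
    by rewrite (fr_var fr3) //= ?wreg_relocate // (fr_var fr2) //= ?wreg_relocate.
  apply: (wp_assign_eq (v := j.+1)) => //.
    by rewrite /= eIDX3 truncE ?addE ?addn1 //; lia.
  rewrite /= eLO3; split; last by lia.
  have eI : infix (Ps i) T = (lo3 < n) && prefix (Ps i) (suf T lo3.+1).
    rewrite -sT; apply: infix_search => //; [by rewrite sP|rewrite sT; lia|].
    by rewrite sT => /b3[].
  have szd : {in s, forall i, size (Ps i) = m} by move=> x /sk /sP.
  split=> //; first by lia.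
  (* Suffixes below the current pattern are below every later one, as the patterns are sorted; hence
     the next search may start here. *)
  + move=> i' i's y /g3 /slt_sle_trans; apply.
    have : pairwise (lex_rel (fun i => nthb (Ps i)) 0) (drop j s).
      by move: so; rewrite -{1}(cat_take_drop j s) pairwise_cat => /and3P[].
    rewrite dj /= => /andP[/allP/(_ _ i's)/andP[_ /asboolP le] _].
    apply: sle_first_diff; last by rewrite !szd //; apply: (mem_drop i's).
    by move=> l eql; apply: le => // l' /=; apply: eql.
  + rewrite (take_nth 0) ?ss // -/i -cats1 has_cat /= orbF.
    move: b3 as2 as3; rewrite /bad /ans_step /= eans => b3 as2 as3.
    case: (boolP (infix (Ps i) T)) => I; last first.
      rewrite orbF (negbTE I) in as2 as3 *.
      by case: as3 => [->|[]//]; case: as2 => [->|[]//].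
    by rewrite orbT; move: I; rewrite eI => /andP[l3 pr]; apply: (b3 l3).2.
  + have X1 : w * clk h3 <= w * (clk h2 + W * e + 10) by rewrite leq_mul2l c3 orbT.
    have X2 : W * lo2 <= W * lo3 by rewrite leq_mul2l; case/andP: ln3 => ->; rewrite orbT.
    have X3 : w * 200 <= w * W by rewrite leq_mul2l; apply/orP; right; rewrite /W; lia.
    move: c2 X1; rewrite /D /= mulSn !mulnDr; lia.
- move=> h1 fr [[R1 jk] lon gs eans c1] /=.
  have E1 : env h1.
    by apply: env_frame fr _ _ _ _; rewrite /= ?wreg_relocate ?wbank_relocate //;
    case: En => *; split.
  rewrite (env_k E1) ltE // => /eqP; rewrite eqb0 => jk'.
  have ej : var h1 vIDX = k by lia.
  rewrite ej take_oversize ?ss // in eans c1; split.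
    by rewrite eans; congr nat_of_bool; apply: eq_has_r; apply: perm_mem.
  have : W * var h1 vLO <= W * n by rewrite leq_mul2l lon orbT.
  rewrite /= -/D; move: c1; rewrite !mulnDr; lia.
Qed.
End Search.

(** * Packed strings in memory *)

Lemma num_wordsE w m : 0 < w -> 0 < m -> num_words w m = num_digits w m.
Proof.
move=> w0 m0; rewrite /num_words /num_digits.
have -> : m + w.-1 = m.-1 + w by lia.
by rewrite divnDr ?dvdnn // divnn w0 addn1.
Qed.

Lemma size_le_num_words w l : 0 < w -> l <= num_words w l * w.
Proof.
move=> w0; case: l => // l; rewrite num_wordsE // /num_digits /=.
exact: ltn_ceil.
Qed.

Lemma num_words_le w l : 0 < w -> num_words w l <= (l %/ w).+1.
Proof.
move=> w0; case: l => [|l]; first by rewrite /num_words add0n divn_small ?div0n //; lia.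
by rewrite num_wordsE // ltnS leq_div2r.
Qed.

Lemma bit_packed_word w s j t : t < w ->
  bit (packed_word w s j) t = nthb s (j * w + t).
Proof. by move=> tw; rewrite (bit_sum_bits w (fun t => nthb s (j * w + t))) tw. Qed.

Lemma packed_word_lt w s j : packed_word w s j < 2 ^ w.
Proof. exact: (sum_bits_lt w (fun t => nthb s (j * w + t))). Qed.

Lemma packed_default w s a : num_words w (size s) <= a -> nth 0 (packed w s) a = 0.
Proof. by move=> h; rewrite nth_default // size_mkseq. Qed.

Lemma bit_packed w s a t : t < w ->
  bit (nth 0 (packed w s) a) t = nthb s (a * w + t).
Proof.
move=> tw; case: (ltnP a (num_words w (size s))) => h.
  by rewrite nth_mkseq // bit_packed_word.
rewrite packed_default // /bit div0n nth_default //.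
apply: leq_trans (size_le_num_words (size s) (_ : 0 < w)) _; first by lia.
by rewrite (leq_trans _ (leq_addr _ _)) // leq_mul2r h orbT.
Qed.

Lemma nth_packed_lt w s a : nth 0 (packed w s) a < 2 ^ w.
Proof.
case: (ltnP a (num_words w (size s))) => h; last by rewrite packed_default ?expn_gt0.
by rewrite nth_mkseq // packed_word_lt.
Qed.

Lemma nth_flatten_const (S : eqType) (F : S -> seq nat) (D : seq S) x0 q i a :
  (forall x, x \in D -> size (F x) = q) -> i < size D -> a < q ->
  nth 0 (flatten [seq F x | x <- D]) (i * q + a) = nth 0 (F (nth x0 D i)) a.
Proof.
move=> sF iD aq; elim: D i sF iD => // x D IH [|i] sF iD /=; rewrite nth_cat sF ?mem_head //.
  by rewrite add0n aq.
rewrite mulSn -addnA ltnNge leq_addr /= addKn IH // => y yD; apply: sF.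
by rewrite inE yD orbT.
Qed.

Lemma flatten_packed_lt w D a :
  nth 0 (flatten [seq packed w P | P <- D]) a < 2 ^ w.
Proof.
elim: D a => [|P D IH] a /=; first by rewrite nth_nil expn_gt0.
by rewrite nth_cat; case: ifP => _; rewrite ?nth_packed_lt.
Qed.

(** * The complete program for large inputs *)

Definition main_prog (C : nat) (prep query : prog) : prog :=
  word_size_prog;; copy_prog;; relocate prep;; consts_prog C;; table_prog;;
  iota_prog;; sort_prog C;; search_prog query;; vN ::= V vANS.

Definition oracle_ok (w n : nat) (prep query : prog) (T : seq bool) (Pn Qn : nat) : Prop :=
  let s0 := init_state [:: n] [:: packed w T] in
  (exists (t : nat) (s : state), exec w prep s0 t s /\ t <= Pn) /\
  (forall (s : state) (i : nat),
     sa_reachable w n prep query s0 s -> 1 <= i <= n ->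
     exists (t : nat) (s' : state),
       [/\ exec w query (set_reg s 0 i) t s', t <= Qn & reg s' 0 = suffix_array T i]).

Section Main.
Variables (w n k m C e Pn Qn : nat) (T : seq bool) (D : seq (seq bool)).
Variables (prep query : prog).
Let nw := num_digits w m.
Let d := digit_size w C.
Hypotheses (w1 : 1 < w) (m0 : 0 < m) (k0 : 0 < k) (nm : n + m < 2 ^ w).
Hypotheses (nw2 : forall p, p < n -> p %/ w + nw + 1 < 2 ^ w).
Hypotheses (n2 : 2 * n + w + 1 < 2 ^ w) (k2 : k * nw < 2 ^ w).
Hypotheses (C1 : 1 < C < 2 ^ w) (C2 : nw * C < 2 ^ w) (C3 : C * d < 2 ^ w).
Hypotheses (dw : d < w) (we : w <= 2 ^ e).
Hypotheses (sT : size T = n) (sD : size D = k) (sP : forall P, P \in D -> size P = m).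
Hypothesis orc_ok : oracle_ok w n prep query T Pn Qn.

(** Bounds [w] times the running time, so that the galloping term, one probe per [w] ranks, needs no
    division. *)
Definition main_time : nat :=
  w * (15 * w + 20 * (n %/ w) + Pn + 40 * 2 ^ d + 20 * k +
       nw * C * (100 * (k + 2 ^ d) + 200) + 300) +
  (Qn + 100 * nw + 200) * n + w * (k * ((Qn + 100 * nw + 200) * (e + 2))).

Lemma main_exec s :
  reg s vN = n -> reg s vK = k -> reg s vM = m ->
  (forall x, x < nvars -> reg s x < 2 ^ w) -> substate s = zero_state ->
  (forall b, b < bank_off ->
     bank s b = nth 0 (nth [::] [:: packed w T; flatten [seq packed w P | P <- D]] b)) ->
  exists u s', [/\ exec w (main_prog C prep query) s u s',
    w * u <= main_time & reg s' 0 = dm_answer T D].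
Proof.
move=> eN eK eM rlt so bk.
have w0 : 0 < w by lia.
have ww : w < 2 ^ w by apply: ltn_expl.
have [[tp [sp [exp tpP]]] qok] := orc_ok.
pose h0 := HSt (reg s) (fun b => bank s b) zero_state 0.
have r0 : rep w s h0.
  split=> //= b a bb; rewrite bk //.
  case: b bb => [|[|b]] _ /=; [exact: nth_packed_lt|exact: flatten_packed_lt|].
  by rewrite !nth_nil expn_gt0.
have eT0 : arr h0 bT = nth 0 (packed w T) by rewrite /= bk.
have eP0 : arr h0 bP = nth 0 (flatten [seq packed w P | P <- D]) by rewrite /= bk.
have eZ0 b : 2 <= b -> b < bank_off -> arr h0 b = fun _ => 0.
  move=> b2 bb; rewrite /= bk //; case: b b2 bb => [|[|b]] // _ _.
  by apply: funext => a; rewrite /= !nth_nil.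
have d0 : 0 < d by [].
have dC : w <= C * d by rewrite mulnC; apply/ltnW/ltn_ceil; lia.
have PE i a t : i < k -> a < nw -> t < w ->
    bit (nth 0 (flatten [seq packed w P | P <- D]) (i * nw + a)) t =
    nthb (nth [::] D i) (a * w + t).
  move=> ik an tw; rewrite (@nth_flatten_const _ (packed w) D [::] nw) ?sD ?bit_packed //.
  by move=> P PD; rewrite size_mkseq (sP PD) num_wordsE.
suff W : wp w (main_prog C prep query) h0 (fun h' =>
    var h' 0 = dm_answer T D /\ w * clk h' <= main_time).
  have [u [s' [h' [ex r' c [eA tm]]]]] := W _ r0.
  exists u, s'; split=> //; last by rewrite (rep_var r').
  by apply: leq_trans tm; rewrite leq_mul2l c orbT.
apply: wp_seq; apply: wp_conseq (wp_frame (@wp_word_size w h0 w1)) _.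
move=> h1 [[eW1 c1] fr1].
have eN1 : var h1 vN = n by rewrite (fr_var fr1).
have eT1 : arr h1 bT = arr h0 bT by rewrite (fr_arr fr1).
apply: wp_seq; apply: wp_conseq.
  apply: wp_frame; apply: (@wp_copy w n (packed w T)) => //.
  - lia.
  - by rewrite (fr_orc fr1).
  - move=> a na; rewrite eT1 eT0 packed_default // sT.
    exact: leq_trans (num_words_le _ _) na.
  - by move=> a; rewrite eT1 eT0.
move=> h2 [[eO2 c2] fr2].
apply: wp_seq; apply: (wp_call (o := sp) (t := tp)); first by rewrite eO2.
set h3 := tick _ _.
have eW3 : var h3 vW = w by rewrite /= (fr_var fr2).
have eM3 : var h3 vM = m by rewrite /= (fr_var fr2) // (fr_var fr1).
apply: wp_seq; apply: wp_conseq.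
  by apply: wp_frame; apply: (@wp_consts w m C h3) => //; lia.
move=> h4 [[eNW4 eMASK4 eD4 eD24 c4] fr4].
apply: wp_seq; apply: wp_conseq.
  apply: wp_frame; apply: (@wp_table w d h4) => //.
  by rewrite (fr_arr fr4) //= (fr_arr fr2) // (fr_arr fr1) // eZ0.
move=> h5 [[tab5 c5] fr5].
apply: wp_seq; apply: wp_conseq.
  apply: wp_frame; apply: (@wp_iota w k h5) => //; last first.
    by apply: leq_ltn_trans k2; rewrite leq_pmulr.
  by rewrite (fr_var fr5) // (fr_var fr4) //= (fr_var fr2) // (fr_var fr1).
move=> h6 [[eA6 c6] fr6].
have eP6 : arr h6 bP = nth 0 (flatten [seq packed w P | P <- D]).
  by rewrite (fr_arr fr6) // (fr_arr fr5) // (fr_arr fr4) //= (fr_arr fr2) // (fr_arr fr1).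
have eK6 : var h6 vK = k.
  by rewrite (fr_var fr6) // (fr_var fr5) // (fr_var fr4) //= (fr_var fr2) // (fr_var fr1).
have eNW6 : var h6 vNW = nw by rewrite (fr_var fr6) // (fr_var fr5).
have f0 i l : nw * w <= l -> nthb (nth [::] D i) l = false.
  move=> nl; apply: nth_default; case: (ltnP i k) => ik; last by rewrite (nth_default [::]) ?sD.
  rewrite sP ?mem_nth ?sD //; apply: leq_trans nl.
  by rewrite /nw -num_wordsE // size_le_num_words.
apply: wp_seq; apply: wp_conseq.
  apply: wp_frame.
  apply: (wp_sort w1 d0 dw k2 isT (flatten_packed_lt w D) (ltnW (proj1 (andP C1)))
    C2 dC C3 PE f0) => //.
  - by rewrite (fr_var fr6) // (fr_var fr5).
  - by rewrite (fr_var fr6) // (fr_var fr5).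
  - by move=> u ud; rewrite (fr_arr fr6) // tab5.
  - move=> x xd; rewrite (fr_arr fr6) // (fr_arr fr5) // (fr_arr fr4) //= (fr_arr fr2) //.
    by rewrite (fr_arr fr1) // eZ0.
move=> h7 [[srt [eA7 ps7 so7 c7]] fr7].
have szP i : i < k -> size (nth [::] D i) = m by move=> ik; rewrite sP ?mem_nth ?sD.
have q7 o y : sa_reachable w n prep query (init_state [:: n] [:: packed w T]) o ->
    1 <= y <= n -> exists t st, [/\ exec w query (set_reg o 0 y) t st, t <= Qn,
      reg st 0 = suffix_array T y &
      sa_reachable w n prep query (init_state [:: n] [:: packed w T]) st].
  move=> R yn; have [t [st [ex tQ eo]]] := qok _ _ R yn.
  by exists t, st; split=> //; apply: sa_after_query R yn ex.
apply: wp_seq; apply: wp_conseq.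
  have TE a t : t < w -> bit (nth 0 (packed w T) a) t = nthb T (a * w + t).
    exact: bit_packed.
  apply: (wp_search w1 m0 nm nw2 n2 k2 sT szP (@nth_packed_lt w T) TE PE q7 _ _ eA7 ps7 so7 we).
  - have ev x : x \in [:: vNW; vMASK] -> var h7 x = var h4 x.
      by rewrite !inE => /orP[]/eqP->; rewrite (fr_var fr7) // (fr_var fr6) // (fr_var fr5).
    have ev' x : x \in [:: vN; vK; vM] -> var h7 x = var h0 x.
      by rewrite !inE => /or3P[]/eqP->; rewrite (fr_var fr7) // (fr_var fr6) //
         (fr_var fr5) // (fr_var fr4) //= (fr_var fr2) // (fr_var fr1).
    split; [by rewrite ev'|by rewrite ev'|by rewrite ev'| |by rewrite ev|by rewrite ev| |].
    + by rewrite (fr_var fr7) // (fr_var fr6) // (fr_var fr5) // (fr_var fr4).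
    + rewrite (fr_arr fr7) // (fr_arr fr6) // (fr_arr fr5) // (fr_arr fr4) //= (fr_arr fr2) //.
      by rewrite eT1.
    + by rewrite (fr_arr fr7).
  - rewrite (fr_orc fr7) // (fr_orc fr6) // (fr_orc fr5) // (fr_orc fr4) //=.
    exact: sa_after_prep exp.
move=> h8 [eA8 c8]; apply: wp_assign => //; split.
  rewrite /= eA8 /dm_answer; congr nat_of_bool.
  by rewrite -[D in RHS](mkseq_nth [::]) sD has_map; apply: eq_has.
rewrite /main_time.
have X : clk h7 + 33 <= 15 * w + 20 * (n %/ w) + Pn + 40 * 2 ^ d + 20 * k +
       nw * C * (100 * (k + 2 ^ d) + 200) + 300.
  by move: c1 c2 c4 c5 c6 c7; rewrite /=; lia.
have {}X : w * (clk h7 + 33) <= w * (15 * w + 20 * (n %/ w) + Pn + 40 * 2 ^ d + 20 * k +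
       nw * C * (100 * (k + 2 ^ d) + 200) + 300) by rewrite leq_mul2l X orbT.
apply: leq_trans (leq_add (leq_add X (leqnn _)) (leqnn _)).
by move: c8; rewrite /= !(mulnDr w (clk _)); lia.
Qed.
End Main.

(** * Finitely many instances *)

Definition cell := (nat + nat * nat)%type.

Definition cell_val (s : state) (o : cell) : nat :=
  match o with inl r => reg s r | inr (b, a) => bank s b a end.

Definition load_cell (o : cell) : prog :=
  match o with
  | inl r => BinOp OpOr 4 r r
  | inr (b, a) => Seq (SetConst 3 a) (Read 4 b 3)
  end.

Fixpoint switch (M : nat) (body : nat -> prog) : prog :=
  if M is v.+1 then
    Seq (SetConst 3 v) (Seq (BinOp OpEq 5 4 3) (If 5 (body v) (switch v body)))
  else Skip.

(** An arbitrary function [F] of finitely many words is tabulated: it is evaluated while the program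
    text is built, and each leaf stores a constant. *)
Fixpoint decision_tree (M : nat) (os : seq cell) (F : seq nat -> nat) : prog :=
  if os is o :: os' then
    Seq (load_cell o) (switch M (fun v => decision_tree M os' (fun vs => F (v :: vs))))
  else SetConst 0 (F [::]).

(** What the tree reads: [k], [m] and the banks. The size [n] is built into each tree. *)
Definition same_input (s s' : state) : Prop :=
  [/\ reg s' 1 = reg s 1, reg s' 2 = reg s 2 & bank s' = bank s].

Definition cell_ok (w : nat) (s : state) (o : cell) : bool :=
  (cell_val s o < 2 ^ w) &&
  match o with inl r => (r == 1) || (r == 2) | inr (_, a) => a < 2 ^ w end.

Lemma cell_val_same s s' w o : same_input s s' -> cell_ok w s o ->
  cell_val s' o = cell_val s o.
Proof.
move=> [e1 e2 e3] /andP[_]; case: o => [r|[b a]] /=; last by rewrite e3.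
by case/orP => /eqP ->.
Qed.

Lemma cell_ok_same s s' w o : same_input s s' -> cell_ok w s o -> cell_ok w s' o.
Proof. by move=> ss ok; rewrite /cell_ok (cell_val_same ss ok). Qed.

Lemma exec_switch w M body s v (Q : nat -> state -> Prop) : 0 < w -> M <= 2 ^ w ->
  reg s 4 = v -> v < M ->
  (forall s1, same_input s s1 -> exists u s', exec w (body v) s1 u s' /\ Q u s') ->
  exists u s' c, [/\ exec w (switch M body) s (c + u) s', c <= 3 * M & Q u s'].
Proof.
move=> w0; elim: M s => // M IH s Mw ev vM B.
set s1 := set_reg s 3 (trunc_word w M).
set s2 := set_reg s1 5 (binop_sem w OpEq (reg s1 4) (reg s1 3)).
have ss : same_input s s2 by [].
have e5 : reg s2 5 = (v == M).
  by rewrite /s2 regE /= weqE // ev truncE.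
case: (eqVneq v M) => [e|ne].
  have [u [s' [ex q]]] := B _ ss; exists u, s', 3; split=> //; last by lia.
  apply: (@exec_seq _ _ _ _ 1 _ u.+2); first exact: exec_const.
  apply: (@exec_seq _ _ _ _ 1 _ u.+1); first exact: exec_binop.
  by rewrite e in ex; apply: (@exec_if_true _ _ _ _ s2) => //; rewrite e5 e eqxx.
have [||//|s3 s3s|u [s' [c [ex cM q]]]] := IH s2 _ _ _ _.
- exact: ltnW.
- by [].
- by move: vM; rewrite ltnS leq_eqVlt (negbTE ne).
- by apply: B; case: ss => a1 a2 a3; case: s3s => b1 b2 b3; split; rewrite ?b1 ?b2 ?b3.
exists u, s', (3 + c); split=> //; last by lia.
apply: (@exec_seq _ _ _ _ 1 _ (c + u).+2); first exact: exec_const.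
apply: (@exec_seq _ _ _ _ 1 _ (c + u).+1); first exact: exec_binop.
by apply: (@exec_if_false _ _ _ _ s2) => //; rewrite e5 (negbTE ne).
Qed.

Lemma exec_decision_tree w os F s : 0 < w -> all (cell_ok w s) os ->
  exists u s', [/\ exec w (decision_tree (2 ^ w) os F) s u s',
    u <= size os * (3 * 2 ^ w + 2) + 1 &
    reg s' 0 = trunc_word w (F [seq cell_val s o | o <- os])].
Proof.
move=> w0; elim: os F s => [|o os IH] F s /=.
  by move=> _; eexists _, _; split; [exact: exec_const| |rewrite regE].
move=> /andP[ok oks].
have [s1 [t1 [ex1 t12 ss1 e4]]] : exists s1 t1, [/\ exec w (load_cell o) s t1 s1, t1 <= 2,
    same_input s s1 & reg s1 4 = cell_val s o].
  case: o ok => [r|[b a]] /andP[lt ok].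
    eexists _, _; split; [exact: exec_binop|by []|by []|].
    by rewrite regE /= /binop_sem PeanoNat.Nat.lor_diag truncE.
  eexists _, _; split; [exact: exec_seq (exec_const _ _ _ _) (exec_read _ _ _ _ _)|by []|by []|].
  by rewrite !regE /= truncE.
have [|s2 ss2|u [s' [c [ex cM [uQ q]]]]] := @exec_switch w (2 ^ w)
    (fun v => decision_tree (2 ^ w) os (fun vs => F (v :: vs))) s1 (cell_val s o)
    (fun u s' => u <= size os * (3 * 2 ^ w + 2) + 1 /\
       reg s' 0 = trunc_word w (F (cell_val s o :: [seq cell_val s o | o <- os]))) w0 (leqnn _) e4.
- by case/andP: ok.
- have ss : same_input s s2.
    by case: ss1 => a1 a2 a3; case: ss2 => b1 b2 b3; split; rewrite ?b1 ?b2 ?b3.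
  have oks2 : all (cell_ok w s2) os.
    by apply: sub_all oks => x; apply: cell_ok_same.
  have [u [s' [ex uQ e]]] := IH (fun vs => F (cell_val s o :: vs)) s2 oks2.
  exists u, s'; split=> //; split=> //; rewrite e; congr (trunc_word _ (F (_ :: _))).
  by apply/eq_in_map => x /(allP oks); apply: cell_val_same.
exists (t1 + (c + u)), s'; split=> //; first exact: exec_seq ex1 ex.
by rewrite mulSn; lia.
Qed.

Section Small.
Variables (w n : nat).
Hypotheses (w0 : 0 < w) (nw : n < 2 ^ w).

Definition input_cells : seq cell :=
  inl 1 :: inl 2 :: [seq inr (0, a) | a <- iota 0 (2 ^ w)] ++
                    [seq inr (1, a) | a <- iota 0 (2 ^ w)].

(** Layout of [input_cells]: [k], [m], then [2 ^ w] text words, then [2 ^ w] pattern words.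
    [dm_fits] ensures that the patterns fit into this range. *)
Definition decode (vs : seq nat) : nat :=
  let k := nth 0 vs 0 in let m := nth 0 vs 1 in
  dm_answer (mkseq (fun i => bit (nth 0 vs (2 + i %/ w)) (i %% w)) n)
    (mkseq (fun i => mkseq (fun l => bit
       (nth 0 vs (2 + (2 ^ w + (i * num_digits w m + l %/ w)))) (l %% w)) m) k).

Definition small_prog : prog := decision_tree (2 ^ w) input_cells decode.

Lemma exec_small k m T D s : 0 < k -> 0 < m -> dm_fits w k m ->
  size T = n -> size D = k -> (forall P, P \in D -> size P = m) ->
  reg s 1 = k -> reg s 2 = m -> bank s 0 = nth 0 (packed w T) ->
  bank s 1 = nth 0 (flatten [seq packed w P | P <- D]) ->
  exists u s', [/\ exec w small_prog s u s',
    u <= size input_cells * (3 * 2 ^ w + 2) + 1 & reg s' 0 = dm_answer T D].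
Proof.
move=> k0 m0 [mw kw] sT sD sP ek em e0 e1.
rewrite num_wordsE // in kw.
have km : k < 2 ^ w by apply: leq_ltn_trans kw; rewrite leq_pmulr.
have ok : all (cell_ok w s) input_cells.
  rewrite /= /cell_ok /= ek em km mw /= all_cat; apply/andP; split; apply/allP => o.
    by move=> /mapP[a]; rewrite mem_iota => aw -> /=; rewrite e0 nth_packed_lt.
  by move=> /mapP[a]; rewrite mem_iota => aw -> /=; rewrite e1 flatten_packed_lt.
have [u [s' [ex ub e]]] := exec_decision_tree decode w0 ok.
exists u, s'; split=> //; rewrite e.
have w2 : 1 < 2 ^ w by rewrite -{1}(expn0 2) ltn_exp2l.
rewrite truncE; last by rewrite /decode; case: dm_answer; rewrite ?w2 // ltnW.
rewrite /decode /= ek em; congr (nat_of_bool (dm_answer _ _)).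
  rewrite -[RHS](mkseq_nth false) sT; apply/eq_in_map => i; rewrite mem_iota => /= iN.
  have iw : i %/ w < 2 ^ w by apply: leq_ltn_trans (leq_div _ _) _; lia.
  rewrite map_cat nth_cat -map_comp size_map size_iota iw.
  rewrite (nth_map 0) ?size_iota // nth_iota //= e0 bit_packed ?ltn_mod //.
  by rewrite -divn_eq.
rewrite -[RHS](mkseq_nth [::]) sD; apply/eq_in_map => i; rewrite mem_iota => /= ik.
have sPi : size (nth [::] D i) = m by rewrite sP ?mem_nth ?sD.
rewrite -[RHS](mkseq_nth false) sPi; apply/eq_in_map => l; rewrite mem_iota => /= lm.
have lw : l %/ w < num_digits w m by rewrite ltnS leq_div2r //; lia.
have iw : i * num_digits w m + l %/ w < 2 ^ w.
  apply: leq_ltn_trans kw; rewrite (@leq_trans (i.+1 * num_digits w m)) //.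
    by rewrite mulSnr leq_add2l ltnW.
  by rewrite leq_mul2r ik orbT.
rewrite map_cat nth_cat -!map_comp size_map size_iota ltnNge leq_addr /= add0n addKn.
rewrite (nth_map 0) ?size_iota // nth_iota //= e1.
rewrite (@nth_flatten_const _ (packed w) D [::] (num_digits w m)) ?sD //; last first.
  by move=> P /sP sPm; rewrite size_mkseq sPm num_wordsE.
by rewrite bit_packed ?ltn_mod // -divn_eq.
Qed.
End Small.

(* Testing [n = v] in increasing order of [v] is safe even when the constants [v]
   overflow the word size: the test succeeds before an overflow occurs. *)
Fixpoint dispatch (small : nat -> prog) (main : prog) (v c : nat) : prog :=
  if c is c'.+1 then
    Seq (SetConst 3 v) (Seq (BinOp OpEq 4 0 3)
      (If 4 (small v) (dispatch small main v.+1 c')))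
  else main.

Definition same_but_scratch (s s' : state) : Prop :=
  (forall r, r != 3 -> r != 4 -> reg s' r = reg s r) /\ bank s' = bank s.

Lemma exec_dispatch w small main v c n s (Q : nat -> state -> Prop) : 0 < w ->
  reg s 0 = n -> n < 2 ^ w -> v <= n ->
  (forall r, r < nvars -> reg s r < 2 ^ w) ->
  (forall s1, same_but_scratch s s1 -> (forall r, r < nvars -> reg s1 r < 2 ^ w) ->
     exists u s', exec w (if n < v + c then small n else main) s1 u s' /\ Q u s') ->
  exists u s' x, [/\ exec w (dispatch small main v c) s (x + u) s', x <= 3 * c & Q u s'].
Proof.
move=> w0; elim: c v s => [|c IH] v s e0 nw vn rb B.
  rewrite addn0 ltnNge vn /= in B; have [//|//|u [s' [ex q]]] := B s.
  by exists u, s', 0.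
set s1 := set_reg s 3 (trunc_word w v).
set s2 := set_reg s1 4 (binop_sem w OpEq (reg s1 0) (reg s1 3)).
have ss : same_but_scratch s s2.
  by split=> // r /negbTE r3 /negbTE r4; rewrite !regE r3 r4.
have rb2 r : r < nvars -> reg s2 r < 2 ^ w.
  move=> rn; rewrite /s2 regE; case: eqP => _; first exact: binop_lt.
  by rewrite regE; case: eqP => _; [rewrite ltn_mod expn_gt0|exact: rb].
have e4 : reg s2 4 = (n == v).
  by rewrite /s2 regE /= weqE // e0 truncE //; exact: leq_ltn_trans vn nw.
case: (eqVneq n v) => [e|ne].
  have [u [s' [ex q]]] := B _ ss rb2; exists u, s', 3; split=> //; last by lia.
  rewrite e addnS ltnS leq_addr in ex.
  apply: (@exec_seq _ _ _ _ 1 _ u.+2); first exact: exec_const.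
  apply: (@exec_seq _ _ _ _ 1 _ u.+1); first exact: exec_binop.
  by apply: (@exec_if_true _ _ _ _ s2) => //; rewrite e4 e eqxx.
have e02 : reg s2 0 = n by rewrite ss.1.
have vn1 : v < n by rewrite ltn_neqAle eq_sym ne.
have B2 s3 : same_but_scratch s2 s3 -> (forall r, r < nvars -> reg s3 r < 2 ^ w) ->
    exists u s', exec w (if n < v.+1 + c then small n else main) s3 u s' /\ Q u s'.
  rewrite addSn -addnS => s3s rb3; apply: B => //; case: ss => a1 a2; case: s3s => b1 b2.
  by split=> [r r3 r4|]; rewrite ?b1 ?a1 ?b2.
have [u' [s' [x [ex xc q]]]] := IH v.+1 s2 e02 nw vn1 rb2 B2.
exists u', s', (3 + x); split=> //; last by lia.
apply: (@exec_seq _ _ _ _ 1 _ (x + u').+2); first exact: exec_const.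
apply: (@exec_seq _ _ _ _ 1 _ (x + u').+1); first exact: exec_binop.
by apply: (@exec_if_false _ _ _ _ s2) => //; rewrite e4 (negbTE ne).
Qed.

Local Open Scope ring_scope.

(** * Asymptotics *)

Section Log.
Variable R : realType.
Implicit Types (x y : R) (n : nat).

Lemma ln2_gt0 : 0 < ln (2 : R). Proof. by rewrite ln_gt0 // ltr1n. Qed.

Lemma ln2_ge0 : 0 <= ln (2 : R). Proof. exact: ltW ln2_gt0. Qed.

Lemma log2_ge0 x : 1 <= x -> 0 <= log2 x.
Proof. by move=> x1; apply: divr_ge0; [exact: ln_ge0|exact: ln2_ge0]. Qed.

Lemma log2_le x y : 0 < x -> x <= y -> log2 x <= log2 y.
Proof.
move=> x0 xy; rewrite ler_pM2r ?invr_gt0 ?ln2_gt0 // ler_ln // posrE //.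
exact: lt_le_trans x0 xy.
Qed.

Lemma log2M x y : 0 < x -> 0 < y -> log2 (x * y) = log2 x + log2 y.
Proof. by move=> x0 y0; rewrite /log2 lnM ?posrE // mulrDl. Qed.

Lemma log2X x n : 0 < x -> log2 (x ^+ n) = n%:R * log2 x.
Proof. by move=> x0; rewrite /log2 lnXn // mulrA mulr_natl. Qed.

Lemma log2_2 : log2 (2 : R) = 1.
Proof. by rewrite /log2 divff // gt_eqF // ln2_gt0. Qed.

Lemma log2_X2 n : log2 ((2 ^ n)%N%:R : R) = n%:R.
Proof. by rewrite natrX log2X // log2_2 mulr1. Qed.

Lemma leq_log2 (m n : nat) : (0 < m)%N -> (0 < n)%N ->
  log2 (m%:R : R) <= log2 n%:R -> (m <= n)%N.
Proof.
move=> m0 n0; rewrite ler_pM2r ?invr_gt0 ?ln2_gt0 // ler_ln ?posrE ?ltr0n //.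
by rewrite ler_nat.
Qed.

Lemma log2_nat_ge1 n : (2 <= n)%N -> 1 <= log2 (n%:R : R).
Proof. by move=> n2; rewrite -[leLHS]log2_2 log2_le // ler_nat. Qed.

Lemma log2_le_self n : (0 < n)%N -> log2 (n%:R : R) <= n%:R.
Proof.
move=> n0; rewrite -[leRHS]log2_X2 log2_le ?ltr0n // ler_nat.
exact/ltnW/ltn_expl.
Qed.

(** The sublinearity of the logarithm, applied to the square root of [x]. *)
Lemma log2_sqrt x : 0 < x -> log2 x <= 2 / ln 2 * Num.sqrt x.
Proof.
move=> x0; have s0 : 0 < Num.sqrt x by rewrite sqrtr_gt0.
rewrite -{1}(sqr_sqrtr (ltW x0)) log2X // -mulrA ler_pM2l // mulrC.
by rewrite ler_pM2r ?invr_gt0 ?ln2_gt0 // ltW // ln_sublinear.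
Qed.

(** This makes both log n and the square root of n of order at most n / log n. *)
Lemma log2_sqr x : 1 <= x -> log2 x ^+ 2 <= (2 / ln 2) ^+ 2 * x.
Proof.
move=> x1; have x0 : 0 < x by lra.
rewrite -{2}(sqr_sqrtr (ltW x0)) -exprMn ler_sqr ?nnegrE ?log2_ge0 ?log2_sqrt //.
by rewrite mulr_ge0 ?sqrtr_ge0 // divr_ge0 // ln2_ge0.
Qed.

Definition nat_ceil x : nat := `|Num.ceil x|%N.

Lemma nat_ceil_ge x : 0 <= x -> x <= (nat_ceil x)%:R.
Proof.
move=> x0; have c0 : 0 <= Num.ceil x by rewrite ceil_ge0; lra.
by rewrite /nat_ceil -[leRHS]/(`|Num.ceil x|%N%:Z%:~R) gez0_abs // ceil_ge.
Qed.

Lemma nat_ceil_le x : 0 <= x -> (nat_ceil x)%:R <= x + 1.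
Proof.
move=> x0; have c0 : 0 <= Num.ceil x by rewrite ceil_ge0; lra.
rewrite /nat_ceil -[leLHS]/(`|Num.ceil x|%N%:Z%:~R) gez0_abs //.
by have /andP[] := ceil_itv x; rewrite rmorphB /=; lra.
Qed.

End Log.

Section WordSize.
Variables (R : realType) (c : R) (n : nat).
Hypotheses (c2 : 2 <= c) (n2 : (2 <= n)%N).
Local Notation w := (word_size c n).
Local Notation L := (log2 (n%:R : R)).
Local Notation cc := (nat_ceil c).

Lemma cL_ge0 : 0 <= c * L.
Proof. by have hc := c2; have := log2_nat_ge1 R n2; move: (log2 _) => l L1; nra. Qed.

Lemma word_size_ge : c * L <= w%:R.
Proof. exact: nat_ceil_ge cL_ge0. Qed.

Lemma word_size_le : w%:R <= c * L + 1.
Proof. exact: nat_ceil_le cL_ge0. Qed.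

Lemma word_size_ge2 : (2 <= w)%N.
Proof.
rewrite -(ler_nat R); apply: le_trans word_size_ge.
have hc := c2; have := log2_nat_ge1 R n2; move: (log2 _) => l L1; nra.
Qed.

(** This is where [c >= 2] provides room: quantities linear in [n] will not overflow once [n] is
    large. *)
Lemma sqr_le_word : (n * n <= 2 ^ w)%N.
Proof.
apply: (@leq_log2 R); rewrite ?expn_gt0 ?muln_gt0 //; first by lia.
rewrite log2_X2 natrM log2M ?ltr0n ?(ltnW n2) //; apply: le_trans word_size_ge.
have hc := c2; have := log2_nat_ge1 R n2; move: (log2 _) => l L1; nra.
Qed.

Lemma ge_nat_ceil : c <= cc%:R.
Proof. by have hc := c2; apply: nat_ceil_ge; lra. Qed.

Lemma word_size_le_nat : (w <= cc * n + 1)%N.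
Proof.
rewrite -(ler_nat R) natrD natrM; apply: le_trans word_size_le _.
have := ge_nat_ceil; have := log2_le_self R (ltnW n2); have := log2_nat_ge1 R n2.
by have hc := c2; move: ((nat_ceil c)%:R : R) (n%:R : R) (log2 _) => a x l; nra.
Qed.

(** With [q = w %/ (2 * cc)], the bound [w <= c log n + 1] gives [2 * q <= log n + 1]. The statement
    says, without roots, that a table of [2 ^ d] entries has size O(sqrt n). *)
Lemma digit_size_le : (2 ^ (digit_size w (2 * cc)) * 2 ^ (digit_size w (2 * cc)) <= 8 * n)%N.
Proof.
have cc0 : (0 < cc)%N by rewrite -(ltr0n R); have hc := c2; have := ge_nat_ceil; lra.
set q := (w %/ (2 * cc))%N.
have qw : (q * (2 * cc) <= w)%N by apply: leq_divM.
suff : (2 ^ (2 * q) <= 2 * n)%N.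
  by rewrite /digit_size -/q mul2n -addnn expnD !expnS; nia.
apply: (@leq_log2 R); rewrite ?expn_gt0 ?muln_gt0 //; first by lia.
rewrite log2_X2 [(2 * n)%:R]natrM log2M ?ltr0n ?(ltnW n2) // log2_2 natrM.
rewrite -(ler_nat R) !natrM in qw.
have := word_size_le; have := ge_nat_ceil; have := log2_nat_ge1 R n2.
have := ler0n R q; move: qw; move: (w%:R : R) (cc%:R : R) (q%:R : R) (log2 _) => W A q' l qw q0 L1 cA wc.
have hc := c2; rewrite leNgt; apply/negP => bad.
have : A * (1 + l) < A * (2 * q') by rewrite ltr_pM2l //; lra.
nra.
Qed.

Lemma up_log_word_size : ((up_log 2 w)%:R : R) <= 1 + log2 w%:R.
Proof.
have /andP[lt _] := up_log_bounds (isT : (1 < 2)%N) word_size_ge2.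
have : log2 ((2 ^ (up_log 2 w).-1)%N%:R : R) <= log2 w%:R.
  by rewrite log2_le ?ltr0n ?expn_gt0 // ler_nat ltnW.
rewrite log2_X2; case: (up_log 2 w) => [|e] /=; last by rewrite -natr1; lra.
have w1 : 1 <= (w%:R : R) by rewrite ler1n (ltnW word_size_ge2).
by have := log2_ge0 w1; move: (log2 _) => l; lra.
Qed.

End WordSize.

(** The bounds by [2 ^ w] compare it with quantities at most linear in [n], while [2 ^ w] is at
    least [n * n]; the threshold on [n] leaves ample slack. *)
Lemma regime (cc b w n m : nat) : (2 <= cc)%N -> (2 <= w)%N -> (m <= b * w)%N -> 
  (n * n <= 2 ^ w)%N -> (w <= cc * n + 1)%N ->
  (10 * ((cc + 1) * (b + 2)) <= n)%N ->
  [/\ (n + m < 2 ^ w)%N,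
      (forall p, (p < n)%N -> (p %/ w + num_digits w m + 1 < 2 ^ w)%N),
      (2 * n + w + 1 < 2 ^ w)%N,
      (1 < 2 * cc < 2 ^ w)%N /\ (digit_size w (2 * cc) < w)%N &
      (num_digits w m * (2 * cc) < 2 ^ w)%N /\
      (2 * cc * digit_size w (2 * cc) < 2 ^ w)%N /\ (num_digits w m <= b + 1)%N].
Proof.
move=> cc2 w2 mb nn wn; set N := (10 * _)%N => Nn.
have NN : (N * n <= n * n)%N by rewrite leq_mul2r Nn orbT.
have nd : (num_digits w m <= b + 1)%N.
  rewrite /num_digits addn1 ltnS.
  apply: leq_trans (leq_div2r w (_ : m.-1 <= b * w)%N) _; first by lia.
  by rewrite mulnK //; lia.
have dwC : (2 * cc * digit_size w (2 * cc) <= w + 2 * cc)%N.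
  by rewrite /digit_size mulnS addnC leq_add2r mulnC leq_divM.
have dw : (digit_size w (2 * cc) < w)%N by nia.
have mn : (m <= b * (cc * n + 1))%N by rewrite (leq_trans mb) // leq_mul2l wn orbT.
have ndC : (num_digits w m * (2 * cc) <= (b + 1) * (2 * cc))%N by rewrite leq_mul2r nd orbT.
(* The products of parameters are expanded and compared with their multiples by [n] beforehand, so
   that linear arithmetic suffices for the conclusions. *)
have eN : N = (10 * (cc * b) + 20 * cc + 10 * b + 20)%N by rewrite /N; lia.
have NN' : (10 * (cc * b) * n + 20 * cc * n + 10 * b * n + 20 * n <= n * n)%N.
  by rewrite eN in NN; lia.
have cbn : (cc * b <= cc * b * n)%N by rewrite leq_pmulr //; lia.
have cn : (cc <= cc * n)%N by rewrite leq_pmulr //; lia.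
have bn : (b <= b * n)%N by rewrite leq_pmulr //; lia.
clearbody N; clear eN NN.
split.
- lia.
- move=> p pn; have := leq_div p w; lia.
- lia.
- split=> //; lia.
- split; [lia|split=> //; lia].
Qed.

(** * Running time in terms of n / log n *)

Lemma word_bound (R : realFieldType) (v b y : R) : v <= b + 1 -> 0 <= b -> 0 <= y ->
  y + 100 * v + 200 <= (100 * (b + 1) + 200) * (y + 1).
Proof. by move=> vb b0 y0; have : 0 <= b * y by [exact: mulr_ge0]; lra. Qed.

Lemma log_bound (R : realFieldType) (e lw lc ll : R) :
  e <= 1 + lw -> lw <= lc + ll -> 0 <= lc -> 0 <= ll -> e + 2 <= (3 + lc) * (1 + ll).
Proof. by move=> el ll' lc0 ll0; have : 0 <= lc * ll by [exact: mulr_ge0]; lra. Qed.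

(** Everything before the search. [X] stands for n / log n and [Y] for the target, which exceeds [X]
    by the factors 1 + log log n and Q + 1; each term but the preprocessing time [p] is a constant
    times [X], or at most one. *)
Lemma setup_bound (R : realFieldType) (w nq p D k v C X Y K1 K2 a B : R) :
  w <= K1 * X -> nq <= X -> D <= K2 * X -> k <= a * X -> v <= B -> 0 <= v -> 0 <= C ->
  0 <= k -> 0 <= D -> 1 <= X -> X <= Y -> 0 <= K1 -> 0 <= K2 -> 0 <= a ->
  15 * w + 20 * nq + p + 40 * D + 20 * k + v * C * (100 * (k + D) + 200) + 300 <=
  p + (15 * K1 + 20 + 40 * K2 + 20 * a + B * C * (100 * (a + K2) + 200) + 300) * Y.
Proof.
move=> wX nX DX kX vB v0 C0 k0 D0 X1 XY K10 K20 a0.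
have B0 : 0 <= B by lra.
have S0 : 0 <= 100 * (a + K2) + 200 by lra.
have BC0 : 0 <= B * C by apply: mulr_ge0.
have P0 := mulr_ge0 BC0 S0.
have P1 : v * C * (100 * (k + D) + 200) <= B * C * ((100 * (a + K2) + 200) * X).
  apply: ler_pM; [exact: mulr_ge0|lra|exact: ler_wpM2r|lra].
have X0 : 0 <= X by lra.
have P2 : B * C * ((100 * (a + K2) + 200) * X) <= B * C * (100 * (a + K2) + 200) * Y.
  by rewrite mulrA; apply: ler_wpM2l.
have Q1 := ler_wpM2l K10 XY; have Q2 := ler_wpM2l K20 XY; have Q3 := ler_wpM2l a0 XY.
move: P1 P2; move: (v * C * _) (B * C * (_ * X)) (B * C * (_ + 200)) => e1 e2 e3 P1 P2.
lra.
Qed.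

Section TimeBound.
Variables (R : realType) (c a2 b2 : R).

(** Constants of the single estimates: the square of log n against n, the table size against n / log
    n, the cost of a probe against Q + 1, and the bisection depth plus two against 1 + log log n. *)
Definition log_kappa : R := (2 / ln 2) ^+ 2.
Definition table_const : R := 8 * log_kappa + 1.
Definition word_const : R := 100 * ((nat_ceil b2)%:R + 1) + 200.
Definition log_const : R := 3 + log2 (c + 1).

Definition time_const : R :=
  15 * (c + 1) * log_kappa + 20 + 40 * table_const + 20 * a2 +
  ((nat_ceil b2)%:R + 1) * (2 * (nat_ceil c)%:R) * (100 * (a2 + table_const) + 200) +
  300 + word_const + a2 * word_const * log_const.

Lemma log_kappa_ge0 : 0 <= log_kappa. Proof. exact: sqr_ge0. Qed.

Lemma word_const_ge0 : 0 <= word_const.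
Proof. by have := ler0n R (nat_ceil b2); rewrite /word_const; lra. Qed.

Lemma table_const_ge0 : 0 <= table_const.
Proof. by have := log_kappa_ge0; rewrite /table_const; lra. Qed.

Lemma main_time_le (n k m u Pn Qn : nat) :
  2 <= c -> 0 < a2 -> (2 <= n)%N -> 
  k%:R <= a2 * (n%:R / log2 n%:R) ->
  (num_digits (word_size c n) m <= nat_ceil b2 + 1)%N ->
  (word_size c n * u <= main_time (word_size c n) n k m (2 * nat_ceil c)
      (up_log 2 (word_size c n)) Pn Qn)%N ->
  u%:R <= Pn%:R + time_const *
    (n%:R * (1 + log2 (log2 n%:R)) / log2 n%:R * (Qn%:R + 1)).
Proof.
move=> c2 a20 n2 ka nwb.
have wge := word_size_ge c2 n2; have wle := word_size_le c2 n2.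
have w2 := word_size_ge2 c2 n2; have dle := digit_size_le c2 n2.
have ele := up_log_word_size c2 n2; have cA := ge_nat_ceil c2.
have L1 := log2_nat_ge1 R n2.
have LN := log2_le_self R (ltnW n2).
have n1 : 1 <= (n%:R : R) by rewrite ler1n ltnW.
have LK : log2 n%:R ^+ 2 <= log_kappa * n%:R := log2_sqr n1.
have LL0 : 0 <= log2 (log2 (n%:R : R)) by apply: log2_ge0.
set w := word_size c n in wge wle w2 dle ele nwb *.
set e := up_log 2 w in ele *.
set nw := num_digits w m in nwb *.
set d := digit_size w _ in dle *.
set L := log2 n%:R in wge wle L1 LN LK LL0 ka *.
set LL := log2 L in LL0 *.
have eLL : LL = log2 L by [].
clearbody LL L.
have L0 : 0 < L by lra.
pose X : R := n%:R / L.
have n0 : 0 < (n%:R : R) by lra.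
have XL : X * L = n%:R by rewrite mulfVK // gt_eqF.
have X1 : 1 <= X by rewrite ler_pdivlMr // mul1r.
have X0 : 0 <= X by lra.
have K0 : 0 <= log_kappa := log_kappa_ge0.
have w0 : 0 < (w%:R : R) by rewrite ltr0n ltnW.
have c10 : 0 < c + 1 by clear -c2; lra.
have Lw : L <= w%:R by clear -c2 wge L1; nra.
have leX (x b : R) : x * L <= b * n%:R -> x <= b * X.
  by move=> h; rewrite /X mulrA ler_pdivlMr.
have T1 : w%:R <= (c + 1) * log_kappa * X.
  rewrite -mulrA; apply: (@le_trans _ _ ((c + 1) * L)); first by nra.
  rewrite ler_pM2l; last by lra.
  by apply: leX; rewrite -expr2.
have T2 : (n %/ w)%N%:R <= X.
  rewrite -[X]mul1r; apply: leX; rewrite mul1r.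
  apply: (@le_trans _ _ ((n %/ w)%N%:R * w%:R)); last by rewrite -natrM ler_nat leq_divM.
  by rewrite ler_wpM2l ?ler0n //; nra.
have T3 : (2 ^ d)%N%:R <= table_const * X.
  apply: leX; rewrite -ler_sqr ?nnegrE; last 2 first.
  - by rewrite mulr_ge0 ?ler0n //; lra.
  - by rewrite mulr_ge0 ?ler0n // /table_const; lra.
  rewrite !exprMn; apply: (@le_trans _ _ (8 * n%:R * (log_kappa * n%:R))).
    apply: ler_pM; [exact: sqr_ge0|exact: sqr_ge0| |exact: LK].
    by rewrite expr2 -!natrM ler_nat.
  have -> : 8 * n%:R * (log_kappa * n%:R) = 8 * log_kappa * n%:R ^+ 2 :> R by ring.
  (* The summand 1 in [table_const] serves here: the square of [8 * log_kappa + 1] exceeds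
     [8 * log_kappa], so no square root is needed. *)
  by rewrite ler_wpM2r ?sqr_ge0 // /table_const; nra.
have T4 : k%:R <= a2 * X by [].
have q1 : 1 <= Qn%:R + 1 :> R by rewrite lerDr ler0n.
set q := Qn%:R + 1 in q1 *.
have W0 := word_const_ge0.
have B0 : 0 <= ((nat_ceil b2)%:R : R) by rewrite ler0n.
have nwB : nw%:R <= (nat_ceil b2)%:R + 1 :> R by rewrite -[1]/(1%:R) -natrD ler_nat.
pose A := (Qn + 100 * nw + 200)%N.
have T5 : A%:R <= word_const * q.
  by rewrite /A /word_const /q !natrD natrM word_bound ?ler0n.
have T6 : (e + 2)%:R <= log_const * (1 + LL).
  have lw : log2 w%:R <= log2 (c + 1) + LL.
    rewrite eLL -log2M //; apply: log2_le => //.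
    by clear -wle L1; rewrite mulrDl mul1r; lra.
  have lc0 : 0 <= log2 (c + 1) by apply: log2_ge0; clear -c2; lra.
  by rewrite natrD; apply: log_bound ele lw lc0 LL0.
pose Y := X * (1 + LL) * q.
have -> : n%:R * (1 + LL) / L * q = Y by rewrite /Y /X; ring.
have XY : X <= Y.
  rewrite /Y -mulrA ler_peMr //; apply: (@le_trans _ _ (1 * 1)); first by rewrite mulr1.
  by apply: ler_pM => //; rewrite lerDl.
pose S := (15 * w + 20 * (n %/ w) + Pn + 40 * 2 ^ d + 20 * k +
       nw * (2 * nat_ceil c) * (100 * (k + 2 ^ d) + 200) + 300)%N.
move=> tm.
(* Division of [main_time] by [w]: setup, galloping and bisection. *)
have US : u%:R <= S%:R + A%:R * (n%:R / w%:R) + k%:R * (A%:R * (e + 2)%:R) :> R.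
  rewrite -(ler_pM2l w0) !mulrDr.
  have -> : w%:R * (A%:R * (n%:R / w%:R)) = A%:R * n%:R :> R.
    by field; rewrite gt_eqF.
  by rewrite -!natrM -!natrD ler_nat.
have nwX : n%:R / w%:R <= X :> R.
  by rewrite /X ler_pM2l // lef_pV2 ?posrE.
have M1 : A%:R * (n%:R / w%:R) <= word_const * Y :> R.
  apply: (@le_trans _ _ (word_const * q * X)).
    by apply: ler_pM; rewrite ?ler0n ?divr_ge0 ?ler0n.
  rewrite /Y -mulrA [q * X]mulrC ler_wpM2l // ler_wpM2r ?(le_trans ler01) //.
  by rewrite ler_peMr // lerDl.
have M2 : k%:R * (A%:R * (e + 2)%:R) <= a2 * word_const * log_const * Y.
  rewrite /Y; apply: (@le_trans _ _ (a2 * X * (word_const * q * (log_const * (1 + LL))))).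
    by apply: ler_pM; rewrite ?mulr_ge0 ?ler0n //; apply: ler_pM; rewrite ?ler0n.
  by rewrite le_eqVlt; apply/orP; left; apply/eqP; ring.
have M3 : S%:R <= Pn%:R +  (15 * (c + 1) * log_kappa + 20 + 40 * table_const + 20 * a2 +
  ((nat_ceil b2)%:R + 1) * (2 * (nat_ceil c)%:R) * (100 * (a2 + table_const) + 200) +
  300) * Y.
  rewrite /S !(natrD, natrM) -!(mulrA 15).
  apply: (@setup_bound R _ _ _ _ _ _ _ X) => //; [exact: mulr_ge0 (ltW c10) K0|exact: table_const_ge0|exact: ltW].
rewrite /time_const; move: US M1 M2 M3; clear; move: (S%:R) (A%:R * _) (k%:R * _) => s1 s2 s3; lra.
Qed.
End TimeBound.

(** * The reduction and its running time *)

Local Open Scope classical_set_scope.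
Local Open Scope ring_scope.

Lemma littleo_natP (R : realType) (f g : nat -> R) :
  f =o_\oo g <-> forall eps : R, 0 < eps ->
    exists N : nat, forall n : nat, (N <= n)%N -> `|f n| <= eps * `|g n|.
Proof.
split=> [/eqoP H eps e0|H].
  have [N _ HN] := H eps e0; exists N => n Nn; exact: HN.
by apply/eqoP => eps /H[N HN]; exists N => // n /= Nn; exact: HN.
Qed.

(** Rounding up and the additive constant are absorbed because [y >= 1]. *)
Lemma dm_time_bound (R : realFieldType) (x k C p y : R) : x <= k * y + 1 ->
  0 <= k -> 0 <= C -> 0 <= p -> 1 <= y -> p + x + C <= (k + 2 + C) * (p + y).
Proof.
move=> xy k0 C0 p0 y1.
have h1 : C <= C * y by apply: ler_peMr.
have h2 : 0 <= k * p by apply: mulr_ge0.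
have h3 : 0 <= C * p by apply: mulr_ge0.
lra.
Qed.

Section Reduction.
Variables (R : realType) (c a1 a2 b1 b2 : R) (prep query : prog) (P Q : nat -> nat).
Hypotheses (hc : 2 <= c) (ha : 0 < a1 <= a2) (hb : 0 < b1 <= b2).
Hypothesis hds : sa_data_structure c prep query P Q.

Definition query_cost (n : nat) : R :=
  n%:R * (1 + log2 (log2 n%:R)) / log2 n%:R * ((Q n)%:R + 1).

(** Holds because log n is at most n; it lets this term absorb additive constants. *)
Lemma query_cost_ge1 n : (2 <= n)%N -> 1 <= query_cost n.
Proof.
move=> n2; have L1 := log2_nat_ge1 R n2; have Ln := log2_le_self R (ltnW n2).
have LL := log2_ge0 L1.
have L0 : 0 < log2 (n%:R : R) by apply: lt_le_trans L1.
rewrite -[leLHS]mulr1; apply: ler_pM => //; last by rewrite lerDr ler0n.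
rewrite ler_pdivlMr // mul1r (le_trans Ln) // ler_peMr ?ler0n //.
by rewrite lerDl.
Qed.

Let cc := nat_ceil c.
Let b := nat_ceil b2.
Let N0 := (10 * ((cc + 1) * (b + 2)))%N.
Let small n := small_prog (word_size c n) n.
Let small_time n := (size (input_cells (word_size c n)) * (3 * 2 ^ word_size c n + 2) + 1)%N.
Let K := time_const c a2 b2.

Lemma time_const_ge0 : 0 <= K.
Proof.
have /andP[a10 a12] := ha; have a20 : 0 <= a2 := le_trans (ltW a10) a12.
have k0 := log_kappa_ge0 R; have t0 := table_const_ge0 R; have w0 := word_const_ge0 b2.
have c0 : 0 <= c := le_trans (ler0n R 2) hc.
have l0 : 0 <= log_const c by rewrite addr_ge0 // log2_ge0 // lerDr.
by rewrite /K /time_const; do ?[exact: ler0n|assumption|apply: addr_ge0|apply: mulr_ge0].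
Qed.

(** The last two summands are constants: the tests of [dispatch], three units each, and the times of
    all decision trees, summed in place of a maximum. *)
Definition dm_time (n : nat) : nat :=
  (P n + nat_ceil (K * query_cost n) + (3 * N0 + \sum_(v < N0) small_time v))%N.

Lemma reduction : solves_dm c a1 a2 b1 b2
  (dispatch small (main_prog (2 * cc)%N prep query) 0 N0) dm_time.
Proof.
move=> n k m T D [n2 k1 m1 /andP[_ ka] /andP[_ mb]] fits D'.
have [orc0 orc1] := hds T n2.
have /andP[a10 a12] := ha; have /andP[b10 b12] := hb.
set w := word_size c n in fits orc0 orc1 *.
have w2 : (2 <= w)%N := word_size_ge2 hc n2.
have nn : (n * n <= 2 ^ w)%N := sqr_le_word hc n2.
have wn : (w <= cc * n + 1)%N := word_size_le_nat hc n2.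
have sD : size D' = k by rewrite size_map size_tuple.
have sP S : S \in D' -> size S = m by move=> /mapP[x _ ->]; rewrite size_tuple.
have nw : (n < 2 ^ w)%N by apply: leq_trans nn; rewrite -{1}[n]mul1n ltn_pmul2r //; lia.
have [mw] := fits; rewrite num_wordsE //; last by lia.
move=> kw; have km : (k < 2 ^ w)%N by apply: leq_ltn_trans kw; rewrite leq_pmulr.
have bnd : forall r, (r < nvars)%N -> (reg (dm_input w n k m T D') r < 2 ^ w)%N.
  by case=> [|[|[|r]]] _ //=; rewrite nth_nil expn_gt0.
have [||u [s' [x [ex xc [ut e]]]]] := @exec_dispatch w small (main_prog (2 * cc)%N prep query)
    0 N0 n (dm_input w n k m T D')
    (fun u s' => (u <= P n + nat_ceil (K * query_cost n) + \sum_(v < N0) small_time v)%N /\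
       reg s' 0 = dm_answer T D') _ erefl nw isT bnd.
- by lia.
- move=> s1 [er eb] rb1; rewrite add0n; case: ltnP => nN.
    have [||||||||u [s' [ex ut e]]] := @exec_small w n _ nw k m T D' s1 _ _ fits _ sD sP.
    + by lia.
    + by lia.
    + by lia.
    + by rewrite size_tuple.
    + by rewrite er.
    + by rewrite er.
    + by rewrite eb.
    + by rewrite eb.
    exists u, s'; split=> //; split=> //; apply: leq_trans ut _.
    rewrite (bigD1 (Ordinal nN)) //= addnCA leq_addr //.
  have cc2 : (2 <= cc)%N by rewrite -(ler_nat R); apply: le_trans hc (ge_nat_ceil hc).
  have b20 : 0 <= b2 := le_trans (ltW b10) b12.
  have mbw : (m <= b * w)%N.
    rewrite -(ler_nat R) natrM (le_trans mb) //; apply: ler_pM => //.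
    - by apply: log2_ge0; rewrite ler1n; lia.
    - exact: nat_ceil_ge.
    - apply: le_trans (word_size_ge hc n2).
      apply: ler_peMl; first exact: le_trans ler01 (log2_nat_ge1 R n2).
      by apply: le_trans hc; rewrite ler1n.
  have [r1 r2 r3 [r4 r5] [r6 [r7 r8]]] := regime cc2 w2 mbw nn wn nN.
  have we : (w <= 2 ^ up_log 2 w)%N by apply: up_logP.
  have [||||||u [s' [ex ut e]]] := @main_exec w n k m (2 * cc)%N (up_log 2 w) (P n) (Q n) T D'
     prep query w2 m1 k1 r1 r2 r3 kw r4 r6 r7 r5 we (size_tuple T) sD sP (conj orc0 orc1) s1.
  + by rewrite er.
  + by rewrite er.
  + by rewrite er.
  + exact: rb1.
  (* The input fills only registers 0 to 2 and banks 0 and 1, and dispatching touches registers 3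
     and 4, so the zone of the subroutine is still zero. *)
  + by apply: state_eq => [r|b' a] /=; rewrite ?er ?eb //= ?nth_nil.
  + by move=> b' bb'; rewrite eb.
  exists u, s'; split=> //; split=> //.
  apply: (@leq_trans (P n + nat_ceil (K * query_cost n))%N); last exact: leq_addr.
  have a20 : 0 < a2 := lt_le_trans a10 a12.
  rewrite -(ler_nat R) natrD; apply: le_trans (main_time_le hc a20 n2 ka r8 ut) _.
  rewrite lerD2l; apply: nat_ceil_ge; apply: mulr_ge0; first exact: time_const_ge0.
  exact: le_trans ler01 (query_cost_ge1 n2).
exists (x + u)%N, s'; split=> //.
by rewrite /dm_time; lia.
Qed.

Lemma dm_time_littleo (g : nat -> R) :
  (fun n : nat => (P n)%:R + query_cost n) =o_\oo g ->
  (fun n : nat => (dm_time n)%:R : R) =o_\oo g.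
Proof.
move=> /littleo_natP H; apply/littleo_natP => eps e0.
set C := (3 * N0 + \sum_(v < N0) small_time v)%N.
have K0 := time_const_ge0; have C0 := ler0n R C.
pose M : R := K + 2 + C%:R.
have M0 : 0 < M by rewrite /M -addrA ltr_wpDl // ltr_pwDl.
have [N HN] := H _ (divr_gt0 e0 M0); exists (maxn N 2) => n.
rewrite geq_max => /andP[/HN Fn n2].
have G1 := query_cost_ge1 n2; have P0 := ler0n R (P n).
have G0 : 0 <= query_cost n by apply: le_trans G1.
have KG : 0 <= K * query_cost n by apply: mulr_ge0.
rewrite ger0_norm ?addr_ge0 // in Fn; rewrite (ger0_norm (ler0n R _)).
apply: (@le_trans _ _ (M * ((P n)%:R + query_cost n))); last first.
  by rewrite mulrC -ler_pdivlMr // mulrAC.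
rewrite /dm_time -/C natrD [(_ + nat_ceil _)%:R]natrD /M; move: (C%:R : R) C0 => C' C0.
exact: dm_time_bound (nat_ceil_le KG) K0 C0 P0 G1.
Qed.
End Reduction.

(** * Separate bounds on preprocessing and query time *)

Lemma log2_unbounded (R : realType) (M : R) : exists N : nat, forall n : nat,
  (N <= n)%N -> M <= log2 (n%:R : R).
Proof.
exists (2 ^ nat_ceil (Num.max M 0)%R)%N => n Nn.
apply: (@le_trans _ _ (Num.max M 0)); first by rewrite le_max lexx.
apply: (@le_trans _ _ (nat_ceil (Num.max M 0))%:R).
  by apply: nat_ceil_ge; rewrite le_max lexx orbT.
by rewrite -[leLHS]log2_X2 log2_le ?ltr0n ?expn_gt0 // ler_nat.
Qed.

(* With s the fourth root of log n, log log n = 2 log (s ^ 2) is O(s), whereas the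
   square root of log n is s ^ 2. *)
Lemma log2_log2_le (R : realType) (eps : R) : 0 < eps -> exists N : nat, forall n : nat,
  (N <= n)%N -> 1 + log2 (log2 (n%:R : R)) <= eps * Num.sqrt (log2 n%:R).
Proof.
move=> e0; pose B : R := 2 * (2 / ln 2).
have B0 : 0 <= B by rewrite mulr_ge0 // divr_ge0 // ln2_ge0.
have B1 : 0 < 1 + B by rewrite ltr_pwDl.
pose S : R := (1 + B) / eps.
have S0 : 0 < S by apply: divr_gt0.
have [N HN] := log2_unbounded (1 + S ^+ 2 ^+ 2); exists N => n /HN.
move: (log2 n%:R) => L LS.
have S2 : 0 <= S ^+ 2 ^+ 2 by apply: sqr_ge0.
have L1 : 1 <= L by apply: le_trans LS; rewrite lerDl.
have L0 : 0 < L by apply: lt_le_trans L1.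
set t := Num.sqrt L; set s := Num.sqrt t.
have t0 : 0 < t by rewrite sqrtr_gt0.
have s0 : 0 < s by rewrite sqrtr_gt0.
have tt : t ^+ 2 = L by rewrite sqr_sqrtr // ltW.
have ss : s ^+ 2 = t by rewrite sqr_sqrtr // ltW.
have s1 : 1 <= s.
  by rewrite -[leLHS]sqrtr1 ler_wsqrtr // -[leLHS]sqrtr1 ler_wsqrtr.
have Ss : S <= s.
  rewrite -[S](ger0_norm (ltW S0)) -sqrtr_sqr ler_wsqrtr //.
  rewrite -[leLHS](ger0_norm (sqr_ge0 S)) -sqrtr_sqr ler_wsqrtr //.
  by apply: le_trans LS; rewrite lerDr.
have LL : log2 L <= B * s.
  rewrite -tt log2X // /B -mulrA ler_wpM2l //; exact: log2_sqrt.
apply: (@le_trans _ _ ((1 + B) * s)).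
  by rewrite mulrDl mul1r lerD.
by rewrite -ss expr2 mulrA ler_wpM2r ?(ltW s0) // -ler_pdivrMl // mulrC.
Qed.

(** Here [l] is 1 + log log n and [t] the square root of [L]. The term splits as
    [n / L * (l * q + l)]; both summands are at most [eps / 3 * t], and [n / L * t = n / t]. *)
Lemma query_cost_le (R : realFieldType) (eps n L t l p q : R) :
  0 < eps -> 0 <= n -> 0 < t -> t ^+ 2 = L -> 1 <= l ->
  p <= eps / 3 * (n / t) -> q <= eps / 3 * (t / l) -> l <= eps / 3 * t ->
  p + n * l / L * (q + 1) <= eps * (n / t).
Proof.
move=> e0 n0 t0 tL l1 hp hq hl.
have l0 : 0 < l by lra.
have L0 : 0 < L by rewrite -tL exprn_gt0.
have c0 : 0 <= n / L by rewrite divr_ge0 // ltW.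
have lq : l * q <= eps / 3 * t.
  by rewrite [l * q]mulrC -ler_pdivlMr // -(mulrA (eps / 3)).
have H : n / L * (l * q + l) <= n / L * (eps / 3 * t + eps / 3 * t).
  by apply: ler_wpM2l => //; apply: lerD.
have E : n / L * t = n / t by rewrite -tL; field; rewrite gt_eqF.
have H' : n / L * (l * q + l) <= 2 * (eps / 3 * (n / t)).
  by apply: le_trans H _; rewrite -E le_eqVlt; apply/orP; left; apply/eqP; ring.
have -> : n * l / L * (q + 1) = n / L * (l * q + l) by ring.
move: hp H'; move: (n / L * _) (n / t) => x y; lra.
Qed.

Theorem corollary8p6 (R : realType) (c a1 a2 b1 b2 : R)
    (hc : 2 <= c) (ha : 0 < a1 <= a2) (hb : 0 < b1 <= b2)
    (hard : ~ exists (p : prog) (t : nat -> nat),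
        solves_dm c a1 a2 b1 b2 p t /\
        (fun n : nat => (t n)%:R : R)
          =o_\oo (fun n : nat => n%:R / Num.sqrt (log2 n%:R)))
    (prep query : prog) (P Q : nat -> nat)
    (hds : sa_data_structure c prep query P Q) :
  ~ ((fun n : nat => (P n)%:R +
         n%:R * (1 + log2 (log2 n%:R)) / log2 n%:R * ((Q n)%:R + 1) : R)
       =o_\oo (fun n : nat => n%:R / Num.sqrt (log2 n%:R))) /\
  ~ ((fun n : nat => (P n)%:R : R)
       =o_\oo (fun n : nat => n%:R / Num.sqrt (log2 n%:R)) /\
     (fun n : nat => (Q n)%:R : R)
       =o_\oo (fun n : nat => Num.sqrt (log2 n%:R) / (1 + log2 (log2 n%:R)))).
Proof.
have part1 : ~ ((fun n : nat => (P n)%:R + query_cost R Q n)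
       =o_\oo (fun n : nat => n%:R / Num.sqrt (log2 n%:R))).
  move=> H; apply: hard; do 2!eexists; split; first exact: reduction hc ha hb hds.
  exact: (dm_time_littleo b2 hc ha H).
split=> // -[/littleo_natP HP /littleo_natP HQ]; apply: part1.
apply/littleo_natP => eps e0.
(* One third each for the preprocessing, the queries, and the summand 1 added to the query time. *)
have e3 : 0 < eps / 3 by apply: divr_gt0.
have [N1 H1] := HP _ e3; have [N2 H2] := HQ _ e3; have [N3 H3] := log2_log2_le e3.
exists (maxn (maxn N1 N2) (maxn N3 2)) => n.
rewrite !geq_max => /andP[/andP[/H1 p1 /H2 p2] /andP[/H3 p3 n2]].
have L1 := log2_nat_ge1 R n2; have LL := log2_ge0 L1.
have L0 : 0 < log2 (n%:R : R) by apply: lt_le_trans L1.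
have t0 : 0 < Num.sqrt (log2 (n%:R : R)) by rewrite sqrtr_gt0.
have l1 : 1 <= 1 + log2 (log2 (n%:R : R)) by rewrite lerDl.
have G0 : 0 <= query_cost R Q n := le_trans ler01 (query_cost_ge1 R Q n2).
rewrite [X in X <= _]ger0_norm ?addr_ge0 ?ler0n // ger0_norm ?divr_ge0 ?ler0n ?sqrtr_ge0 //.
rewrite (ger0_norm (ler0n R _)) ger0_norm ?divr_ge0 ?ler0n ?sqrtr_ge0 // in p1.
rewrite (ger0_norm (ler0n R _)) ger0_norm in p2; last first.
  by rewrite divr_ge0 ?sqrtr_ge0 // (le_trans ler01).
by apply: query_cost_le => //; rewrite sqr_sqrtr // ltW.
Qed.
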